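(* Let $a=(a_\ell)_{\ell\in\mathbb{Z}}$ be a complex valued sequence satisfying Assumption A (see context) with $c_3>0$. Then its Green's function $(\mathcal{G}_j^n)_{(n,j)\in\mathbb{N}\times\mathbb{Z}}$ satisfies $$\lim_{n\to+\infty}\frac{1}{n^{1/8}}\sum_{j\in\mathbb{Z}}|\mathcal{G}_j^n|=\frac{8\,\Gamma(11/8)}{\sqrt3\,\pi^{3/2}}\,\frac{c_3^{1/2}}{c_4^{3/8}},$$ where $\Gamma(x):=\int_0^{+\infty}t^{x-1}e^{-t}\,dt$ for $x>0$.
   Context: For a finitely supported complex sequence $a=(a_\ell)_{\ell\in\mathbb{Z}}$, set $\widehat F_a(\theta):=\sum_{\ell\in\mathbb{Z}}a_\ell e^{i\ell\theta}$ (a trigonometric polynomial, extended holomorphically to $\theta\in\mathbb{C}$). Assumption A. The complex valued sequence $a$ is finitely supported and $\sum_{\ell}a_\ell=1$. For all $\theta\in[-\pi,\pi]\setminus\{0\}$, $|\widehat F_a(\theta)|<1$. Moreover there exist a real number $\alpha$, a nonzero real number $c_3$, a positive real number $c_4$ and a function $\varphi$ holomorphic on a neighborhood of $0$ such that, for $\theta\in\mathbb{C}$ close to $0$, $$\widehat F_a(\theta)=\exp\left(i\alpha\theta-ic_3\theta^3-c_4\theta^4+\theta^5\varphi(\theta)\right).$$ Laurent operator: $L_a$ maps a sequence $(u_j)_{j\in\mathbb{Z}}$ to $a\star u=(\sum_{\ell}a_\ell u_{j-\ell})_{j\in\mathbb{Z}}$. Green's function: $\mathcal{G}_j^n:=(L_a^n\boldsymbol{\delta})_j$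 for $n\in\mathbb{N}$, $j\in\mathbb{Z}$, where $\boldsymbol{\delta}_0=1$ and $\boldsymbol{\delta}_j=0$ for $j\ne0$. *)

(* Defs.v *)
From Stdlib Require Import Reals ZArith List.
From Coquelicot Require Import Coquelicot.

Open Scope R_scope.

(* Sums over Z, split as l >= 0 and l <= -1.  Series is a total operator that
   is meaningful for convergent series only; the sums below all have finitely
   many nonzero terms. *)
Definition RsumZ (f : Z -> R) : R :=
  Series (fun k : nat => f (Z.of_nat k)) +
  Series (fun k : nat => f (- Z.of_nat (S k))%Z).

Definition CsumZ (f : Z -> C) : C :=
  (RsumZ (fun l => Re (f l)), RsumZ (fun l => Im (f l))).

Definition finitely_supported (a : Z -> C) : Prop :=
  exists s : list Z, forall l : Z, a l <> RtoC 0 -> In l s.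

Definition Cexp (z : C) : C := (exp (Re z) * cos (Im z), exp (Re z) * sin (Im z)).

Definition Fhat (a : Z -> C) (theta : C) : C :=
  CsumZ (fun l => (a l * Cexp (Ci * RtoC (IZR l) * theta))%C).

Definition holomorphic_near (phi : C -> C) (z0 : C) : Prop :=
  locally z0 (fun z : C => ex_derive (K := C_AbsRing) (V := C_NormedModule) phi z).

(* alpha, c3 and c4 are the real numbers of the expansion at 0; they are
   determined by a. *)
Definition assumption_A (a : Z -> C) (alpha c3 c4 : R) : Prop :=
  finitely_supported a /\
  CsumZ a = RtoC 1 /\
  (forall theta : R, - PI <= theta <= PI -> theta <> 0 ->
     Cmod (Fhat a (RtoC theta)) < 1) /\
  c3 <> 0 /\
  0 < c4 /\
  exists phi : C -> C,
    holomorphic_near phi (RtoC 0) /\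
    locally (RtoC 0) (fun theta : C =>
      Fhat a theta =
      Cexp (Ci * RtoC alpha * theta - Ci * RtoC c3 * theta ^ 3
            - RtoC c4 * theta ^ 4 + theta ^ 5 * phi theta)%C).

Definition laurent (a u : Z -> C) : Z -> C :=
  fun j => CsumZ (fun l => (a l * u (j - l)%Z)%C).

Definition delta : Z -> C := fun j => if Z.eq_dec j 0 then RtoC 1 else RtoC 0.

Definition green (a : Z -> C) (n : nat) : Z -> C := Nat.iter n (laurent a) delta.

Definition Gamma (x : R) : R :=
  RInt_gen (fun t => Rpower t (x - 1) * exp (- t)) (at_right 0) (Rbar_locally p_infty).

(* Main.v *)
Require Import Defs.
From Stdlib Require Import Reals ZArith List Lra Lia Psatz.
From Coquelicot Require Import Coquelicot.
Open Scope R_scope.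

(* Put N = n^(1/4) and y = j - alpha n. Parseval's identity for F^n and for its
   centred derivative bounds the sums of |G_j|^2 and of y^2 |G_j|^2 by O(1/N) and
   O(N^3), so that up to a small multiple of N^(1/2) = n^(1/8) only the range
   eps^2 N^2 < |y| / (3 c3) < K^2 N^2 contributes to the l1 norm. There G_j equals
     M(y) = (1/pi) int_0^pi cos(y t + n c3 t^3) exp(-n c4 t^4) dt
   up to O(1/N^2), because F(t)^n exp(-i n alpha t) is close in L^1 to
   exp(-i n c3 t^3 - n c4 t^4), and M(y) = O(1/y) for y > 0. For y = -3 c3 N^2 xi^2
   the points t = +xi/N and t = -xi/N are stationary, and M(y) is an amplitude in xi
   times cos(2 N c3 xi^3 - pi/4), uniformly for xi in [eps, K]. Sums over j are
   within O(1) of integrals in y because M has Lipschitz constant O(1/N^2), and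
   |cos| averages to 2/pi. The remaining integral of sqrt(xi) exp(-c4 xi^4) is a
   Gamma value. *)

(** * Integrals of oscillating functions *)

(** The obstacle is that no single estimate works on the whole line. The error O(1/N^2) of the model
    is harmless only over O(N^2) indices, where it adds up to O(1), and the stationary phase formula
    degenerates near y = 0, where its two critical points merge. Cauchy-Schwarz disposes of both
    remaining ranges: about eps^2 N^2 indices with l2 mass O(1/N) cost eps N^(1/2), and beyond K^2
    N^2 the weighted mass O(N^3) against the tail of the sum of 1/y^2 costs N^(1/2) / K. The order
    N^3 rests on the centred derivative of the symbol being O(t^2), that is, on the vanishing of the
    first two moments of [a] about alpha. In the main range eps and K are fixed while n grows, so
    constants there may depend on them. The limit is assembled from the Jacobian 6 c3 N^2 xi, the
    squared Fresnel limit PI / 8, the mean of |cos| and the Gamma value. Every other integral over t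
    is dominated by the Lorentz profile 1 / (1 + (N t)^2), of mass at most PI / N, or handled by one
    integration by parts. *)

Lemma ex_RInt_cont (f : R -> R) (a b : R) :
  a <= b -> (forall x, a <= x <= b -> continuous f x) -> ex_RInt f a b.
Proof.
  intros Hab Hf. apply (ex_RInt_continuous (V := R_CompleteNormedModule)).
  intros z Hz. apply Hf. now rewrite Rmin_left, Rmax_right in Hz.
Qed.

Lemma ex_RInt_cont_all (f : R -> R) (a b : R) :
  (forall x, continuous f x) -> ex_RInt f a b.
Proof. intros Hf. apply (ex_RInt_continuous (V := R_CompleteNormedModule)). auto. Qed.

Lemma is_derive_continuous (f : R -> R) (x l : R) : is_derive f x l -> continuous f x.
Proof. intros H. apply (ex_derive_continuous (V := R_NormedModule)). now exists l. Qed.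

Lemma is_RInt_deriv (f df : R -> R) (a b : R) :
  a <= b -> (forall x, a <= x <= b -> is_derive f x (df x)) ->
  (forall x, a <= x <= b -> continuous df x) ->
  is_RInt df a b (f b - f a).
Proof.
  intros Hab Hd Hc. apply (is_RInt_derive (V := R_CompleteNormedModule) f df);
    intros x; rewrite Rmin_left, Rmax_right by assumption; auto.
Qed.

Lemma RInt_deriv (f df : R -> R) (a b : R) :
  a <= b -> (forall x, a <= x <= b -> is_derive f x (df x)) ->
  (forall x, a <= x <= b -> continuous df x) ->
  RInt df a b = f b - f a.
Proof. intros. apply is_RInt_unique. now apply is_RInt_deriv. Qed.

Lemma RInt_abs_le (f g : R -> R) (a b : R) :
  a <= b -> ex_RInt f a b -> ex_RInt g a b ->
  (forall x, a <= x <= b -> Rabs (f x) <= g x) ->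
  Rabs (RInt f a b) <= RInt g a b.
Proof.
  intros Hab Hf Hg H.
  eapply (norm_RInt_le (V := R_NormedModule) f g a b); try eassumption.
  - now apply (RInt_correct (V := R_CompleteNormedModule)).
  - now apply (RInt_correct (V := R_CompleteNormedModule)).
Qed.

Lemma RInt_abs_le_const (f : R -> R) (a b M : R) :
  a <= b -> ex_RInt f a b ->
  (forall x, a <= x <= b -> Rabs (f x) <= M) ->
  Rabs (RInt f a b) <= (b - a) * M.
Proof.
  intros Hab Hf H.
  replace ((b - a) * M) with (RInt (fun _ => M) a b).
  - apply RInt_abs_le; trivial. apply ex_RInt_const.
  - now rewrite RInt_const.
Qed.

Lemma RInt_plus_R (f g : R -> R) (a b : R) : ex_RInt f a b -> ex_RInt g a b ->
  RInt (fun x => f x + g x) a b = RInt f a b + RInt g a b.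
Proof. intros. now apply (RInt_plus (V := R_CompleteNormedModule)). Qed.

Lemma RInt_minus_R (f g : R -> R) (a b : R) : ex_RInt f a b -> ex_RInt g a b ->
  RInt (fun x => f x - g x) a b = RInt f a b - RInt g a b.
Proof. intros. now apply (RInt_minus (V := R_CompleteNormedModule)). Qed.

Lemma RInt_scal_R (f : R -> R) (c a b : R) : ex_RInt f a b ->
  RInt (fun x => c * f x) a b = c * RInt f a b.
Proof. intros. now apply (RInt_scal (V := R_CompleteNormedModule)). Qed.

Lemma RInt_Chasles_R (f : R -> R) (a b c : R) : ex_RInt f a b -> ex_RInt f b c ->
  RInt f a b + RInt f b c = RInt f a c.
Proof. intros. now apply (RInt_Chasles (V := R_CompleteNormedModule)). Qed.

Lemma RInt_ext_le (f g : R -> R) (a b : R) : a <= b ->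
  (forall x, a < x < b -> f x = g x) -> RInt f a b = RInt g a b.
Proof. intros Hab H. apply RInt_ext. intros x. now rewrite Rmin_left, Rmax_right; auto. Qed.

Lemma continuous_Rplus (f g : R -> R) x : continuous f x -> continuous g x ->
  continuous (fun t => f t + g t) x.
Proof. apply (continuous_plus (V := R_NormedModule)). Qed.
Lemma continuous_Rminus (f g : R -> R) x : continuous f x -> continuous g x ->
  continuous (fun t => f t - g t) x.
Proof. apply (continuous_minus (V := R_NormedModule)). Qed.
Lemma continuous_Rmult (f g : R -> R) x : continuous f x -> continuous g x ->
  continuous (fun t => f t * g t) x.
Proof. apply (continuous_mult (K := R_AbsRing)). Qed.
Lemma continuous_Rabs_comp (f : R -> R) x : continuous f x ->
  continuous (fun t => Rabs (f t)) x.
Proof. intros. apply (continuous_comp f Rabs); trivial. apply continuous_Rabs. Qed.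

(** Integration by parts against [H (Phi x)]. The function [h] is any one with a bounded primitive,
    because two cases are needed: [cos], and |cos| minus its mean. *)
Lemma osc_by_parts (H h Phi dPhi k dk : R -> R) (a b B : R) :
  a <= b ->
  (forall x, is_derive H x (h x)) -> (forall x, continuous h x) ->
  (forall x, Rabs (H x) <= B) ->
  (forall x, a <= x <= b -> is_derive Phi x (dPhi x)) ->
  (forall x, a <= x <= b -> continuous dPhi x) ->
  (forall x, a <= x <= b -> is_derive k x (dk x)) ->
  (forall x, a <= x <= b -> continuous dk x) ->
  Rabs (RInt (fun x => h (Phi x) * dPhi x * k x) a b) <=
  B * (Rabs (k a) + Rabs (k b) + RInt (fun x => Rabs (dk x)) a b).
Proof.
  intros Hab HH Hh HB HP HdP Hk Hdk.
  assert (cP : forall x, a <= x <= b -> continuous Phi x).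
  { intros x Hx. eapply is_derive_continuous; now apply HP. }
  assert (ck : forall x, a <= x <= b -> continuous k x).
  { intros x Hx. eapply is_derive_continuous; now apply Hk. }
  assert (cH : forall x, continuous H x).
  { intros x. eapply is_derive_continuous; now apply HH. }
  assert (c1 : forall x, a <= x <= b -> continuous (fun x => h (Phi x) * dPhi x * k x) x).
  { intros x Hx. apply continuous_Rmult; auto. apply continuous_Rmult; auto.
    apply (continuous_comp Phi h); auto. }
  assert (c2 : forall x, a <= x <= b -> continuous (fun x => H (Phi x) * dk x) x).
  { intros x Hx. apply continuous_Rmult; auto. apply (continuous_comp Phi H); auto. }
  assert (E : RInt (fun x => h (Phi x) * dPhi x * k x + H (Phi x) * dk x) a b =
     H (Phi b) * k b - H (Phi a) * k a).
  { apply (RInt_deriv (fun x => H (Phi x) * k x)); trivial.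
    - intros x Hx.
      evar_last.
      + apply (is_derive_mult (K := R_AbsRing) (fun x => H (Phi x)) k).
        * apply (is_derive_comp H Phi); auto.
        * auto.
        * intros; apply Rmult_comm.
      + simpl. unfold plus, mult, scal; simpl. unfold mult; simpl. ring.
    - intros x Hx. apply continuous_Rplus; auto. }
  rewrite RInt_plus_R in E by (apply ex_RInt_cont; auto).
  assert (E2 : Rabs (RInt (fun x => H (Phi x) * dk x) a b) <=
     RInt (fun x => B * Rabs (dk x)) a b).
  { apply RInt_abs_le; trivial.
    - apply ex_RInt_cont; auto.
    - apply ex_RInt_cont; auto. intros. apply continuous_Rmult.
      apply continuous_const. apply continuous_Rabs_comp; auto.
    - intros x Hx. rewrite Rabs_mult. apply Rmult_le_compat_r; auto. apply Rabs_pos. }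
  rewrite RInt_scal_R in E2.
  2:{ apply ex_RInt_cont; auto. intros. apply continuous_Rabs_comp; auto. }
  replace (RInt (fun x => h (Phi x) * dPhi x * k x) a b) with
    (H (Phi b) * k b - H (Phi a) * k a - RInt (fun x => H (Phi x) * dk x) a b) by lra.
  assert (Rabs (H (Phi b) * k b) <= B * Rabs (k b)).
  { rewrite Rabs_mult. apply Rmult_le_compat_r; auto. apply Rabs_pos. }
  assert (Rabs (H (Phi a) * k a) <= B * Rabs (k a)).
  { rewrite Rabs_mult. apply Rmult_le_compat_r; auto. apply Rabs_pos. }
  unfold Rminus.
  eapply Rle_trans; [ apply Rabs_triang |]. rewrite Rabs_Ropp.
  eapply Rle_trans; [ apply Rplus_le_compat_r, Rabs_triang |]. rewrite Rabs_Ropp. lra.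
Qed.

Lemma Rabs_cos_le x : Rabs (cos x) <= 1.
Proof. apply Rabs_le. generalize (COS_bound x); lra. Qed.

Lemma Rabs_sin_le x : Rabs (sin x) <= 1.
Proof. apply Rabs_le. generalize (SIN_bound x); lra. Qed.

(** For a decreasing nonnegative amplitude the total variation telescopes:
    [k a + k b + (k a - k b) = 2 * k a]. The bound does not see the length of the interval, so it
    also applies to ranges that grow with the parameter. *)
Lemma osc_decr (Phi dPhi k dk : R -> R) (a b : R) :
  a <= b ->
  (forall x, a <= x <= b -> is_derive Phi x (dPhi x)) ->
  (forall x, a <= x <= b -> continuous dPhi x) ->
  (forall x, a <= x <= b -> is_derive k x (dk x)) ->
  (forall x, a <= x <= b -> continuous dk x) ->
  (forall x, a <= x <= b -> dk x <= 0) -> 0 <= k b ->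
  Rabs (RInt (fun x => cos (Phi x) * dPhi x * k x) a b) <= 2 * k a.
Proof.
  intros Hab HP HdP Hk Hdk Hneg Hkb.
  assert (E : RInt (fun x => Rabs (dk x)) a b = k a - k b).
  { rewrite (RInt_ext_le _ (fun x => - dk x)); trivial.
    2:{ intros x Hx. rewrite Rabs_left1; auto. apply Hneg; lra. }
    replace (k a - k b) with (- k b - - k a) by ring.
    apply (RInt_deriv (fun x => - k x)); trivial.
    - intros x Hx. apply (is_derive_opp (V := R_NormedModule)). auto.
    - intros x Hx. apply (continuous_opp (V := R_NormedModule)). auto. }
  assert (0 <= k a - k b).
  { rewrite <- E.
    apply Rle_trans with (RInt (fun _ => 0) a b).
    - rewrite RInt_const. unfold scal; simpl; unfold mult; simpl; lra.
    - apply RInt_le; trivial. apply ex_RInt_const.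
      apply ex_RInt_cont; auto. intros. apply continuous_Rabs_comp; auto.
      intros. apply Rabs_pos. }
  eapply Rle_trans.
  - apply (osc_by_parts sin cos Phi dPhi k dk a b 1); auto using is_derive_sin, continuous_cos, Rabs_sin_le.
  - rewrite E, !Rabs_right by lra. lra.
Qed.

(** The form for amplitudes without monotonicity on a bounded range: the variation is at most the
    length times the supremum of the derivative. *)
Lemma osc_lip (Phi dPhi k dk : R -> R) (a b C D : R) :
  a <= b ->
  (forall x, a <= x <= b -> is_derive Phi x (dPhi x)) ->
  (forall x, a <= x <= b -> continuous dPhi x) ->
  (forall x, a <= x <= b -> is_derive k x (dk x)) ->
  (forall x, a <= x <= b -> continuous dk x) ->
  (forall x, a <= x <= b -> Rabs (dk x) <= D) ->
  (forall x, a <= x <= b -> Rabs (k x) <= C) ->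
  Rabs (RInt (fun x => cos (Phi x) * dPhi x * k x) a b) <= 2 * C + (b - a) * D.
Proof.
  intros Hab HP HdP Hk Hdk HD HC.
  eapply Rle_trans.
  - apply (osc_by_parts sin cos Phi dPhi k dk a b 1); auto using is_derive_sin, continuous_cos, Rabs_sin_le.
  - assert (Rabs (k a) <= C) by (apply HC; lra).
    assert (Rabs (k b) <= C) by (apply HC; lra).
    assert (RInt (fun x => Rabs (dk x)) a b <= (b - a) * D).
    { eapply Rle_trans; [ apply Rle_abs |]. apply RInt_abs_le_const; trivial.
      apply ex_RInt_cont; auto. intros; apply continuous_Rabs_comp; auto.
      intros. rewrite Rabs_Rabsolu. auto. }
    lra.
Qed.

Lemma exp_le (x y : R) : x <= y -> exp x <= exp y.
Proof.
  intros [H | ->]; [left; now apply exp_increasing | apply Rle_refl].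
Qed.

Lemma is_RInt_plus_R (f g : R -> R) (a b I J : R) : is_RInt f a b I -> is_RInt g a b J ->
  is_RInt (fun x => f x + g x) a b (I + J).
Proof. apply (is_RInt_plus (V := R_NormedModule)). Qed.

Lemma is_RInt_ext_eq (f g : R -> R) (a b I J : R) : is_RInt f a b I ->
  (forall x, f x = g x) -> I = J -> is_RInt g a b J.
Proof. intros H E <-. apply (is_RInt_ext f); auto. Qed.

(** * Fresnel integrals *)

Lemma is_derive_RInt_0 (f : R -> R) (t : R) : (forall x, continuous f x) ->
  is_derive (fun t => RInt f 0 t) t (f t).
Proof.
  intros Hf. apply (is_derive_RInt (V := R_NormedModule) f _ 0); auto.
  apply filter_forall. intros b.
  apply (RInt_correct (V := R_CompleteNormedModule)).
  apply ex_RInt_cont_all. auto.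
Qed.

Lemma is_derive_eq (f : R -> R) (x l l' : R) : is_derive f x l -> l = l' -> is_derive f x l'.
Proof. now intros H <-. Qed.

(** The limit is produced along the integers, and the rate then passes to the limit for every real
    [t]. It serves the Fresnel integrals and both ends of the Gamma integral, the end 0 being seen
    through t -> 1 / t. *)
Lemma cauchy_inv_rate (f : R -> R) :
  (forall s t, 0 < s <= t -> Rabs (f t - f s) <= / s) ->
  exists l, forall t, 0 < t -> Rabs (f t - l) <= / t.
Proof.
  intros H.
  assert (Hc : ex_finite_lim_seq (fun n => f (INR (S n)))).
  { apply ex_lim_seq_cauchy_corr. intros eps.
    destruct (archimed_cor1 eps (cond_pos eps)) as [N [HN HN0]].
    exists N.
    assert (W : forall n m, (N <= n)%nat -> (n <= m)%nat ->
       Rabs (f (INR (S m)) - f (INR (S n))) < eps).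
    { intros n m Hn Hm. eapply Rle_lt_trans; [| exact HN].
      assert (0 < INR N) by (apply lt_0_INR; lia).
      assert (INR N <= INR (S n)) by (apply le_INR; lia).
      eapply Rle_trans.
      - apply H. split. lra. apply le_INR; lia.
      - apply Rinv_le_contravar; lra. }
    intros n m Hn Hm. destruct (Nat.le_ge_cases n m).
    - rewrite Rabs_minus_sym. now apply W.
    - now apply W. }
  destruct Hc as [l Hl]. exists l. intros t Ht.
  assert (L : is_lim_seq (fun n => Rabs (f (INR (S n)) - f t)) (Rabs (l - f t))).
  { apply (is_lim_seq_abs _ (Finite (l - f t))).
    apply (is_lim_seq_minus' _ (fun _ => f t)); trivial. apply is_lim_seq_const. }
  rewrite Rabs_minus_sym.
  refine (is_lim_seq_le_loc (fun n => Rabs (f (INR (S n)) - f t)) (fun _ => / t)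
    (Finite (Rabs (l - f t))) (Finite (/ t)) _ L (is_lim_seq_const _)).
  destruct (nfloor_ex t) as [N [_ HN]]; [lra |].
  exists N. intros n Hn. apply H. split; trivial.
  apply Rle_trans with (INR N + 1); [lra |].
  rewrite S_INR. apply Rplus_le_compat_r, le_INR; lia.
Qed.

Definition fresnelC (t : R) : R := RInt (fun v => cos (v ^ 2)) 0 t.
Definition fresnelS (t : R) : R := RInt (fun v => sin (v ^ 2)) 0 t.

Ltac cont_auto := intros; apply (ex_derive_continuous (V := R_NormedModule)); auto_derive; trivial.

Lemma is_derive_fresnelC t : is_derive fresnelC t (cos (t ^ 2)).
Proof. apply (is_derive_RInt_0 (fun v => cos (v ^ 2))). cont_auto. Qed.
Lemma is_derive_fresnelS t : is_derive fresnelS t (sin (t ^ 2)).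
Proof. apply (is_derive_RInt_0 (fun v => sin (v ^ 2))). cont_auto. Qed.

Lemma is_derive_fresnel_phase (w t : R) :
  is_derive (fun t => cos w * fresnelC t + sin w * fresnelS t) t (cos (t ^ 2 - w)).
Proof.
  eapply is_derive_eq.
  - apply (is_derive_plus (V := R_NormedModule)); apply is_derive_scal.
    apply is_derive_fresnelC. apply is_derive_fresnelS.
  - unfold plus; simpl. rewrite cos_minus. ring.
Qed.

(** Writing 1 as 2v / (2v) exposes the derivative of the phase and leaves the decreasing amplitude 1
    / (2v). The shift [w] treats cosine and sine together: [w = 0] gives [fresnelC], [w = PI / 2]
    gives [fresnelS]. *)
Lemma fresnel_tail (w s t : R) : 0 < s <= t ->
  Rabs ((cos w * fresnelC t + sin w * fresnelS t) -
        (cos w * fresnelC s + sin w * fresnelS s)) <= / s.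
Proof.
  intros Hst.
  rewrite <- (RInt_deriv (fun t => cos w * fresnelC t + sin w * fresnelS t)
     (fun v => cos (v ^ 2 - w))); try lra.
  2:{ intros; apply is_derive_fresnel_phase. }
  2: cont_auto.
  rewrite (RInt_ext_le _ (fun v => cos (v ^ 2 - w) * (2 * v) * (/ (2 * v)))); try lra.
  2:{ intros x Hx. field. lra. }
  replace (/ s) with (2 * / (2 * s)) by (field; lra).
  apply (osc_decr (fun v => v ^ 2 - w) (fun v => 2 * v) (fun v => / (2 * v))
     (fun v => - / (2 * v ^ 2))); try lra.
  - intros x _. auto_derive; trivial. ring.
  - cont_auto.
  - intros x Hx. auto_derive. lra. field. lra.
  - cont_auto. apply Rgt_not_eq. nra.
  - intros x Hx. assert (0 < / (2 * x ^ 2)) by (apply Rinv_0_lt_compat; nra). lra.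
  - left. apply Rinv_0_lt_compat; lra.
Qed.

(* Euler's device: the left side of [fresnel_identity] below has the same derivative in [t]
   as this proper integral, which tends to 0 as [t] grows; [w = 0] and [w = PI / 2] then
   give [C^2 = S^2] and [2 C S = PI / 4] for the Fresnel limits. *)
Definition fresnel_aux (w t : R) : R :=
  RInt (fun x => sin (t ^ 2 * (1 + x ^ 2) - w) / (1 + x ^ 2)) 0 1.

Lemma is_derive_fresnel_aux (w t : R) :
  is_derive (fresnel_aux w) t
    (RInt (fun x => 2 * t * cos (t ^ 2 * (1 + x ^ 2) - w)) 0 1).
Proof.
  unfold fresnel_aux.
  assert (D : forall u v : R, is_derive
     (fun z : R => sin (z ^ 2 * (1 + v ^ 2) - w) / (1 + v ^ 2)) u
     (2 * u * cos (u ^ 2 * (1 + v ^ 2) - w))).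
  { intros u v. auto_derive. nra.
    replace (u * (u * 1) * (1 + v * (v * 1)) + - w) with (u ^ 2 * (1 + v ^ 2) - w) by ring.
    field. nra. }
  replace (RInt (fun x => 2 * t * cos (t ^ 2 * (1 + x ^ 2) - w)) 0 1) with
    (RInt (fun v => Derive (fun z : R => sin (z ^ 2 * (1 + v ^ 2) - w) / (1 + v ^ 2)) t) 0 1).
  2:{ apply RInt_ext_le. lra. intros x _. apply is_derive_unique, D. }
  apply (is_derive_RInt_param (fun t x => sin (t ^ 2 * (1 + x ^ 2) - w) / (1 + x ^ 2))).
  - apply filter_forall. intros u v _. eexists; apply D.
  - intros v _.
    apply continuity_2d_pt_ext with (fun u v => 2 * u * cos (u ^ 2 * (1 + v ^ 2) - w)).
    { intros. symmetry. apply is_derive_unique, D. }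
    apply continuity_2d_pt_mult.
    { apply continuity_2d_pt_mult. apply continuity_2d_pt_const. apply continuity_2d_pt_id1. }
    apply (continuity_1d_2d_pt_comp cos). { apply continuity_cos. }
    apply continuity_2d_pt_minus. 2: apply continuity_2d_pt_const.
    apply continuity_2d_pt_mult.
    + apply (continuity_1d_2d_pt_comp (fun z => z ^ 2)).
      apply derivable_continuous_pt, derivable_pt_pow. apply continuity_2d_pt_id1.
    + apply continuity_2d_pt_plus. apply continuity_2d_pt_const.
      apply (continuity_1d_2d_pt_comp (fun z => z ^ 2)).
      apply derivable_continuous_pt, derivable_pt_pow. apply continuity_2d_pt_id2.
  - apply filter_forall. intros u. apply ex_RInt_cont. lra.
    cont_auto. nra.
Qed.

(** Substituting u = t x turns the phase into u^2 + (t^2 - w), and the addition formula separates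
    the two parts. This expresses half the derivative of [fresnel_aux] through the Fresnel
    integrals. *)
Lemma RInt_cos_sum (w t : R) :
  RInt (fun x => t * cos (t ^ 2 * (1 + x ^ 2) - w)) 0 1 =
  cos (t ^ 2 - w) * fresnelC t - sin (t ^ 2 - w) * fresnelS t.
Proof.
  rewrite (RInt_ext_le _ (fun x => scal t ((fun u => cos (u ^ 2 + t ^ 2 - w)) (t * x + 0)))).
  2: lra.
  2:{ intros x _. unfold scal; simpl; unfold mult; simpl. do 2 f_equal. ring. }
  rewrite (RInt_comp_lin (V := R_CompleteNormedModule) (fun u => cos (u ^ 2 + t ^ 2 - w))).
  2:{ apply ex_RInt_cont_all. cont_auto. }
  replace (t * 0 + 0) with 0 by ring. replace (t * 1 + 0) with t by ring.
  unfold fresnelC, fresnelS.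
  rewrite <- !RInt_scal_R, <- RInt_minus_R;
    try (apply (ex_RInt_continuous (V := R_CompleteNormedModule)); cont_auto).
  apply RInt_ext. intros x _. simpl.
  replace (x * (x * 1) + t * (t * 1) - w) with ((t * (t * 1) - w) + x * (x * 1)) by ring.
  rewrite cos_plus. ring.
Qed.

Lemma fresnel_identity (w t : R) : 0 <= t ->
  cos w * (fresnelC t ^ 2 - fresnelS t ^ 2) + sin w * (2 * fresnelC t * fresnelS t) =
  fresnel_aux w t + sin w * (PI / 4).
Proof.
  intros Ht.
  set (f := fun t => cos w * (fresnelC t ^ 2 - fresnelS t ^ 2)
     + sin w * (2 * fresnelC t * fresnelS t) - fresnel_aux w t).
  assert (D : forall s, is_derive f s 0).
  { intros s. unfold f.
    assert (DC := is_derive_fresnelC s). assert (DS := is_derive_fresnelS s).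
    assert (DA := is_derive_fresnel_aux w s).
    eapply is_derive_eq.
    - apply (is_derive_minus (V := R_NormedModule)); [| apply DA].
      apply (is_derive_plus (V := R_NormedModule)); apply is_derive_scal.
      + apply (is_derive_minus (V := R_NormedModule)); apply is_derive_pow; eassumption.
      + apply (is_derive_mult (K := R_AbsRing) (fun s => 2 * fresnelC s) fresnelS).
        * apply is_derive_scal; eassumption.
        * eassumption.
        * intros; apply Rmult_comm.
    - rewrite (RInt_ext_le _ (fun x => 2 * (s * cos (s ^ 2 * (1 + x ^ 2) - w)))); try lra.
      2:{ intros; ring. }
      rewrite RInt_scal_R.
      2:{ apply ex_RInt_cont. lra. cont_auto. }
      rewrite RInt_cos_sum, cos_minus, sin_minus.
      unfold plus, minus, plus, opp, mult; simpl. ring. }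
  assert (E : f t - f 0 = 0).
  { rewrite <- (RInt_deriv f (fun _ => 0)); trivial.
    - rewrite RInt_const. unfold scal; simpl; unfold mult; simpl; ring.
    - intros. apply continuous_const. }
  (* At 0 both Fresnel integrals vanish, and the auxiliary integral is - sin w times the integral of
     1 / (1 + x^2) over [0, 1], an arctangent: this is where PI / 4 enters. *)
  assert (E0 : f 0 = sin w * (PI / 4)).
  { unfold f, fresnelC, fresnelS. rewrite !RInt_point. unfold zero; simpl.
    unfold fresnel_aux.
    rewrite (RInt_ext_le _ (fun x => - sin w * (/ (1 + x²)))); try lra.
    2:{ intros x _. unfold Rsqr. replace (0 ^ 2 * (1 + x ^ 2) - w) with (- w) by ring.
        rewrite sin_neg. field. nra. }
    rewrite RInt_scal_R.
    2:{ apply ex_RInt_cont. lra. cont_auto. unfold Rsqr. nra. }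
    rewrite (RInt_deriv atan); try lra.
    - rewrite atan_1, atan_0. field.
    - intros. apply is_derive_atan.
    - cont_auto. unfold Rsqr. nra. }
  unfold f in E, E0. lra.
Qed.

(** On [0, 1] the phase is stationary at x = 0 only, so the range is cut at x = 1 / t. The piece
    near 0 is bounded by its length, the other one by the amplitude at the cut, and both are at most
    1 / t. *)
Lemma fresnel_aux_bound (w t : R) : 1 <= t -> Rabs (fresnel_aux w t) <= 2 / t.
Proof.
  intros Ht. unfold fresnel_aux.
  assert (0 < / t) by (apply Rinv_0_lt_compat; lra).
  assert (/ t <= 1) by (rewrite <- Rinv_1; apply Rinv_le_contravar; lra).
  assert (C : forall x, continuous (fun x => sin (t ^ 2 * (1 + x ^ 2) - w) / (1 + x ^ 2)) x).
  { cont_auto. nra. }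
  rewrite <- (RInt_Chasles_R _ 0 (/ t) 1); try (apply ex_RInt_cont; [lra | auto]).
  eapply Rle_trans; [apply Rabs_triang |].
  replace (2 / t) with (/ t + / t) by (field; lra).
  apply Rplus_le_compat.
  - rewrite <- (Rmult_1_r (/ t)) at 2. rewrite <- (Rminus_0_r (/ t)) at 2.
    apply RInt_abs_le_const; try lra. apply ex_RInt_cont; [lra | auto].
    intros x Hx. unfold Rdiv. rewrite Rabs_mult, <- (Rmult_1_r 1).
    apply Rmult_le_compat; try apply Rabs_pos. apply Rabs_sin_le.
    rewrite Rabs_right.
    + rewrite <- Rinv_1. apply Rinv_le_contravar; nra.
    + left. apply Rinv_0_lt_compat. nra.
  (* The shift by PI / 2 turns the sine into the cosine that [osc_decr] expects. *)
  - rewrite (RInt_ext_le _ (fun x => cos (t ^ 2 * (1 + x ^ 2) - w - PI / 2) * (2 * t ^ 2 * x) *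
       (/ (2 * t ^ 2 * x * (1 + x ^ 2))))); try lra.
    2:{ intros x Hx. rewrite (cos_minus _ (PI / 2)), cos_PI2, sin_PI2.
        field. split; [nra | split; lra]. }
    eapply Rle_trans.
    + apply (osc_decr (fun x => t ^ 2 * (1 + x ^ 2) - w - PI / 2)
        (fun x => 2 * t ^ 2 * x) (fun x => / (2 * t ^ 2 * x * (1 + x ^ 2)))
        (fun x => - (2 * t ^ 2 * (1 + 3 * x ^ 2)) / (2 * t ^ 2 * x * (1 + x ^ 2)) ^ 2));
      try lra.
      * intros. auto_derive; trivial. ring.
      * cont_auto.
      * intros x Hx. assert (0 < 2 * t ^ 2 * x * (1 + x ^ 2)).
        { repeat apply Rmult_lt_0_compat; try lra; nra. }
        auto_derive. simpl in *; lra. field. repeat split; try lra; nra.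
      * intros x Hx. assert (0 < 2 * t ^ 2 * x * (1 + x ^ 2)).
        { repeat apply Rmult_lt_0_compat; try lra; nra. }
        cont_auto. simpl in *. apply Rgt_not_eq. nra.
      * intros x Hx. assert (0 < 2 * t ^ 2 * x * (1 + x ^ 2)).
        { repeat apply Rmult_lt_0_compat; try lra; nra. }
        assert (0 < / (2 * t ^ 2 * x * (1 + x ^ 2)) ^ 2).
        { apply Rinv_0_lt_compat. apply pow_lt. trivial. }
        unfold Rdiv. assert (0 <= 2 * t ^ 2 * (1 + 3 * x ^ 2)) by nra. nra.
      * left. apply Rinv_0_lt_compat. nra.
    + replace (2 * t ^ 2 * / t * (1 + (/ t) ^ 2)) with (2 * t * (1 + (/ t) ^ 2)) by (field; lra).
      replace (/ t) with (2 * / (2 * t)) at 2 by (field; lra).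
      apply Rmult_le_compat_l. lra. apply Rinv_le_contravar. lra.
      assert (0 <= (/ t) ^ 2) by nra. nra.
Qed.

Lemma squeeze_0 (x C : R) : (forall t, 1 <= t -> Rabs x <= C / t) -> x = 0.
Proof.
  intros H. destruct (Req_dec x 0) as [|Hx]; trivial. exfalso.
  assert (0 < Rabs x) by now apply Rabs_pos_lt.
  assert (H1 := H 1 (Rle_refl 1)). assert (Rabs x <= C) by lra.
  assert (H3 : 1 <= 2 * C / Rabs x).
  { apply Rmult_le_reg_r with (Rabs x); trivial. unfold Rdiv.
    rewrite Rmult_assoc, Rinv_l; lra. }
  assert (H4 := H _ H3).
  replace (C / (2 * C / Rabs x)) with (Rabs x / 2) in H4 by (field; lra). lra.
Qed.

(** Obtained from [fresnel_identity] at [w = 0] and [w = PI / 2], all errors being O(1 / t). Only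
    the square of [Ci] is recorded: its sign disappears when absolute values are taken. *)
Lemma fresnel_limit :
  exists Ci Si : R,
    (forall t, 0 < t -> Rabs (fresnelC t - Ci) <= / t) /\
    (forall t, 0 < t -> Rabs (fresnelS t - Si) <= / t) /\
    Ci = Si /\ Ci ^ 2 = PI / 8.
Proof.
  destruct (cauchy_inv_rate fresnelC) as [Ci HC].
  { intros s t H. assert (E := fresnel_tail 0 s t H). rewrite cos_0, sin_0 in E.
    replace (fresnelC t - fresnelC s) with
     (1 * fresnelC t + 0 * fresnelS t - (1 * fresnelC s + 0 * fresnelS s)) by ring. trivial. }
  destruct (cauchy_inv_rate fresnelS) as [Si HS].
  { intros s t H. assert (E := fresnel_tail (PI / 2) s t H). rewrite cos_PI2, sin_PI2 in E.
    replace (fresnelS t - fresnelS s) with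
     (0 * fresnelC t + 1 * fresnelS t - (0 * fresnelC s + 1 * fresnelS s)) by ring. trivial. }
  exists Ci, Si. split; [exact HC | split; [exact HS |]].
  assert (BC : forall t, 1 <= t -> Rabs (fresnelC t) <= Rabs Ci + 1).
  { intros t Ht. assert (E := HC t ltac:(lra)).
    assert (/ t <= 1) by (rewrite <- Rinv_1; apply Rinv_le_contravar; lra).
    replace (fresnelC t) with (Ci + (fresnelC t - Ci)) by ring.
    eapply Rle_trans; [apply Rabs_triang | lra]. }
  assert (BS : forall t, 1 <= t -> Rabs (fresnelS t) <= Rabs Si + 1).
  { intros t Ht. assert (E := HS t ltac:(lra)).
    assert (/ t <= 1) by (rewrite <- Rinv_1; apply Rinv_le_contravar; lra).
    replace (fresnelS t) with (Si + (fresnelS t - Si)) by ring.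
    eapply Rle_trans; [apply Rabs_triang | lra]. }
  assert (P : forall A a B b t, 1 <= t -> Rabs (a - A) <= / t -> Rabs (b - B) <= / t ->
     Rabs b <= Rabs B + 1 ->
     Rabs (a * b - A * B) <= (Rabs A + Rabs B + 1) / t).
  { intros A a B b t Ht Ha Hb Hb'.
    replace (a * b - A * B) with ((a - A) * b + A * (b - B)) by ring.
    assert (0 < / t) by (apply Rinv_0_lt_compat; lra).
    eapply Rle_trans; [apply Rabs_triang |]. rewrite !Rabs_mult.
    assert (0 <= Rabs (a - A)) by apply Rabs_pos. assert (0 <= Rabs A) by apply Rabs_pos.
    assert (0 <= Rabs b) by apply Rabs_pos. assert (0 <= Rabs (b - B)) by apply Rabs_pos.
    unfold Rdiv. nra. }
  assert (E1 : Ci * Ci - Si * Si = 0).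
  { apply (squeeze_0 _ (2 + (Rabs Ci + Rabs Ci + 1) + (Rabs Si + Rabs Si + 1))).
    intros t Ht.
    assert (I := fresnel_identity 0 t ltac:(lra)). rewrite cos_0, sin_0 in I.
    assert (A := fresnel_aux_bound 0 t Ht).
    assert (P1 := P Ci _ Ci _ t Ht (HC t ltac:(lra)) (HC t ltac:(lra)) (BC t Ht)).
    assert (P2 := P Si _ Si _ t Ht (HS t ltac:(lra)) (HS t ltac:(lra)) (BS t Ht)).
    unfold Rdiv in *. rewrite !Rmult_plus_distr_r in *.
    apply Rabs_le_between in A. apply Rabs_le_between in P1. apply Rabs_le_between in P2.
    apply Rabs_le. nra. }
  assert (E2 : 2 * Ci * Si - PI / 4 = 0).
  { apply (squeeze_0 _ (2 + 2 * (Rabs Ci + Rabs Si + 1))).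
    intros t Ht.
    assert (I := fresnel_identity (PI / 2) t ltac:(lra)). rewrite cos_PI2, sin_PI2 in I.
    assert (A := fresnel_aux_bound (PI / 2) t Ht).
    assert (P1 := P Ci _ Si _ t Ht (HC t ltac:(lra)) (HS t ltac:(lra)) (BS t Ht)).
    unfold Rdiv in *. rewrite !Rmult_plus_distr_r in *.
    apply Rabs_le_between in A. apply Rabs_le_between in P1.
    apply Rabs_le. nra. }
  assert (0 < PI) by apply PI_RGT_0.
  assert (E3 : (Ci - Si) * (Ci + Si) = 0) by (rewrite <- E1; ring).
  (* The alternative [Ci = - Si] contradicts 2 Ci Si = PI / 4 > 0. *)
  apply Rmult_integral in E3. assert (Ci = Si) by (destruct E3; [lra |]; replace Si with (- Ci) in * by lra; nra).
  split; trivial. subst Si. lra.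
Qed.

(** * Stationary phase for the cubic phase *)

Lemma lip_of_deriv (f df : R -> R) (a b L : R) :
  (forall x, a <= x <= b -> is_derive f x (df x)) ->
  (forall x, a <= x <= b -> continuous df x) ->
  (forall x, a <= x <= b -> Rabs (df x) <= L) ->
  forall x y, a <= x <= b -> a <= y <= b -> Rabs (f y - f x) <= L * Rabs (y - x).
Proof.
  intros Hd Hc HL.
  assert (W : forall x y, a <= x -> x <= y -> y <= b -> Rabs (f y - f x) <= L * Rabs (y - x)).
  { intros x y Hx Hxy Hy.
    rewrite <- (RInt_deriv f df); trivial; try (intros; (apply Hd || apply Hc); lra).
    rewrite (Rabs_right (y - x)), Rmult_comm by lra.
    apply RInt_abs_le_const; trivial.
    - apply ex_RInt_cont; trivial. intros; apply Hc; lra.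
    - intros; apply HL; lra. }
  intros x y Hx Hy. destruct (Rle_dec x y).
  - apply W; lra.
  - rewrite Rabs_minus_sym, (Rabs_minus_sym y). apply W; lra.
Qed.

(* The phase [s^3 - 3 xi^2 s + 2 xi^3], with a double zero at its critical point [xi]. *)
Definition cubic (xi s : R) : R := (s - xi) ^ 2 * (s + 2 * xi).

Lemma is_derive_cubic lam w xi s :
  is_derive (fun s => lam * cubic xi s - w) s (3 * lam * ((s - xi) * (s + xi))).
Proof. unfold cubic. auto_derive; trivial. ring. Qed.

(** The integrand is divided by the derivative 3 lam (s - xi) (s + xi) of the phase. The linear
    vanishing of [g] at [xi] cancels one factor s - xi: the quotient is O(1 / lam) and its
    derivative O(1 / (lam eta)), where a general amplitude would give 1 / (lam eta^2). *)
Lemma osc_away (lam w xi eta eps K L p q : R) (g dg : R -> R) :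
  0 < lam -> 0 < eta <= 1 -> 0 < eps <= xi -> xi <= K ->
  0 <= p <= q -> q <= 2 * K ->
  (forall s, p <= s <= q -> eta <= Rabs (s - xi)) ->
  (forall s, p <= s <= q -> is_derive g s (dg s)) ->
  (forall s, p <= s <= q -> continuous dg s) ->
  (forall s, p <= s <= q -> Rabs (dg s) <= L) ->
  (forall s, p <= s <= q -> Rabs (g s) <= L * Rabs (s - xi)) ->
  Rabs (RInt (fun s => cos (lam * cubic xi s - w) * g s) p q) <=
  (2 * L / eps + 2 * K * (L / eps + 4 * K * L / eps ^ 2)) / (lam * eta).
Proof.
  intros Hlam Heta Heps HK Hpq Hq Haway Hd Hc HL Hg.
  assert (HL0 : 0 <= L) by (eapply Rle_trans; [apply Rabs_pos | apply (HL p); lra]).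
  assert (Nz : forall s, p <= s <= q -> s - xi <> 0).
  { intros s Hs E. specialize (Haway s Hs). rewrite E, Rabs_R0 in Haway. lra. }
  assert (Ieps : 0 < / eps) by (apply Rinv_0_lt_compat; lra).
  assert (Ilam : 0 < / lam) by (apply Rinv_0_lt_compat; lra).
  assert (Ieta : 1 <= / eta) by (rewrite <- Rinv_1; apply Rinv_le_contravar; lra).
  assert (cg : forall s, p <= s <= q -> continuous g s).
  { intros s Hs. eapply is_derive_continuous; now apply Hd. }
  rewrite (RInt_ext_le _ (fun s => cos (lam * cubic xi s - w) *
     (3 * lam * ((s - xi) * (s + xi))) * (g s / (3 * lam * ((s - xi) * (s + xi)))))); try lra.
  2:{ intros s Hs. field. repeat split; try lra. apply Nz; lra. }
  eapply Rle_trans.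
  - apply (osc_lip (fun s => lam * cubic xi s - w) _
      (fun s => g s / (3 * lam * ((s - xi) * (s + xi))))
      (fun s => dg s / (3 * lam * ((s - xi) * (s + xi))) -
         g s * (2 * s) / (3 * lam * ((s - xi) * (s + xi)) ^ 2))
      p q (L * (/ lam * / eps))
      (L * (/ lam * / eta * / eps) + L * (4 * K) * (/ lam * / eta * (/ eps * / eps)))); try lra.
    + intros; apply is_derive_cubic.
    + cont_auto.
    + intros s Hs.
      assert (0 < s + xi) by lra. assert (Nzs := Nz s Hs).
      eapply is_derive_eq.
      * apply is_derive_div; [now apply Hd | |].
        -- instantiate (1 := 3 * lam * (2 * s)). auto_derive; trivial. ring.
        -- apply Rmult_integral_contrapositive_currified; [lra |].
           apply Rmult_integral_contrapositive_currified; lra.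
      * simpl. field. repeat split; lra.
    + intros s Hs. assert (0 < s + xi) by lra. assert (Nzs := Nz s Hs).
      assert (N1 : 3 * lam * ((s - xi) * (s + xi)) <> 0).
      { apply Rmult_integral_contrapositive_currified; [lra |].
        apply Rmult_integral_contrapositive_currified; lra. }
      apply continuous_Rminus.
      * apply continuous_Rmult; auto. cont_auto.
      * unfold Rdiv. apply continuous_Rmult.
        -- apply continuous_Rmult; auto. cont_auto.
        -- cont_auto. simpl.
           apply Rmult_integral_contrapositive_currified; [lra |].
           rewrite Rmult_1_r. repeat apply Rmult_integral_contrapositive_currified; lra.
    + intros s Hs. assert (Hsx : eps <= s + xi) by lra. assert (Nzs := Nz s Hs).
      assert (Ha := Haway s Hs). assert (Hgs := Hg s Hs). assert (Hdgs := HL s Hs).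
      assert (I1 : / (s + xi) <= / eps) by (apply Rinv_le_contravar; lra).
      assert (I0 : 0 < / (s + xi)) by (apply Rinv_0_lt_compat; lra).
      assert (J1 : / Rabs (s - xi) <= / eta) by (apply Rinv_le_contravar; lra).
      assert (J0 : 0 < / Rabs (s - xi)) by (apply Rinv_0_lt_compat; lra).
      unfold Rminus at 1. eapply Rle_trans; [apply Rabs_triang |]. rewrite Rabs_Ropp.
      apply Rplus_le_compat.
      * replace (dg s / (3 * lam * ((s - xi) * (s + xi)))) with
         (dg s * ((/ 3 * / lam * / (s + xi)) * / (s - xi))) by (field; repeat split; lra).
        rewrite Rabs_mult. apply Rmult_le_compat; auto using Rabs_pos.
        rewrite Rabs_mult, Rabs_inv, Rabs_right.
        2:{ left. repeat apply Rmult_lt_0_compat; lra. }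
        apply Rle_trans with ((/ lam * / eps) * / eta); [| right; ring].
        apply Rmult_le_compat; try lra.
        -- left. repeat apply Rmult_lt_0_compat; lra.
        -- apply Rmult_le_compat; lra.
      * replace (g s * (2 * s) / (3 * lam * ((s - xi) * (s + xi)) ^ 2)) with
         (g s * / (s - xi) * ((2 * s) * ((/ 3 * / lam * (/ (s + xi) * / (s + xi))) * / (s - xi))))
         by (field; repeat split; lra).
        rewrite Rabs_mult. rewrite (Rmult_assoc L). apply Rmult_le_compat; auto using Rabs_pos.
        -- rewrite Rabs_mult, Rabs_inv. apply Rmult_le_reg_r with (Rabs (s - xi)); [lra |].
           rewrite Rmult_assoc, Rinv_l; lra.
        -- rewrite Rabs_mult. apply Rmult_le_compat; auto using Rabs_pos.
           ++ rewrite Rabs_right; lra.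
           ++ rewrite Rabs_mult, Rabs_inv, Rabs_right.
              2:{ left. repeat apply Rmult_lt_0_compat; lra. }
              apply Rle_trans with ((/ lam * (/ eps * / eps)) * / eta); [| right; ring].
              apply Rmult_le_compat; try lra.
              ** left. repeat apply Rmult_lt_0_compat; lra.
              ** apply Rmult_le_compat; try lra; [nra |]. apply Rmult_le_compat; lra.
    + intros s Hs. assert (Hsx : eps <= s + xi) by lra. assert (Nzs := Nz s Hs).
      assert (Ha := Haway s Hs). assert (Hgs := Hg s Hs).
      assert (I1 : / (s + xi) <= / eps) by (apply Rinv_le_contravar; lra).
      assert (I0 : 0 < / (s + xi)) by (apply Rinv_0_lt_compat; lra).
      replace (g s / (3 * lam * ((s - xi) * (s + xi)))) with
         (g s * / (s - xi) * (/ 3 * / lam * / (s + xi))) by (field; repeat split; lra).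
      rewrite Rabs_mult. apply Rmult_le_compat; auto using Rabs_pos.
      * rewrite Rabs_mult, Rabs_inv. apply Rmult_le_reg_r with (Rabs (s - xi)); [lra |].
        rewrite Rmult_assoc, Rinv_l; lra.
      * rewrite Rabs_right. 2:{ left. repeat apply Rmult_lt_0_compat; lra. }
        apply Rmult_le_compat; lra.
  - replace ((2 * L / eps + 2 * K * (L / eps + 4 * K * L / eps ^ 2)) / (lam * eta)) with
     ((2 * L * / eps + 2 * K * (L * / eps + 4 * K * L * (/ eps * / eps))) * (/ lam * / eta))
     by (field; lra).
    assert (A1 : 0 <= L * / lam * / eps) by (repeat apply Rmult_le_pos; lra).
    assert (A2 : 0 <= L * / lam * / eps * / eta) by (repeat apply Rmult_le_pos; lra).
    assert (A3 : 0 <= L * / lam * / eps * / eta * K * / eps) by (repeat apply Rmult_le_pos; lra).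
    assert (L * / lam * / eps * 1 <= L * / lam * / eps * / eta) by (apply Rmult_le_compat_l; lra).
    assert ((q - p) * (L * (/ lam * / eta * / eps) + L * (4 * K) * (/ lam * / eta * (/ eps * / eps)))
      <= (2 * K) * (L * (/ lam * / eta * / eps) + L * (4 * K) * (/ lam * / eta * (/ eps * / eps)))).
    { apply Rmult_le_compat_r; lra. }
    lra.
Qed.

(** Within distance [eta] of [xi] the integrand is at most L eta on a length 2 eta; on either side
    [osc_away] applies. The cut-off [eta] is left free, to be balanced against [lam] later. *)
Lemma osc_vanishing (lam w xi eta eps K L : R) (g dg : R -> R) :
  0 < lam -> 0 < eta <= 1 -> eta <= eps -> 0 < eps <= xi -> xi <= K ->
  eta <= K ->
  (forall s, 0 <= s <= 2 * K -> is_derive g s (dg s)) ->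
  (forall s, 0 <= s <= 2 * K -> continuous dg s) ->
  (forall s, 0 <= s <= 2 * K -> Rabs (dg s) <= L) ->
  g xi = 0 ->
  Rabs (RInt (fun s => cos (lam * cubic xi s - w) * g s) 0 (2 * K)) <=
  2 * L * eta ^ 2 +
  2 * ((2 * L / eps + 2 * K * (L / eps + 4 * K * L / eps ^ 2)) / (lam * eta)).
Proof.
  intros Hlam Heta Hee Heps HK HeK Hd Hc HL Hg0.
  assert (Hg : forall s, 0 <= s <= 2 * K -> Rabs (g s) <= L * Rabs (s - xi)).
  { intros s Hs. rewrite <- (Rminus_0_r (g s)), <- Hg0.
    apply (lip_of_deriv g dg 0 (2 * K)); trivial. lra. }
  assert (cg : forall s, 0 <= s <= 2 * K -> continuous (fun s => cos (lam * cubic xi s - w) * g s) s).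
  { intros s Hs. apply continuous_Rmult. unfold cubic; cont_auto.
    eapply is_derive_continuous; now apply Hd. }
  rewrite <- (RInt_Chasles_R _ 0 (xi - eta) (2 * K));
    try (apply ex_RInt_cont; [lra | intros; apply cg; lra]).
  rewrite <- (RInt_Chasles_R _ (xi - eta) (xi + eta) (2 * K));
    try (apply ex_RInt_cont; [lra | intros; apply cg; lra]).
  assert (B1 : Rabs (RInt (fun s => cos (lam * cubic xi s - w) * g s) 0 (xi - eta)) <=
    (2 * L / eps + 2 * K * (L / eps + 4 * K * L / eps ^ 2)) / (lam * eta)).
  { apply (osc_away _ _ _ _ _ _ _ _ _ g dg); try lra;
     intros s Hs; try (apply Hd || apply Hc || apply HL || apply Hg; lra).
    rewrite Rabs_left1; lra. }
  assert (B2 : Rabs (RInt (fun s => cos (lam * cubic xi s - w) * g s) (xi + eta) (2 * K)) <=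
    (2 * L / eps + 2 * K * (L / eps + 4 * K * L / eps ^ 2)) / (lam * eta)).
  { apply (osc_away _ _ _ _ _ _ _ _ _ g dg); try lra;
     intros s Hs; try (apply Hd || apply Hc || apply HL || apply Hg; lra).
    rewrite Rabs_right; lra. }
  assert (B3 : Rabs (RInt (fun s => cos (lam * cubic xi s - w) * g s) (xi - eta) (xi + eta)) <=
    (xi + eta - (xi - eta)) * (L * eta)).
  { apply RInt_abs_le_const; try lra.
    - apply ex_RInt_cont; [lra | intros; apply cg; lra].
    - intros s Hs. rewrite Rabs_mult.
      assert (HL0 : 0 <= L) by (eapply Rle_trans; [apply Rabs_pos | apply (HL 0); lra]).
      assert (E1 := Rabs_cos_le (lam * cubic xi s - w)).
      assert (E2 := Hg s ltac:(lra)).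
      assert (E3 : Rabs (s - xi) <= eta) by (apply Rabs_le; lra).
      assert (E4 := Rabs_pos (g s)). assert (E5 := Rabs_pos (cos (lam * cubic xi s - w))).
      nra. }
  eapply Rle_trans; [apply Rabs_triang |].
  eapply Rle_trans; [apply Rplus_le_compat_l, Rabs_triang |].
  replace (2 * L * eta ^ 2) with ((xi + eta - (xi - eta)) * (L * eta)) by ring. lra.
Qed.

Lemma fresnel_odd t : fresnelC (- t) = - fresnelC t /\ fresnelS (- t) = - fresnelS t.
Proof.
  assert (W : forall f : R -> R, (forall x, f (- x) = f x) -> (forall x, continuous f x) ->
     RInt f 0 (- t) = - RInt f 0 t).
  { intros f Hf Hc.
    transitivity (RInt (fun x => - f x) 0 t).
    - replace 0 with (-1 * 0 + 0) at 1 by ring. replace (- t) with (-1 * t + 0) by ring.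
      rewrite <- (RInt_comp_lin (V := R_CompleteNormedModule) f).
      + apply RInt_ext. intros x _. unfold scal; simpl; unfold mult; simpl.
        replace (-1 * x + 0) with (- x) by ring. rewrite Hf. ring.
      + apply ex_RInt_cont_all. auto.
    - apply (RInt_opp (V := R_CompleteNormedModule)).
      apply ex_RInt_cont_all. auto. }
  split; apply W; try cont_auto; intros x; f_equal; ring.
Qed.

(* With [u = (s - xi) sqrt (s + 2 xi)] one has [cubic xi s = u^2], so weighting by [u']
   turns the oscillatory integral into a difference of Fresnel integrals. *)
Lemma fresnel_window (lam w xi eps K Ci Si : R) :
  (forall t, 0 < t -> Rabs (fresnelC t - Ci) <= / t) ->
  (forall t, 0 < t -> Rabs (fresnelS t - Si) <= / t) ->
  0 < lam -> 0 < eps <= xi -> xi <= K ->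
  Rabs (RInt (fun s => cos (lam * cubic xi s - w) * (3 * (s + xi) / (2 * sqrt (s + 2 * xi))))
          0 (2 * K) - 2 / sqrt lam * (cos w * Ci + sin w * Si)) <=
  4 / (eps * sqrt (2 * eps)) / lam.
Proof.
  intros HC HS Hlam Heps HK.
  set (F := fun t => cos w * fresnelC t + sin w * fresnelS t).
  set (u := fun s => sqrt lam * ((s - xi) * sqrt (s + 2 * xi))).
  assert (Hsl : 0 < sqrt lam) by now apply sqrt_lt_R0.
  assert (Hss : sqrt lam * sqrt lam = lam) by (apply sqrt_sqrt; lra).
  assert (E : RInt (fun s => sqrt lam * (cos (lam * cubic xi s - w) *
      (3 * (s + xi) / (2 * sqrt (s + 2 * xi))))) 0 (2 * K) = F (u (2 * K)) - F (u 0)).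
  { apply (RInt_deriv (fun s => F (u s))); try lra.
    - intros s Hs.
      assert (0 < sqrt (s + 2 * xi)) by (apply sqrt_lt_R0; lra).
      assert (Q : sqrt (s + 2 * xi) * sqrt (s + 2 * xi) = s + 2 * xi) by (apply sqrt_sqrt; lra).
      eapply is_derive_eq.
      + apply (is_derive_comp F u).
        * apply is_derive_fresnel_phase.
        * instantiate (1 := sqrt lam * (3 * (s + xi) / (2 * sqrt (s + 2 * xi)))).
          unfold u. auto_derive. lra.
          field_simplify; [| lra | lra]. f_equal.
          simpl. rewrite ?Rmult_1_r. rewrite Q. ring.
      + unfold scal; simpl; unfold mult; simpl.
        replace (u s * (u s * 1)) with (lam * cubic xi s).
        * ring.
        * unfold u, cubic. rewrite <- Hss at 1.
          replace (s + 2 * xi) with (sqrt (s + 2 * xi) * sqrt (s + 2 * xi)) at 1 by exact Q.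
          ring.
    - intros s Hs.
      assert (0 < sqrt (s + 2 * xi)) by (apply sqrt_lt_R0; lra).
      unfold cubic. cont_auto. split. lra. split; trivial. lra. }
  rewrite RInt_scal_R in E.
  2:{ apply ex_RInt_cont. lra. intros s Hs.
      assert (0 < sqrt (s + 2 * xi)) by (apply sqrt_lt_R0; lra).
      unfold cubic. cont_auto. split. lra. split; trivial. lra. }
  set (I := RInt _ 0 (2 * K)) in *.
  set (W := cos w * Ci + sin w * Si).
  assert (T : forall t, 0 < t -> Rabs (F t - W) <= 2 / t).
  { intros t Ht. unfold F, W.
    replace (cos w * fresnelC t + sin w * fresnelS t - (cos w * Ci + sin w * Si)) with
      (cos w * (fresnelC t - Ci) + sin w * (fresnelS t - Si)) by ring.
    eapply Rle_trans; [apply Rabs_triang |]. rewrite !Rabs_mult.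
    assert (A1 := HC t Ht). assert (A2 := HS t Ht).
    assert (A3 := Rabs_cos_le w). assert (A4 := Rabs_sin_le w).
    assert (A5 := Rabs_pos (fresnelC t - Ci)). assert (A6 := Rabs_pos (fresnelS t - Si)).
    assert (A7 := Rabs_pos (cos w)). assert (A8 := Rabs_pos (sin w)).
    unfold Rdiv. nra. }
  (* At s = 0 the variable u is negative. Oddness turns that end into a second Fresnel tail, so each
     end contributes one [W]; hence the factor 2. *)
  assert (Fodd : forall t, F (- t) = - F t).
  { intros t. unfold F. destruct (fresnel_odd t) as [-> ->]. ring. }
  assert (Hse : 0 < sqrt (2 * eps)) by (apply sqrt_lt_R0; lra).
  assert (H0 : 0 < eps * sqrt (2 * eps)) by nra.
  assert (T' : forall t, sqrt lam * (eps * sqrt (2 * eps)) <= t ->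
     Rabs (F t - W) <= 2 / (eps * sqrt (2 * eps)) / sqrt lam).
  { intros t Ht. assert (0 < sqrt lam * (eps * sqrt (2 * eps))) by nra.
    eapply Rle_trans; [apply T; lra |]. unfold Rdiv. rewrite Rmult_assoc.
    apply Rmult_le_compat_l. lra. rewrite <- Rinv_mult.
    apply Rinv_le_contravar; lra. }
  assert (U : forall x, eps <= x ->
    sqrt lam * (eps * sqrt (2 * eps)) <= sqrt lam * (x * sqrt (2 * x))).
  { intros x Hx. apply Rmult_le_compat_l. lra. apply Rmult_le_compat; try lra.
    apply sqrt_le_1_alt. lra. }
  assert (T1 := T' (u (2 * K))).
  assert (T2 := T' (- u 0)).
  rewrite Fodd in T2.
  assert (U1 : sqrt lam * (eps * sqrt (2 * eps)) <= u (2 * K)).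
  { eapply Rle_trans; [apply (U eps); lra |]. unfold u. apply Rmult_le_compat_l. lra.
    apply Rmult_le_compat; try lra. apply sqrt_le_1_alt; lra. }
  assert (U2 : sqrt lam * (eps * sqrt (2 * eps)) <= - u 0).
  { eapply Rle_trans; [apply (U xi); lra |]. unfold u. rewrite Rplus_0_l. right; ring. }
  specialize (T1 U1). specialize (T2 U2).
  replace (I - 2 / sqrt lam * W) with (/ sqrt lam * (sqrt lam * I - 2 * W)) by (field; lra).
  rewrite E, Rabs_mult, Rabs_right.
  2:{ left. now apply Rinv_0_lt_compat. }
  replace (4 / (eps * sqrt (2 * eps)) / lam) with
    (/ sqrt lam * (2 * (2 / (eps * sqrt (2 * eps)) / sqrt lam))).
  2:{ rewrite <- Hss at 3. field. repeat split; lra. }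
  apply Rmult_le_compat_l.
  { left. now apply Rinv_0_lt_compat. }
  replace (F (u (2 * K)) - F (u 0) - 2 * W) with ((F (u (2 * K)) - W) + (- F (u 0) - W)) by ring.
  eapply Rle_trans; [apply Rabs_triang |]. lra.
Qed.

(** Beyond 2 K there is no critical point, and (s - xi) (s + xi) is at least 3 K^2. The amplitude
    divided by the phase derivative decreases, so the bound is independent of [T], which will be PI
    * N. *)
Lemma osc_beyond (lam w xi c K T : R) :
  0 < lam -> 0 <= c -> 0 < xi <= K -> 2 * K <= T ->
  Rabs (RInt (fun s => cos (lam * cubic xi s - w) * exp (- c * s ^ 4)) (2 * K) T) <=
  2 / (9 * K ^ 2) / lam.
Proof.
  intros Hlam Hc Hxi HT.
  assert (Q : forall s, 2 * K <= s -> 0 < (s - xi) * (s + xi)).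
  { intros s Hs. apply Rmult_lt_0_compat; lra. }
  rewrite (RInt_ext_le _ (fun s => cos (lam * cubic xi s - w) *
     (3 * lam * ((s - xi) * (s + xi))) * (exp (- c * s ^ 4) / (3 * lam * ((s - xi) * (s + xi))))));
    try lra.
  2:{ intros s Hs. field. repeat split; lra. }
  eapply Rle_trans.
  - apply (osc_decr (fun s => lam * cubic xi s - w) _
      (fun s => exp (- c * s ^ 4) / (3 * lam * ((s - xi) * (s + xi))))
      (fun s => - (exp (- c * s ^ 4) * (4 * c * s ^ 3 * ((s - xi) * (s + xi)) + 2 * s) /
         (3 * lam * ((s - xi) * (s + xi)) ^ 2)))); try lra.
    + intros; apply is_derive_cubic.
    + cont_auto.
    + intros s Hs. assert (Qs := Q s ltac:(lra)).
      auto_derive.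
      * apply Rmult_integral_contrapositive_currified; [lra |].
        replace ((s + - xi) * (s + xi)) with ((s - xi) * (s + xi)) by ring. lra.
      * replace (s * (s * (s * (s * 1)))) with (s ^ 4) by ring.
        field. repeat split; lra.
    + intros s Hs. assert (Qs := Q s ltac:(lra)).
      cont_auto. simpl. apply Rmult_integral_contrapositive_currified; [lra |].
      replace ((s + - xi) * (s + xi)) with ((s - xi) * (s + xi)) by ring. nra.
    + intros s Hs. assert (Qs := Q s ltac:(lra)).
      assert (0 <= exp (- c * s ^ 4) * (4 * c * s ^ 3 * ((s - xi) * (s + xi)) + 2 * s) /
         (3 * lam * ((s - xi) * (s + xi)) ^ 2)); [| lra].
      apply Rmult_le_pos.
      * apply Rmult_le_pos. left; apply exp_pos.
        assert (0 <= s ^ 3) by (apply pow_le; lra).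
        assert (0 <= 4 * c * s ^ 3 * ((s - xi) * (s + xi))).
        { repeat apply Rmult_le_pos; lra. } lra.
      * left. apply Rinv_0_lt_compat. apply Rmult_lt_0_compat. lra. now apply pow_lt.
    + assert (Qs := Q T ltac:(lra)). apply Rmult_le_pos. left; apply exp_pos.
      left. apply Rinv_0_lt_compat. apply Rmult_lt_0_compat; lra.
  - assert (Qs := Q (2 * K) ltac:(lra)).
    replace (2 / (9 * K ^ 2) / lam) with (2 * (1 * / (9 * K ^ 2 * lam))) by (field; split; lra).
    apply Rmult_le_compat_l. lra. apply Rmult_le_compat.
    + left; apply exp_pos.
    + left. apply Rinv_0_lt_compat. apply Rmult_lt_0_compat; lra.
    + rewrite <- exp_0. apply exp_le. assert (0 <= (2 * K) ^ 4) by (apply pow_le; lra). nra.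
    + apply Rinv_le_contravar. { repeat apply Rmult_lt_0_compat; try lra. }
      replace (9 * K ^ 2 * lam) with (3 * lam * (3 * K ^ 2)) by ring.
      apply Rmult_le_compat_l. lra. nra.
Qed.

(* The amplitude is split as [kap * u' + g] with [g] vanishing at [xi]. *)
Lemma stationary_phase (c eps K Ci Si : R) :
  (forall t, 0 < t -> Rabs (fresnelC t - Ci) <= / t) ->
  (forall t, 0 < t -> Rabs (fresnelS t - Si) <= / t) ->
  0 < c -> 0 < eps <= K ->
  exists A, 0 <= A /\ forall lam w xi eta T,
    0 < lam -> eps <= xi <= K -> 0 < eta <= 1 -> eta <= eps -> 2 * K <= T ->
    Rabs (RInt (fun s => cos (lam * cubic xi s - w) * exp (- c * s ^ 4)) 0 T -
      exp (- c * xi ^ 4) / sqrt (3 * xi) * (2 / sqrt lam * (cos w * Ci + sin w * Si))) <=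
    A * (eta ^ 2 + / (lam * eta)).
Proof.
  intros HC HS Hc Heps.
  set (s0 := sqrt (2 * eps)). assert (Hs0 : 0 < s0) by (apply sqrt_lt_R0; lra).
  (* A bound for the derivative of [g] below. The first term is for exp (- c s^4) on [0, 2 K]; the
     second is for kap u'', where kap <= 1 / s0 and (s + 3 xi) / (s + 2 xi) <= 3/2, whence 9/8 = 3/4
     * 3/2. *)
  set (L := 4 * c * (2 * K) ^ 3 + / s0 * (9 / 8 * / s0)).
  set (A1 := / s0 * (4 / (eps * s0))).
  set (A2 := (2 * L / eps + 2 * K * (L / eps + 4 * K * L / eps ^ 2))).
  set (A3 := 2 / (9 * K ^ 2)).
  assert (Hi0 : 0 < / s0) by now apply Rinv_0_lt_compat.
  assert (HK3 : 0 < (2 * K) ^ 3) by (apply pow_lt; lra).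
  assert (HL : 0 <= L) by (unfold L; nra).
  assert (Hie : 0 < / eps) by (apply Rinv_0_lt_compat; lra).
  assert (HA1 : 0 <= A1).
  { unfold A1. apply Rmult_le_pos; [lra |]. apply Rmult_le_pos; [lra |].
    left. apply Rinv_0_lt_compat. nra. }
  assert (HA2 : 0 <= A2).
  { unfold A2, Rdiv. assert (0 < / eps ^ 2) by (apply Rinv_0_lt_compat, pow_lt; lra).
    assert (0 <= 2 * L * / eps) by nra.
    assert (0 <= 2 * K * (L * / eps + 4 * K * L * / eps ^ 2)); [| lra].
    apply Rmult_le_pos; [lra |]. apply Rplus_le_le_0_compat.
    nra. repeat apply Rmult_le_pos; lra. }
  assert (HA3 : 0 <= A3).
  { unfold A3. apply Rmult_le_pos; [lra |]. left. apply Rinv_0_lt_compat. nra. }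
  exists (A1 + 2 * A2 + A3 + 2 * L). split; [lra |].
  intros lam w xi eta T Hlam Hxi Heta Hee HT.
  set (a := fun s => exp (- c * s ^ 4)).
  set (du := fun s => 3 * (s + xi) / (2 * sqrt (s + 2 * xi))).
  (* [du] takes the value sqrt (3 xi) at xi, so this coefficient makes [g] vanish there. *)
  set (kap := a xi / sqrt (3 * xi)).
  assert (Sp : forall s, 0 <= s -> s0 <= sqrt (s + 2 * xi)).
  { intros s Hs. apply sqrt_le_1_alt. lra. }
  assert (S3 : s0 <= sqrt (3 * xi)).
  { apply sqrt_le_1_alt. lra. }
  assert (Ha1 : forall s, 0 <= s -> 0 < a s <= 1).
  { intros s Hs. unfold a. split. apply exp_pos. rewrite <- exp_0. apply exp_le.
    assert (0 <= s ^ 4) by (apply pow_le; lra). nra. }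
  assert (Hkap : 0 <= kap <= / s0).
  { unfold kap. assert (A := Ha1 xi ltac:(lra)).
    assert (/ sqrt (3 * xi) <= / s0) by (apply Rinv_le_contravar; lra).
    assert (0 < / sqrt (3 * xi)) by (apply Rinv_0_lt_compat; lra).
    unfold Rdiv. split; nra. }
  set (g := fun s => a s - kap * du s).
  set (dg := fun s => (-4 * c * s ^ 3 * a s) -
     kap * (3 / 4 * (s + 3 * xi) / ((s + 2 * xi) * sqrt (s + 2 * xi)))).
  assert (Dg : forall s, 0 <= s <= 2 * K -> is_derive g s (dg s)).
  { intros s Hs. assert (Z := Sp s ltac:(lra)).
    assert (Q : sqrt (s + 2 * xi) * sqrt (s + 2 * xi) = s + 2 * xi) by (apply sqrt_sqrt; lra).
    unfold g, dg.
    apply (is_derive_minus (V := R_NormedModule)).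
    - unfold a. auto_derive; trivial. simpl; ring.
    - apply is_derive_scal. unfold du. auto_derive.
      + split. lra. split; trivial. lra.
      + rewrite <- Q at 5. field_simplify; [| lra | lra]. f_equal.
        simpl. rewrite ?Rmult_1_r.
        replace (sqrt (s + 2 * xi) * (sqrt (s + 2 * xi))) with (s + 2 * xi) by lra. ring. }
  assert (Cdg : forall s, 0 <= s <= 2 * K -> continuous dg s).
  { intros s Hs. assert (Z := Sp s ltac:(lra)). unfold dg, a. cont_auto.
    split; [lra |]. split; trivial. nra. }
  assert (Ldg : forall s, 0 <= s <= 2 * K -> Rabs (dg s) <= L).
  { intros s Hs. assert (Z := Sp s ltac:(lra)). unfold dg, L.
    unfold Rminus. eapply Rle_trans; [apply Rabs_triang |]. rewrite Rabs_Ropp, !Rabs_mult.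
    assert (B := Ha1 s ltac:(lra)).
    apply Rplus_le_compat.
    - rewrite (Rabs_right (a s)), (Rabs_right c), (Rabs_left (-4)), (Rabs_right (s ^ 3)); try lra.
      + assert (s ^ 3 <= (2 * K) ^ 3) by (apply pow_incr; lra).
        assert (0 <= s ^ 3) by (apply pow_le; lra).
        replace (- -4) with 4 by ring.
        apply Rle_trans with (4 * c * s ^ 3 * 1).
        * apply Rmult_le_compat_l; [nra | lra].
        * rewrite Rmult_1_r. apply Rmult_le_compat_l; nra.
      + apply Rle_ge, pow_le; lra.
    - rewrite Rabs_right by lra.
      assert (P1 : 0 < (s + 2 * xi) * sqrt (s + 2 * xi)) by nra.
      rewrite Rabs_right.
      2:{ apply Rle_ge. apply Rmult_le_pos; [lra |]. left; now apply Rinv_0_lt_compat. }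
      apply Rmult_le_compat; try lra.
      { apply Rmult_le_pos; [lra |]. left; now apply Rinv_0_lt_compat. }
      replace (3 / 4 * (s + 3 * xi) / ((s + 2 * xi) * sqrt (s + 2 * xi))) with
        ((3 / 4 * ((s + 3 * xi) / (s + 2 * xi))) * / sqrt (s + 2 * xi)) by (field; lra).
      apply Rmult_le_compat.
      + apply Rmult_le_pos; [lra |]. apply Rmult_le_pos; [lra |].
        left; apply Rinv_0_lt_compat; lra.
      + left; apply Rinv_0_lt_compat; lra.
      + replace (9 / 8) with (3 / 4 * (3 / 2)) by field. apply Rmult_le_compat_l; [lra |].
        apply Rmult_le_reg_r with (s + 2 * xi); [lra |].
        unfold Rdiv at 1. rewrite Rmult_assoc, Rinv_l; lra.
      + apply Rinv_le_contravar; lra. }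
  assert (g0 : g xi = 0).
  { unfold g, kap, du. replace (xi + 2 * xi) with (3 * xi) by ring.
    replace (3 * (xi + xi)) with (2 * (3 * xi)) by ring.
    rewrite <- (sqrt_sqrt (3 * xi)) at 2 by lra. field. lra. }
  assert (B1 := fresnel_window lam w xi eps K Ci Si HC HS Hlam ltac:(lra) ltac:(lra)).
  assert (B2 := osc_vanishing lam w xi eta eps K L g dg Hlam Heta Hee ltac:(lra) ltac:(lra)
     ltac:(lra) Dg Cdg Ldg g0).
  assert (B3 := osc_beyond lam w xi c K T Hlam ltac:(lra) ltac:(lra) HT).
  fold s0 in B1. fold A2 in B2. fold A3 in B3.
  assert (Cc : forall s, continuous (fun s => cos (lam * cubic xi s - w)) s).
  { unfold cubic; cont_auto. }
  assert (Cdu : forall s, 0 <= s -> continuous du s).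
  { intros s Hs. assert (Z := Sp s Hs). unfold du. cont_auto. split; [lra |]. split; trivial; lra. }
  assert (Ca : forall s, continuous a s) by (unfold a; cont_auto).
  assert (Cg : forall s, 0 <= s -> continuous g s).
  { intros s Hs. apply continuous_Rminus; auto. apply continuous_Rmult; auto.
    apply continuous_const. }
  rewrite <- (RInt_Chasles_R _ 0 (2 * K) T);
    try (apply ex_RInt_cont; [lra | intros; apply continuous_Rmult; auto]).
  fold (du) in B1.
  rewrite (RInt_ext_le (fun s => cos (lam * cubic xi s - w) * exp (- c * s ^ 4))
    (fun s => kap * (cos (lam * cubic xi s - w) * du s) + cos (lam * cubic xi s - w) * g s)
    0 (2 * K)); try lra.
  2:{ intros s Hs. unfold g, a. ring. }
  assert (X1 : ex_RInt (fun s => cos (lam * cubic xi s - w) * du s) 0 (2 * K)).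
  { apply ex_RInt_cont; [lra |]. intros. apply continuous_Rmult; auto. apply Cdu; lra. }
  assert (X2 : ex_RInt (fun s => cos (lam * cubic xi s - w) * g s) 0 (2 * K)).
  { apply ex_RInt_cont; [lra |]. intros. apply continuous_Rmult; auto. apply Cg; lra. }
  rewrite RInt_plus_R, RInt_scal_R; trivial.
  2:{ now apply (ex_RInt_scal (V := R_NormedModule)). }
  set (I1 := RInt (fun s => cos (lam * cubic xi s - w) * du s) 0 (2 * K)) in *.
  change (RInt (fun s => cos (lam * cubic xi s - w) *
    (3 * (s + xi) / (2 * sqrt (s + 2 * xi)))) 0 (2 * K)) with I1 in B1.
  set (I2 := RInt (fun s => cos (lam * cubic xi s - w) * g s) 0 (2 * K)) in *.
  set (I3 := RInt (fun s => cos (lam * cubic xi s - w) * exp (- c * s ^ 4)) (2 * K) T) in *.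
  set (W := 2 / sqrt lam * (cos w * Ci + sin w * Si)) in *.
  change (exp (- c * xi ^ 4) / sqrt (3 * xi)) with kap.
  replace (kap * I1 + I2 + I3 - kap * W) with (kap * (I1 - W) + I2 + I3) by ring.
  eapply Rle_trans; [apply Rabs_triang |].
  eapply Rle_trans; [apply Rplus_le_compat_r, Rabs_triang |].
  rewrite Rabs_mult, (Rabs_right kap) by lra.
  assert (Il : 0 < / lam) by now apply Rinv_0_lt_compat.
  assert (Ieta : 1 <= / eta) by (rewrite <- Rinv_1; apply Rinv_le_contravar; lra).
  assert (D1 : kap * Rabs (I1 - W) <= A1 * / lam).
  { apply Rle_trans with (/ s0 * (4 / (eps * s0) / lam)).
    - apply Rmult_le_compat; try lra. apply Rabs_pos.
    - right. unfold A1. field. repeat split; lra. }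
  unfold Rdiv in B2, B3 |- *. rewrite Rinv_mult in B2 |- *.
  assert (/ lam * 1 <= / lam * / eta) by (apply Rmult_le_compat_l; lra).
  assert (0 <= eta ^ 2) by (apply pow_le; lra).
  assert (A1 * / lam <= A1 * (/ lam * / eta)) by (apply Rmult_le_compat_l; lra).
  assert (A3 * / lam <= A3 * (/ lam * / eta)) by (apply Rmult_le_compat_l; lra).
  assert (0 <= 2 * L * (/ lam * / eta)) by (apply Rmult_le_pos; lra).
  assert (0 <= (A1 + 2 * A2 + A3) * eta ^ 2) by (apply Rmult_le_pos; lra).
  lra.
Qed.

(** * The mean of |cos| *)

(** The constant 2 / PI is the mean of |cos| over a period; subtracting it makes the primitive
    periodic, hence bounded. *)
Definition abscos_osc (x : R) : R := Rabs (cos x) - 2 / PI.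
Definition abscos_prim (x : R) : R := RInt abscos_osc 0 x.

Lemma continuous_abscos_osc x : continuous abscos_osc x.
Proof.
  apply continuous_Rminus. apply continuous_Rabs_comp, continuous_cos. apply continuous_const.
Qed.

Lemma is_derive_abscos_prim x : is_derive abscos_prim x (abscos_osc x).
Proof. apply is_derive_RInt_0, continuous_abscos_osc. Qed.

Lemma abscos_prim_PI : abscos_prim PI = 0.
Proof.
  assert (HP := PI_RGT_0).
  unfold abscos_prim, abscos_osc.
  assert (E : forall a b, a <= b -> ex_RInt (fun x => Rabs (cos x)) a b).
  { intros. apply ex_RInt_cont; trivial. intros. apply continuous_Rabs_comp, continuous_cos. }
  rewrite RInt_minus_R; [| apply E; lra | apply ex_RInt_const].
  rewrite RInt_const. unfold scal; simpl; unfold mult; simpl.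
  rewrite <- (RInt_Chasles_R _ 0 (PI / 2) PI) by (apply E; lra).
  rewrite (RInt_ext_le _ cos 0); try lra.
  2:{ intros x Hx. apply Rabs_right. apply Rle_ge, cos_ge_0; lra. }
  rewrite (RInt_ext_le _ (fun x => - cos x) (PI / 2)); try lra.
  2:{ intros x Hx. apply Rabs_left1. apply cos_le_0; lra. }
  rewrite (RInt_deriv sin cos); try lra.
  2:{ intros; apply is_derive_sin. } 2:{ intros; apply continuous_cos. }
  rewrite (RInt_deriv (fun x => - sin x) (fun x => - cos x)); try lra.
  2:{ intros; auto_derive; trivial; ring. } 2: cont_auto.
  rewrite sin_PI2, sin_0, sin_PI. field. lra.
Qed.

Lemma abscos_prim_period x : abscos_prim (x + PI) = abscos_prim x.
Proof.
  unfold abscos_prim.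
  assert (E : forall a b, ex_RInt abscos_osc a b).
  { intros. apply ex_RInt_cont_all. intros; apply continuous_abscos_osc. }
  rewrite <- (RInt_Chasles_R _ 0 PI (x + PI)) by apply E.
  change (RInt abscos_osc 0 PI) with (abscos_prim PI).
  rewrite abscos_prim_PI, Rplus_0_l.
  replace PI with (1 * 0 + PI) at 1 by ring. replace (x + PI) with (1 * x + PI) by ring.
  rewrite <- (RInt_comp_lin (V := R_CompleteNormedModule)) by apply E.
  apply RInt_ext. intros y _. unfold scal; simpl; unfold mult; simpl.
  rewrite !Rmult_1_l. unfold abscos_osc. rewrite neg_cos, Rabs_Ropp. ring.
Qed.

Lemma abscos_prim_bound x : Rabs (abscos_prim x) <= PI.
Proof.
  assert (HP := PI_RGT_0).
  assert (Per : forall n x, abscos_prim (x + INR n * PI) = abscos_prim x).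
  { induction n; intros y.
    - simpl. f_equal. ring.
    - rewrite S_INR. replace (y + (INR n + 1) * PI) with (y + INR n * PI + PI) by ring.
      now rewrite abscos_prim_period. }
  assert (H2 : 0 < 2 / PI < 1).
  { assert (2 < PI) by (generalize PI2_1; lra).
    split. apply Rdiv_lt_0_compat; lra.
    apply Rmult_lt_reg_r with PI; trivial. unfold Rdiv. rewrite Rmult_assoc, Rinv_l; lra. }
  assert (B0 : forall x, 0 <= x <= PI -> Rabs (abscos_prim x) <= PI).
  { intros y Hy. apply Rle_trans with ((y - 0) * 1); [| lra].
    apply RInt_abs_le_const; try lra.
    - apply ex_RInt_cont; try lra. intros; apply continuous_abscos_osc.
    - intros z _. unfold abscos_osc. assert (A := Rabs_cos_le z). assert (A' := Rabs_pos (cos z)).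
      apply Rabs_le. lra. }
  assert (B1 : forall x, 0 <= x -> Rabs (abscos_prim x) <= PI).
  { intros y Hy. destruct (nfloor_ex (y / PI)) as [n Hn].
    { apply Rmult_le_pos; [lra |]. left; now apply Rinv_0_lt_compat. }
    replace y with ((y - INR n * PI) + INR n * PI) by ring. rewrite Per. apply B0.
    assert (y = y / PI * PI) by (field; lra). split; nra. }
  destruct (Rle_dec 0 x); [now apply B1 |].
  destruct (nfloor_ex (- x / PI)) as [m Hm].
  { apply Rmult_le_pos; [lra |]. left; now apply Rinv_0_lt_compat. }
  (* One period more than the floor makes the shifted argument nonnegative. *)
  rewrite <- (Per (S m)). apply B1. rewrite S_INR.
  assert (x = - (- x / PI * PI)) by (field; lra). nra.
Qed.

(** The phase derivative 6 mu x^2 stays away from 0 because [eps > 0]; dividing by it leaves a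
    smooth amplitude and gains 1 / mu, with the bounded primitive [abscos_prim] in the role of the
    sine. The constant is uniform in [mu] and [w]. *)
Lemma abscos_average (b db : R -> R) (eps K : R) :
  0 < eps <= K ->
  (forall x, eps <= x <= K -> is_derive b x (db x)) ->
  (forall x, eps <= x <= K -> continuous db x) ->
  exists A, forall mu w, 0 < mu ->
    Rabs (RInt (fun x => b x * Rabs (cos (2 * mu * x ^ 3 - w))) eps K -
       2 / PI * RInt b eps K) <= A / mu.
Proof.
  intros He Hb Hdb.
  assert (cb : forall x, eps <= x <= K -> continuous b x).
  { intros x Hx. eapply is_derive_continuous; now apply Hb. }
  set (k := fun x => b x / (6 * x ^ 2)).
  set (dk := fun x => db x / (6 * x ^ 2) - b x / (3 * x ^ 3)).
  exists (PI * (Rabs (k eps) + Rabs (k K) + RInt (fun x => Rabs (dk x)) eps K)).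
  intros mu w Hmu.
  assert (cc : forall x, continuous (fun x => Rabs (cos (2 * mu * x ^ 3 - w))) x).
  { intros x. apply continuous_Rabs_comp. cont_auto. }
  rewrite <- RInt_scal_R by (apply ex_RInt_cont; [lra | auto]).
  rewrite <- RInt_minus_R.
  2:{ apply ex_RInt_cont; [lra |]. intros. apply continuous_Rmult; auto. }
  2:{ apply ex_RInt_cont; [lra |]. intros. apply continuous_Rmult; auto. apply continuous_const. }
  assert (Dk : forall x, eps <= x <= K -> is_derive k x (dk x)).
  { intros x Hx. eapply is_derive_eq.
    - apply is_derive_div; [now apply Hb | |].
      + instantiate (1 := 6 * (2 * x)). auto_derive; trivial. ring.
      + apply Rgt_not_eq. nra.
    - unfold dk. simpl. field. lra. }
  assert (Cdk : forall x, eps <= x <= K -> continuous dk x).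
  { intros x Hx. assert (0 < x ^ 2) by (apply pow_lt; lra). assert (0 < x ^ 3) by (apply pow_lt; lra).
    apply continuous_Rminus; apply continuous_Rmult; auto; cont_auto; simpl in *; lra. }
  assert (ck : forall x, eps <= x <= K -> continuous k x).
  { intros x Hx. eapply is_derive_continuous; now apply Dk. }
  rewrite (RInt_ext_le _ (fun x => / mu *
     (abscos_osc (2 * mu * x ^ 3 - w) * (6 * mu * x ^ 2) * k x))); try lra.
  2:{ intros x Hx. unfold abscos_osc, k. field. generalize PI_RGT_0; intros; repeat split; lra. }
  rewrite RInt_scal_R.
  2:{ apply ex_RInt_cont; [lra |]. intros. apply continuous_Rmult; [apply continuous_Rmult | auto].
      - apply (continuous_comp (fun x => 2 * mu * x ^ 3 - w) abscos_osc).
        cont_auto. apply continuous_abscos_osc.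
      - cont_auto. }
  rewrite Rabs_mult, Rabs_right.
  2:{ left. now apply Rinv_0_lt_compat. }
  unfold Rdiv. rewrite Rmult_comm. apply Rmult_le_compat_r.
  { left. now apply Rinv_0_lt_compat. }
  apply (osc_by_parts abscos_prim abscos_osc (fun x => 2 * mu * x ^ 3 - w)); auto; try lra.
  - apply is_derive_abscos_prim.
  - apply continuous_abscos_osc.
  - apply abscos_prim_bound.
  - intros. auto_derive; trivial. ring.
  - cont_auto.
Qed.

(** * The Gamma integral *)

Lemma exp_ge_id x : x <= exp x.
Proof. destruct (Req_dec x 0) as [-> | H]. rewrite exp_0; lra. generalize (exp_ineq1 x H); lra. Qed.

Section Gamma_integrand.
Let f (t : R) : R := Rpower t (11 / 8 - 1) * exp (- t).

(** One bound for each end of the integral: 1 near 0 and 27 / t^2 near infinity. The 27 comes from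
    cubing t / 3 <= exp (t / 3). *)
Lemma gamma_integrand_bounds t : 0 < t -> 0 <= f t <= 1 /\ f t <= 27 * / t ^ 2.
Proof.
  intros Ht.
  assert (H0 : 0 < exp (- t)) by apply exp_pos.
  assert (HR : 0 < Rpower t (11 / 8 - 1)) by apply exp_pos.
  assert (He : exp t * exp (- t) = 1) by (rewrite <- exp_plus, Rplus_opp_r; apply exp_0).
  assert (H3 : t ^ 3 <= 27 * exp t).
  { replace (exp t) with (exp (t / 3) ^ 3).
    - replace (27 * exp (t / 3) ^ 3) with ((3 * exp (t / 3)) ^ 3) by ring.
      apply pow_incr. generalize (exp_ge_id (t / 3)); lra.
    - replace t with (t / 3 + (t / 3 + t / 3)) at 2 by field. rewrite !exp_plus. ring. }
  assert (Hm : Rpower t (11 / 8 - 1) <= 1 \/ Rpower t (11 / 8 - 1) <= t).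
  { destruct (Rle_dec t 1) as [H1 | H1].
    - left. unfold Rpower. apply Rle_trans with (exp 0); [| rewrite exp_0; lra]. apply exp_le.
      assert (ln t <= 0) by (rewrite <- ln_1; apply ln_le; lra). lra.
    - right. rewrite <- (Rpower_1 t Ht) at 2. apply Rle_Rpower; lra. }
  assert (He1 : exp (- t) <= 1) by (rewrite <- exp_0; apply exp_le; lra).
  assert (Het : t * exp (- t) <= 1) by (rewrite <- He; apply Rmult_le_compat_r; [lra | apply exp_ge_id]).
  assert (T2 : 0 < t ^ 2) by (apply pow_lt; lra).
  assert (Hf : f t <= 1).
  { unfold f. destruct Hm; nra. }
  split; [split; trivial; unfold f; nra |].
  apply Rmult_le_reg_r with (t ^ 2); trivial. rewrite Rmult_assoc, Rinv_l by lra.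
  assert (Hc : t ^ 3 * exp (- t) <= 27) by nra.
  destruct (Rle_dec t 1) as [H1 | H1].
  - assert (0 <= f t) by (unfold f; nra). assert (t ^ 2 <= 1) by nra. nra.
  - unfold f. destruct Hm.
    + assert (t ^ 2 <= t ^ 3) by (simpl; nra). nra.
    + replace (t ^ 3) with (t * t ^ 2) in Hc by ring.
      assert (0 <= exp (- t) * t ^ 2) by nra. nra.
Qed.

Lemma gamma_integrand_cont t : 0 < t -> continuous f t.
Proof. intros Ht. unfold f, Rpower. cont_auto. Qed.

Lemma gamma_integrand_ex p q : 0 < p -> 0 < q -> ex_RInt f p q.
Proof.
  intros. apply (ex_RInt_continuous (V := R_CompleteNormedModule)).
  intros z [Hz _]. apply gamma_integrand_cont. eapply Rlt_le_trans; [| exact Hz].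
  now apply Rmin_glb_lt.
Qed.

(** Existence of the improper integral and the size of its tails are obtained together. The
    primitive [W] based at 1 converges at infinity with rate 27 / t, normalised by the factor 1 /
    27, and at 0 with rate t. *)
Lemma Gamma_truncated p q : 0 < p -> 0 < q ->
  Rabs (RInt f p q - Gamma (11 / 8)) <= p + 27 * / q.
Proof.
  set (W := fun t => RInt f 1 t).
  assert (D : forall s t, 0 < s -> 0 < t -> W t - W s = RInt f s t).
  { intros s t Hs Ht. unfold W. rewrite <- (RInt_Chasles_R f 1 s t); try ring;
    apply gamma_integrand_ex; lra. }
  destruct (cauchy_inv_rate (fun t => / 27 * W t)) as [L1 H1].
  { intros s t Hst. rewrite <- Rmult_minus_distr_l, D by lra.
    rewrite Rabs_mult, Rabs_right by lra. apply Rmult_le_reg_l with 27; [lra |].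
    rewrite <- Rmult_assoc, Rinv_r, Rmult_1_l by lra.
    apply Rle_trans with (RInt (fun t => 27 * / t ^ 2) s t).
    - apply RInt_abs_le; try lra. apply gamma_integrand_ex; lra.
      + apply ex_RInt_cont; try lra. intros x Hx. cont_auto. apply Rgt_not_eq. nra.
      + intros x Hx. destruct (gamma_integrand_bounds x ltac:(lra)).
        rewrite Rabs_right; lra.
    - rewrite (RInt_deriv (fun x => - (27 * / x))); try lra.
      + assert (0 < / t) by (apply Rinv_0_lt_compat; lra). lra.
      + intros x Hx. auto_derive. lra. field. lra.
      + intros x Hx. cont_auto. apply Rgt_not_eq. nra. }
  destruct (cauchy_inv_rate (fun t => W (/ t))) as [L0 H0].
  { intros s t Hst.
    assert (0 < / t) by (apply Rinv_0_lt_compat; lra).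
    assert (/ t <= / s) by (apply Rinv_le_contravar; lra).
    rewrite Rabs_minus_sym, D by lra.
    apply Rle_trans with ((/ s - / t) * 1); [| lra].
    apply RInt_abs_le_const; try lra. apply gamma_integrand_ex; lra.
    intros x Hx. destruct (gamma_integrand_bounds x ltac:(lra)). rewrite Rabs_right; lra. }
  set (G := 27 * L1 - L0).
  assert (B : forall p q, 0 < p -> 0 < q -> Rabs (RInt f p q - G) <= p + 27 * / q).
  { intros p' q' Hp Hq. rewrite <- D by trivial. unfold G.
    assert (A1 := H1 q' Hq).
    assert (A0 := H0 (/ p') ltac:(now apply Rinv_0_lt_compat)). rewrite !Rinv_inv in A0.
    replace (W q' - W p' - (27 * L1 - L0)) with
      (27 * (/ 27 * W q' - L1) + - (W p' - L0)) by field.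
    eapply Rle_trans; [apply Rabs_triang |]. rewrite Rabs_Ropp, Rabs_mult, (Rabs_right 27); lra. }
  assert (E : is_RInt_gen f (at_right 0) (Rbar_locally p_infty) G).
  { intros P [d Hd].
    (* With these thresholds p + 27 / q < d / 4 + d / 4. *)
    apply (Filter_prod _ _ _ (fun p => 0 < p < d / 4) (fun q => 108 / d < q)).
    - assert (Hd4 : 0 < d / 4) by (generalize (cond_pos d); lra).
      exists (mkposreal _ Hd4). intros y Hy Hy0. split; trivial.
      unfold ball in Hy; simpl in Hy; unfold AbsRing_ball, abs, minus, plus, opp in Hy; simpl in Hy.
      apply Rabs_lt_between in Hy. lra.
    - exists (108 / d). trivial.
    - intros p' q' Hp Hq. simpl. assert (Hd0 := cond_pos d).
      assert (H108 : 0 < 108 / d) by (apply Rdiv_lt_0_compat; lra).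
      exists (RInt f p' q'). split.
      + apply (RInt_correct (V := R_CompleteNormedModule)). apply gamma_integrand_ex; lra.
      + apply Hd. unfold ball; simpl; unfold AbsRing_ball, abs, minus, plus, opp; simpl.
        eapply Rle_lt_trans; [apply (B p' q'); lra |].
        assert (/ q' <= d / 108).
        { replace (d / 108) with (/ (108 / d)) by (field; lra). apply Rinv_le_contravar; lra. }
        lra. }
  unfold Gamma. fold f. rewrite (is_RInt_gen_unique _ _ E). apply B.
Qed.
End Gamma_integrand.

(** The substitution t = c x^4 alone would lead to Gamma at 3/8, whose integrand is singular at 0.
    Integrating by parts first, with the primitive (2/3) x^(3/2) of sqrt x, raises the argument to
    11/8 and accounts for the factor 2/3; the boundary terms go into the error. *)
Lemma quartic_gamma (c : R) : 0 < c ->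
  exists A, 0 <= A /\ forall eps K, 0 < eps <= 1 -> 1 <= K ->
  Rabs (RInt (fun x => sqrt x * exp (- c * x ^ 4)) eps K -
     2 / 3 * / Rpower c (3 / 8) * Gamma (11 / 8)) <= A * (eps + / K).
Proof.
  intros Hc.
  set (cr := Rpower c (3 / 8)). assert (Hcr : 0 < cr) by apply exp_pos.
  assert (Icr : 0 < / cr) by now apply Rinv_0_lt_compat.
  assert (Ic : 0 < / c) by now apply Rinv_0_lt_compat.
  exists (1 + / c + / cr * (c + 27 * / c)). split.
  { assert (0 <= / cr * (c + 27 * / c)) by nra. lra. }
  intros eps K He HK.
  set (f := fun t => Rpower t (11 / 8 - 1) * exp (- t)).
  assert (Cs : forall x, 0 < x -> continuous (fun x => sqrt x * exp (- c * x ^ 4)) x).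
  { intros x Hx. cont_auto. }
  assert (S : forall x, 0 < x -> sqrt x * sqrt x = x) by (intros; apply sqrt_sqrt; lra).
  assert (HR : forall x, 0 < x -> Rpower (c * x ^ 4) (11 / 8 - 1) = cr * (x * sqrt x)).
  { intros x Hx.
    rewrite <- Rpower_mult_distr; trivial. 2: now apply pow_lt.
    replace (11 / 8 - 1) with (3 / 8) by field. fold cr. f_equal.
    rewrite <- Rpower_pow, Rpower_mult by trivial.
    rewrite <- Rpower_sqrt by trivial. rewrite <- (Rpower_1 x) at 2 by trivial.
    rewrite <- Rpower_plus. f_equal. simpl. field. }
  assert (E : RInt (fun x => sqrt x * exp (- c * x ^ 4)) eps K =
     (2 / 3 * (K * sqrt K * exp (- c * K ^ 4)) - 2 / 3 * (eps * sqrt eps * exp (- c * eps ^ 4)))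
     + 2 / 3 * / cr * RInt f (c * eps ^ 4) (c * K ^ 4)).
  { rewrite <- (RInt_comp (V := R_CompleteNormedModule) f (fun x => c * x ^ 4)
       (fun x => 4 * c * x ^ 3)).
    2:{ intros x. rewrite Rmin_left, Rmax_right by lra. intros Hx.
        apply gamma_integrand_cont. apply Rmult_lt_0_compat; trivial. apply pow_lt; lra. }
    2:{ intros x _. split. auto_derive; trivial; ring. cont_auto. }
    rewrite <- (RInt_deriv (fun x => 2 / 3 * (x * sqrt x * exp (- c * x ^ 4)))
      (fun x => sqrt x * exp (- c * x ^ 4) -
         8 / 3 * c * x ^ 3 * (x * sqrt x * exp (- c * x ^ 4)))); try lra.
    - rewrite RInt_minus_R.
      + rewrite (RInt_ext_le (fun y => scal (4 * c * y ^ 3) (f (c * y ^ 4)))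
         (fun x => 3 / 2 * cr * (8 / 3 * c * x ^ 3 * (x * sqrt x * exp (- c * x ^ 4))))).
        2: lra.
        2:{ intros x Hx. unfold scal; simpl; unfold mult; simpl. unfold f.
            change (x * (x * (x * (x * 1)))) with (x ^ 4).
            rewrite HR by lra. replace (- (c * x ^ 4)) with (- c * x ^ 4) by ring. field. }
        rewrite RInt_scal_R.
        apply Rminus_diag_uniq. field. lra.
        apply ex_RInt_cont; try lra. intros x Hx. cont_auto. repeat split; lra.
      + apply ex_RInt_cont; try lra. intros x Hx. apply Cs; lra.
      + apply ex_RInt_cont; try lra. intros x Hx. cont_auto. repeat split; lra.
    - intros x Hx. auto_derive. repeat split; lra.
      assert (0 < sqrt x) by (apply sqrt_lt_R0; lra).
      replace (x * (x * (x * (x * 1)))) with (x ^ 4) by ring.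
      apply Rminus_diag_uniq.
      transitivity (exp (- c * x ^ 4) * / sqrt x * / 3 * (x - sqrt x * sqrt x)).
      + field. lra.
      + rewrite S by lra. ring.
    - intros x Hx. cont_auto. repeat split; lra. }
  rewrite E.
  assert (P4 : forall x, 0 < x -> 0 < x ^ 4) by (intros; now apply pow_lt).
  assert (G := Gamma_truncated (c * eps ^ 4) (c * K ^ 4)
    ltac:(apply Rmult_lt_0_compat; trivial; apply P4; lra)
    ltac:(apply Rmult_lt_0_compat; trivial; apply P4; lra)). fold f in G.
  set (I := RInt f (c * eps ^ 4) (c * K ^ 4)) in *.
  assert (IK : 0 < / K <= 1).
  { split. apply Rinv_0_lt_compat; lra. rewrite <- Rinv_1. apply Rinv_le_contravar; lra. }
  assert (B1 : 0 <= eps * sqrt eps * exp (- c * eps ^ 4) <= eps).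
  { assert (Hse : 0 <= sqrt eps <= 1).
    { split. apply sqrt_pos. rewrite <- sqrt_1. apply sqrt_le_1_alt. lra. }
    assert (Q := P4 eps ltac:(lra)).
    assert (Hx : 0 < exp (- c * eps ^ 4) <= 1).
    { split. apply exp_pos. rewrite <- exp_0. apply exp_le. nra. }
    assert (0 <= sqrt eps * exp (- c * eps ^ 4) <= 1) by nra. nra. }
  assert (B2 : 0 <= K * sqrt K * exp (- c * K ^ 4) <= / c * / K).
  { assert (Hse : 0 <= sqrt K <= K).
    { split. apply sqrt_pos. rewrite <- (sqrt_square K) at 2 by lra. apply sqrt_le_1_alt. nra. }
    assert (Q := P4 K ltac:(lra)).
    assert (Hx : 0 < exp (- c * K ^ 4)) by apply exp_pos.
    assert (Hy : c * K ^ 4 * exp (- c * K ^ 4) <= 1).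
    { assert (exp (c * K ^ 4) * exp (- c * K ^ 4) = 1).
      { rewrite <- exp_plus. replace (c * K ^ 4 + - c * K ^ 4) with 0 by ring. apply exp_0. }
      generalize (exp_ge_id (c * K ^ 4)). nra. }
    split. repeat apply Rmult_le_pos; lra.
    apply Rmult_le_reg_l with c; trivial. apply Rmult_le_reg_r with K; [lra |].
    replace (c * (/ c * / K) * K) with 1 by (field; lra).
    eapply Rle_trans; [| exact Hy].
    replace (c * (K * sqrt K * exp (- c * K ^ 4)) * K) with
      ((c * exp (- c * K ^ 4)) * (K * K * sqrt K)) by ring.
    replace (c * K ^ 4 * exp (- c * K ^ 4)) with
      ((c * exp (- c * K ^ 4)) * (K * K * (K * K))) by ring.
    apply Rmult_le_compat_l. nra. apply Rmult_le_compat_l; nra. }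
  assert (B3 : c * eps ^ 4 <= c * eps).
  { apply Rmult_le_compat_l. lra. rewrite <- (pow_1 eps) at 2.
    assert (eps ^ 3 <= 1). { rewrite <- (pow1 3). apply pow_incr. lra. }
    replace (eps ^ 4) with (eps ^ 3 * eps) by ring. nra. }
  assert (B4 : / (c * K ^ 4) <= / c * / K).
  { rewrite <- Rinv_mult. apply Rinv_le_contravar. nra. apply Rmult_le_compat_l. lra.
    assert (1 <= K ^ 3) by (apply pow_R1_Rle; lra). replace (K ^ 4) with (K * K ^ 3) by ring. nra. }
  set (Gm := Gamma (11 / 8)) in *.
  match goal with |- Rabs (?a - ?b + 2 / 3 * / cr * I - _) <= _ =>
    replace (a - b + 2 / 3 * / cr * I - 2 / 3 * / cr * Gm) with
     (a - b + 2 / 3 * / cr * (I - Gm)) by ring end.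
  eapply Rle_trans; [apply Rabs_triang |].
  rewrite Rabs_mult, (Rabs_right (2 / 3 * / cr)) by nra.
  assert (B5 : 2 / 3 * / cr * Rabs (I - Gm) <= / cr * (c * eps + 27 * (/ c * / K))).
  { rewrite (Rmult_comm (2 / 3)), Rmult_assoc. apply Rmult_le_compat_l; [lra |].
    generalize (Rabs_pos (I - Gm)). lra. }
  assert (B6 : / cr * (c * eps + 27 * (/ c * / K)) <= / cr * (c + 27 * / c) * (eps + / K)).
  { rewrite Rmult_assoc. apply Rmult_le_compat_l; [lra |].
    assert (0 <= c * / K) by nra. assert (0 <= / c * eps) by nra. nra. }
  assert (B7 : Rabs (2 / 3 * (K * sqrt K * exp (- c * K ^ 4)) -
      2 / 3 * (eps * sqrt eps * exp (- c * eps ^ 4))) <= eps + / c * / K).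
  { apply Rabs_le. lra. }
  assert (0 <= / c * eps) by nra.
  nra.
Qed.

(** * The model for the Green's function *)

Lemma lorentz_integral N a b : 0 < N -> a <= b ->
  ex_RInt (fun t => / (1 + (N * t) ^ 2)) a b /\
  RInt (fun t => / (1 + (N * t) ^ 2)) a b <= PI / N.
Proof.
  intros HN Hab. assert (HP := PI_RGT_0).
  assert (P : forall t, 0 < 1 + (N * t) ^ 2) by (intros t; generalize (pow2_ge_0 (N * t)); lra).
  assert (C : forall t, continuous (fun t => / (1 + (N * t) ^ 2)) t).
  { intros t. specialize (P t). cont_auto. simpl in *; lra. }
  split. { apply ex_RInt_cont; auto. }
  rewrite (RInt_deriv (fun t => / N * atan (N * t))); auto.
  - assert (A1 := atan_bound (N * b)). assert (A2 := atan_bound (N * a)).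
    assert (0 < / N) by now apply Rinv_0_lt_compat. unfold Rdiv. nra.
  - intros t _. eapply is_derive_eq.
    + apply is_derive_scal. apply (is_derive_comp atan (fun t => N * t)).
      * apply is_derive_atan.
      * instantiate (1 := N). auto_derive; trivial. ring.
    + specialize (P t). unfold scal; simpl; unfold mult, Rsqr; simpl in *. field. split; lra.
Qed.

(** The constant comes from squaring 1 + x <= (1 + 2 / c) exp (c x / 2). *)
Lemma exp_absorbs_square c : 0 < c -> exists B, 0 < B /\ forall x, 0 <= x ->
  (1 + x) ^ 2 * exp (- c * x) <= B.
Proof.
  intros Hc. exists ((1 + 2 / c) ^ 2).
  assert (Hc' : 0 < 2 / c) by (apply Rdiv_lt_0_compat; lra).
  split. { apply pow_lt; lra. }
  intros x Hx.
  assert (E : exp (- c * x) = / exp (c / 2 * x) ^ 2).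
  { replace (exp (c / 2 * x) ^ 2) with (exp (c / 2 * x) * exp (c / 2 * x)) by ring.
    rewrite <- exp_plus, <- exp_Ropp. f_equal. field. }
  assert (H1 : 1 + c / 2 * x <= exp (c / 2 * x)).
  { destruct (Req_dec (c / 2 * x) 0) as [-> | Hn]. rewrite exp_0; lra.
    generalize (exp_ineq1 _ Hn); lra. }
  assert (H2 : 1 + x <= (1 + 2 / c) * exp (c / 2 * x)).
  { apply Rle_trans with ((1 + 2 / c) * (1 + c / 2 * x)).
    - replace ((1 + 2 / c) * (1 + c / 2 * x)) with (1 + x + (2 / c + c / 2 * x)) by (field; lra).
      assert (0 <= c / 2 * x) by nra. lra.
    - apply Rmult_le_compat_l; lra. }
  assert (He : 0 < exp (c / 2 * x)) by apply exp_pos.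
  rewrite E. apply Rmult_le_reg_r with (exp (c / 2 * x) ^ 2). { now apply pow_lt. }
  rewrite Rmult_assoc, Rinv_l by (apply Rgt_not_eq; now apply pow_lt).
  rewrite Rmult_1_r, <- Rpow_mult_distr. apply pow_incr. lra.
Qed.

(** These are the profiles met after the scaling s = N t: 1 for the l2 norm, s for the Lipschitz
    constant of the model, s^4 for the weighted l2 norm, s^5 for the error of the model. With a
    common Lorentz bound, one explicit integral serves all four. *)
Lemma quartic_profiles c : 0 < c -> exists B, 0 < B /\ forall s, 0 <= s ->
  exp (- c * s ^ 4) <= B / (1 + s ^ 2) /\
  s * exp (- c * s ^ 4) <= B / (1 + s ^ 2) /\
  s ^ 4 * exp (- c * s ^ 4) <= B / (1 + s ^ 2) /\
  s ^ 5 * exp (- c * s ^ 4) <= B / (1 + s ^ 2).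
Proof.
  intros Hc. destruct (exp_absorbs_square c Hc) as [B [HB H]].
  exists (4 * B). split; [lra |]. intros s Hs.
  assert (Hx : 0 <= s ^ 4) by now apply pow_le.
  specialize (H (s ^ 4) Hx). set (e := exp (- c * s ^ 4)) in *.
  assert (He : 0 < e) by apply exp_pos.
  set (x := s ^ 4) in *.
  assert (S2 : 0 <= s ^ 2) by now apply pow_le.
  assert (S2x : x = s ^ 2 * s ^ 2) by (unfold x; ring).
  assert (K2 : 1 + s ^ 2 <= 2 * (1 + x)) by (rewrite S2x; nra).
  assert (K3 : s * (1 + s ^ 2) <= 2 * (1 + x)).
  { assert (s <= 1 + s ^ 2) by nra. rewrite S2x.
    destruct (Rle_dec s 1).
    - assert (s ^ 2 <= 1) by nra. nra.
    - assert (s <= s ^ 2) by nra. assert (1 <= s ^ 2) by nra.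
      assert (s * s ^ 2 <= s ^ 2 * s ^ 2) by (apply Rmult_le_compat_r; lra). nra. }
  assert (W : forall u, u * (1 + s ^ 2) <= 4 * (1 + x) ^ 2 -> u * e <= 4 * B / (1 + s ^ 2)).
  { intros u Hu. apply Rmult_le_reg_r with (1 + s ^ 2); [lra |].
    unfold Rdiv. rewrite (Rmult_assoc (4 * B)), Rinv_l by lra.
    assert (u * (1 + s ^ 2) * e <= 4 * (1 + x) ^ 2 * e) by (apply Rmult_le_compat_r; lra). lra. }
  repeat split.
  - rewrite <- (Rmult_1_l e). apply W. nra.
  - apply W. nra.
  - apply W. nra.
  - replace (s ^ 5) with (x * s) by (unfold x; ring). apply W.
    rewrite Rmult_assoc. nra.
Qed.

Lemma lorentz_dominated (N M V a b : R) (g : R -> R) : 0 < N -> 0 <= M -> a <= b ->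
  is_RInt g a b V ->
  (forall t, a <= t <= b -> Rabs (g t) <= M * / (1 + (N * t) ^ 2)) ->
  Rabs V <= M * (PI / N).
Proof.
  intros HN HM Hab Hg Hb. destruct (lorentz_integral N a b HN Hab) as [X I].
  rewrite <- (is_RInt_unique _ _ _ _ Hg).
  apply Rle_trans with (RInt (fun t => M * / (1 + (N * t) ^ 2)) a b).
  - apply RInt_abs_le; trivial. now exists V. now apply (ex_RInt_scal (V := R_NormedModule)).
  - rewrite RInt_scal_R by trivial. now apply Rmult_le_compat_l.
Qed.

Lemma pow4_ge_0 t : 0 <= t ^ 4.
Proof. replace (t ^ 4) with ((t ^ 2) ^ 2) by ring. apply pow2_ge_0. Qed.

Lemma pow4_abs t : t ^ 4 = Rabs t ^ 4.
Proof. rewrite RPow_abs, Rabs_right; trivial. apply Rle_ge, pow4_ge_0. Qed.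

(* With [N = n^(1/4)], the model for [green a n j] at [y = j - alpha * n]. *)
Definition model (c3 c4 N y : R) : R :=
  / PI * RInt (fun t => cos (y * t + N ^ 4 * c3 * t ^ 3) * exp (- c4 * (N * t) ^ 4)) 0 PI.

Lemma ex_RInt_model c3 c4 N y a b :
  ex_RInt (fun t => cos (y * t + N ^ 4 * c3 * t ^ 3) * exp (- c4 * (N * t) ^ 4)) a b.
Proof.
  apply ex_RInt_cont_all. cont_auto.
Qed.

Lemma cos_lip x y : Rabs (cos x - cos y) <= Rabs (x - y).
Proof.
  set (m := Rmin x y). set (M := Rmax x y).
  rewrite <- (Rmult_1_l (Rabs (x - y))).
  apply (lip_of_deriv cos (fun t => - sin t) m M).
  - intros. apply is_derive_cos.
  - cont_auto.
  - intros. rewrite Rabs_Ropp. apply Rabs_sin_le.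
  - unfold m, M. split; [apply Rmin_r | apply Rmax_r].
  - unfold m, M. split; [apply Rmin_l | apply Rmax_l].
Qed.

(** A change of [y] brings down a factor t = s / N, and the integration over t gives the second 1 /
    N. *)
Lemma model_lip c3 c4 : 0 < c4 -> exists A, 0 <= A /\ forall N y y', 0 < N ->
  Rabs (model c3 c4 N y - model c3 c4 N y') <= A / N ^ 2 * Rabs (y - y').
Proof.
  intros Hc. assert (HP := PI_RGT_0).
  destruct (quartic_profiles c4 Hc) as [B [HB Hprof]].
  exists B. split; [lra |]. intros N y y' HN. unfold model.
  rewrite <- Rmult_minus_distr_l, <- RInt_minus_R by apply ex_RInt_model.
  assert (HIP : 0 < / PI) by now apply Rinv_0_lt_compat.
  assert (HIN : 0 < / N) by now apply Rinv_0_lt_compat.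
  rewrite Rabs_mult, (Rabs_right (/ PI)) by lra.
  set (f := fun t => _ - _).
  assert (Hf : is_RInt f 0 PI (RInt f 0 PI)).
  { apply (RInt_correct (V := R_CompleteNormedModule)).
    apply (ex_RInt_minus (V := R_NormedModule)); apply ex_RInt_model. }
  assert (HM : 0 <= Rabs (y - y') * (B * / N)).
  { apply Rmult_le_pos; [apply Rabs_pos | apply Rmult_le_pos; lra]. }
  assert (D := lorentz_dominated N _ _ 0 PI f HN HM ltac:(lra) Hf).
  apply Rle_trans with (/ PI * (Rabs (y - y') * (B * / N) * (PI / N))); [| right; field; lra].
  apply Rmult_le_compat_l; [lra |]. apply D. intros t Ht.
  assert (Hs : 0 <= N * t) by (apply Rmult_le_pos; lra).
  destruct (Hprof (N * t) Hs) as [_ [H1 _]].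
  unfold f. rewrite <- Rmult_minus_distr_r, Rabs_mult, (Rabs_right (exp _)) by (left; apply exp_pos).
  assert (H2 : Rabs (cos (y * t + N ^ 4 * c3 * t ^ 3) - cos (y' * t + N ^ 4 * c3 * t ^ 3)) <=
    Rabs (y - y') * t).
  { eapply Rle_trans; [apply cos_lip |].
    replace (y * t + N ^ 4 * c3 * t ^ 3 - (y' * t + N ^ 4 * c3 * t ^ 3)) with ((y - y') * t) by ring.
    rewrite Rabs_mult, (Rabs_right t); lra. }
  eapply Rle_trans; [apply Rmult_le_compat_r; [left; apply exp_pos | exact H2] |].
  replace (Rabs (y - y') * t * exp (- c4 * (N * t) ^ 4)) with
    (Rabs (y - y') * (/ N * (N * t * exp (- c4 * (N * t) ^ 4)))) by (field; lra).
  replace (Rabs (y - y') * (B * / N) * / (1 + (N * t) ^ 2)) with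
    (Rabs (y - y') * (/ N * (B / (1 + (N * t) ^ 2)))) by (unfold Rdiv; ring).
  apply Rmult_le_compat_l; [apply Rabs_pos |]. apply Rmult_le_compat_l; lra.
Qed.

Lemma model_cont c3 c4 N y : 0 < c4 -> 0 < N -> continuous (model c3 c4 N) y.
Proof.
  intros Hc HN. destruct (model_lip c3 c4 Hc) as [A [HA H]].
  assert (HB : exists B, 0 < B /\ forall z, Rabs (model c3 c4 N z - model c3 c4 N y) <= B * Rabs (z - y)).
  { exists ((A + 1) / N ^ 2).
    assert (HN2 : 0 < / N ^ 2) by (apply Rinv_0_lt_compat; now apply pow_lt).
    split. apply Rmult_lt_0_compat; lra.
    intros z. eapply Rle_trans; [now apply H |].
    apply Rmult_le_compat_r; [apply Rabs_pos |]. apply Rmult_le_compat_r; lra. }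
  destruct HB as [B [HB0 HB]].
  intros P [d Hd].
  exists (mkposreal (d / B) ltac:(apply Rdiv_lt_0_compat; [apply cond_pos | trivial])).
  intros z Hz. apply Hd. change (Rabs (z - y) < d / B) in Hz.
  change (Rabs (model c3 c4 N z - model c3 c4 N y) < d).
  eapply Rle_lt_trans; [apply HB |].
  apply Rmult_lt_reg_l with (/ B). now apply Rinv_0_lt_compat.
  rewrite <- Rmult_assoc, Rinv_l, Rmult_1_l, Rmult_comm by lra. exact Hz.
Qed.

Lemma model_abs_le_1 c3 c4 N y : 0 < c4 -> Rabs (model c3 c4 N y) <= 1.
Proof.
  intros Hc. assert (HP := PI_RGT_0). unfold model.
  assert (HIP : 0 < / PI) by now apply Rinv_0_lt_compat.
  rewrite Rabs_mult, (Rabs_right (/ PI)) by lra.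
  apply Rle_trans with (/ PI * ((PI - 0) * 1)); [| right; field; lra].
  apply Rmult_le_compat_l; [lra |]. apply RInt_abs_le_const; try lra. apply ex_RInt_model.
  intros t _. rewrite Rabs_mult, (Rabs_right (exp _)) by (left; apply exp_pos).
  assert (A := Rabs_cos_le (y * t + N ^ 4 * c3 * t ^ 3)).
  assert (A' := Rabs_pos (cos (y * t + N ^ 4 * c3 * t ^ 3))).
  assert (Q := pow4_ge_0 (N * t)).
  assert (E : 0 < exp (- c4 * (N * t) ^ 4) <= 1).
  { split; [apply exp_pos |]. rewrite <- exp_0. apply exp_le. nra. }
  nra.
Qed.

(** For y > 0 the phase derivative y + 3 N^4 c3 t^2 never vanishes, and the damping divided by it
    decreases from the value 1 / y at t = 0. This yields 2 / (PI y), and 2 < PI. *)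
Lemma model_nonstationary c3 c4 N y : 0 < c3 -> 0 < c4 -> 0 < N -> 0 < y ->
  Rabs (model c3 c4 N y) <= / y.
Proof.
  intros Hc3 Hc HN Hy. assert (HP := PI_RGT_0). unfold model.
  assert (HIP : 0 < / PI) by now apply Rinv_0_lt_compat.
  assert (HN4 : 0 < N ^ 4) by now apply pow_lt.
  rewrite Rabs_mult, (Rabs_right (/ PI)) by lra.
  set (ph := fun t => y + 3 * N ^ 4 * c3 * t ^ 2).
  assert (Hph : forall t, y <= ph t).
  { intros t. unfold ph. assert (0 <= t ^ 2) by apply pow2_ge_0.
    assert (0 <= 3 * N ^ 4 * c3 * t ^ 2) by (apply Rmult_le_pos; [nra | trivial]). lra. }
  rewrite (RInt_ext_le _ (fun t => cos (y * t + N ^ 4 * c3 * t ^ 3) * ph t *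
     (exp (- c4 * (N * t) ^ 4) / ph t))); try lra.
  2:{ intros t _. field. specialize (Hph t). lra. }
  apply Rle_trans with (/ PI * (2 * / y)).
  2:{ assert (2 < PI) by (generalize PI2_1; lra).
      assert (/ PI <= / 2) by (apply Rinv_le_contravar; lra).
      assert (0 < / y) by now apply Rinv_0_lt_compat. nra. }
  apply Rmult_le_compat_l; [lra |].
  assert (E0 : exp (- c4 * (N * 0) ^ 4) / ph 0 = / y).
  { unfold ph. replace (- c4 * (N * 0) ^ 4) with 0 by ring. rewrite exp_0. field.
    repeat split; nra. }
  rewrite <- E0.
  apply (osc_decr (fun t => y * t + N ^ 4 * c3 * t ^ 3) ph
    (fun t => exp (- c4 * (N * t) ^ 4) / ph t)
    (fun t => - (exp (- c4 * (N * t) ^ 4) *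
      (4 * c4 * N ^ 4 * t ^ 3 * ph t + 6 * N ^ 4 * c3 * t) / ph t ^ 2))); try lra.
  - intros. unfold ph. auto_derive; trivial. ring.
  - unfold ph. cont_auto.
  - intros t _. specialize (Hph t). eapply is_derive_eq.
    + apply is_derive_div.
      * instantiate (1 := exp (- c4 * (N * t) ^ 4) * (- (4 * c4 * N ^ 4 * t ^ 3))).
        auto_derive; trivial.
        replace (N * t * (N * t * (N * t * (N * t * 1)))) with ((N * t) ^ 4) by ring. ring.
      * instantiate (1 := 6 * N ^ 4 * c3 * t). unfold ph. auto_derive; trivial. ring.
      * lra.
    + unfold Rdiv. simpl. field. lra.
  - intros t _. specialize (Hph t). apply (continuous_opp (V := R_NormedModule)).
    unfold ph in *. cont_auto. simpl in *. apply Rgt_not_eq. nra.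
  - intros t Ht. specialize (Hph t).
    assert (0 <= exp (- c4 * (N * t) ^ 4) *
      (4 * c4 * N ^ 4 * t ^ 3 * ph t + 6 * N ^ 4 * c3 * t) / ph t ^ 2); [| lra].
    assert (0 <= t ^ 3) by (apply pow_le; lra).
    apply Rmult_le_pos.
    + apply Rmult_le_pos. left; apply exp_pos.
      apply Rplus_le_le_0_compat; [apply Rmult_le_pos; [apply Rmult_le_pos |] | apply Rmult_le_pos]; try lra;
        [apply Rmult_le_pos | apply Rmult_le_pos; [apply Rmult_le_pos |]]; lra.
    + left. apply Rinv_0_lt_compat. apply pow_lt. lra.
  - specialize (Hph PI). apply Rmult_le_pos. left; apply exp_pos.
    left; apply Rinv_0_lt_compat; lra.
Qed.

(** With s = N t the phase is N c3 (s^3 - 3 xi^2 s). Adding 2 xi^3 inside the bracket completes it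
    to [cubic], and the compensating constant becomes the shift [w] of the stationary phase
    lemma. *)
Lemma model_scaled c3 c4 N xi : 0 < N ->
  model c3 c4 N (- 3 * c3 * N ^ 2 * xi ^ 2) =
  / (PI * N) * RInt (fun s => cos (N * c3 * cubic xi s - 2 * (N * c3) * xi ^ 3) *
     exp (- c4 * s ^ 4)) 0 (PI * N).
Proof.
  intros HN. assert (HP := PI_RGT_0). unfold model.
  replace 0 with (N * 0 + 0) at 2 by ring. replace (PI * N) with (N * PI + 0) at 2 by ring.
  rewrite <- (RInt_comp_lin (V := R_CompleteNormedModule)
    (fun s => cos (N * c3 * cubic xi s - 2 * (N * c3) * xi ^ 3) * exp (- c4 * s ^ 4))).
  2:{ apply ex_RInt_cont_all. unfold cubic; cont_auto. }
  rewrite (RInt_ext_le (fun y => scal N _) (fun t => N *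
    (cos (- 3 * c3 * N ^ 2 * xi ^ 2 * t + N ^ 4 * c3 * t ^ 3) * exp (- c4 * (N * t) ^ 4)))); try lra.
  - rewrite RInt_scal_R by apply ex_RInt_model. apply Rminus_diag_uniq. field. lra.
  - intros t _. unfold scal; simpl; unfold mult; simpl. unfold cubic.
    rewrite Rplus_0_r. do 2 f_equal. f_equal. simpl. ring.
Qed.

(** The combination is sqrt 2 Ci cos (w - PI / 4). As the sign of [Ci] is not known, |sqrt 2 Ci| =
    sqrt PI / 2 is checked on squares. *)
Lemma cos_plus_sin_abs (Ci w : R) : Ci ^ 2 = PI / 8 ->
  Rabs (cos w * Ci + sin w * Ci) = sqrt PI / 2 * Rabs (cos (w - PI / 4)).
Proof.
  intros H. assert (HP := PI_RGT_0).
  assert (H2 : 0 < sqrt 2) by (apply sqrt_lt_R0; lra).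
  assert (Hs2 : sqrt 2 * sqrt 2 = 2) by (apply sqrt_sqrt; lra).
  assert (Hsp : sqrt PI * sqrt PI = PI) by (apply sqrt_sqrt; lra).
  assert (E : Rabs (Ci * sqrt 2) = sqrt PI / 2).
  { rewrite <- (Rabs_right (sqrt PI / 2)).
    2:{ apply Rle_ge. generalize (sqrt_pos PI); lra. }
    apply Rsqr_eq_abs_0. unfold Rsqr.
    replace (Ci * sqrt 2 * (Ci * sqrt 2)) with (Ci ^ 2 * (sqrt 2 * sqrt 2)) by ring.
    replace (sqrt PI / 2 * (sqrt PI / 2)) with (sqrt PI * sqrt PI / 4) by field.
    rewrite Hs2, Hsp, H. field. }
  rewrite <- E, <- Rabs_mult. f_equal.
  rewrite cos_minus, cos_PI4, sin_PI4. field. lra.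
Qed.

(** Constants of the main window, with the square roots as independent variables so that [field]
    applies: [q] stands for sqrt N, and [sc], [sx], [sp], [s3] for the roots of c3, x, PI and 3. The
    factor 6 c3 (q q)^2 x is the Jacobian of y = - 3 c3 N^2 x^2 in absolute value; the last bracket
    is the stationary phase amplitude. *)
Lemma leading_constant (q c3 x p sc sx sp s3 a b : R) :
  0 < q -> 0 < sc -> 0 < sx -> 0 < sp -> 0 < s3 ->
  sc * sc = c3 -> sx * sx = x -> sp * sp = p -> s3 * s3 = 3 ->
  q * (2 * s3 * sc / sp) * (sx * a * b) =
  6 * c3 * (q * q) ^ 2 * x *
    (/ (p * (q * q)) * (a / (s3 * sx) * (2 / (q * sc) * (sp / 2 * b)))).
Proof.
  intros. subst c3 x p. replace 6 with (2 * (s3 * s3)) by lra. field. repeat split; lra.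
Qed.

(* The parameter [r = N^(1/8) = n^(1/32)] makes all the scales below integer powers;
   the cut-off of the stationary phase lemma is [eta = r^(-3)]. *)
Lemma model_main_window (c3 c4 eps K : R) : 0 < c3 -> 0 < c4 -> 0 < eps <= K ->
  exists A r0, 1 <= r0 /\ forall r, r0 <= r ->
  let N := r ^ 8 in
  Rabs (RInt (fun y => Rabs (model c3 c4 N y)) (- 3 * c3 * N ^ 2 * K ^ 2) (- 3 * c3 * N ^ 2 * eps ^ 2)
    - r ^ 4 * (4 * sqrt 3 * sqrt c3 / (PI * sqrt PI)) *
      RInt (fun x => sqrt x * exp (- c4 * x ^ 4)) eps K) <= A * r ^ 3.
Proof.
  intros Hc3 Hc4 He. assert (HP := PI_RGT_0).
  destruct fresnel_limit as [Ci [Si [HC [HS [HCS HCi]]]]]. subst Si.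
  destruct (stationary_phase c4 eps K Ci Ci HC HS Hc4 He) as [A1 [HA1 SP]].
  set (b := fun x => sqrt x * exp (- c4 * x ^ 4)).
  set (db := fun x => / (2 * sqrt x) * exp (- c4 * x ^ 4) +
     sqrt x * (exp (- c4 * x ^ 4) * (- c4 * (4 * x ^ 3)))).
  assert (Db : forall x, eps <= x <= K -> is_derive b x (db x)).
  { intros x Hx. assert (0 < sqrt x) by (apply sqrt_lt_R0; lra).
    unfold b, db. auto_derive. lra.
    replace (x * (x * (x * (x * 1)))) with (x ^ 4) by ring. field. lra. }
  assert (Cdb : forall x, eps <= x <= K -> continuous db x).
  { intros x Hx. assert (0 < sqrt x) by (apply sqrt_lt_R0; lra).
    unfold db. cont_auto. repeat split; lra. }
  assert (Cb : forall x, eps <= x <= K -> continuous b x).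
  { intros x Hx. eapply is_derive_continuous; now apply Db. }
  destruct (abscos_average b db eps K He Db Cdb) as [A2 AV].
  assert (HA2 : 0 <= A2).
  { assert (H := AV 1 0 Rlt_0_1). eapply Rle_trans; [apply Rabs_pos |].
    eapply Rle_trans; [exact H | lra]. }
  assert (Hsp : 0 < sqrt PI) by now apply sqrt_lt_R0.
  assert (Hsc : 0 < sqrt c3) by now apply sqrt_lt_R0.
  assert (Hs3 : 0 < sqrt 3) by (apply sqrt_lt_R0; lra).
  assert (Hspp : sqrt PI * sqrt PI = PI) by (apply sqrt_sqrt; lra).
  assert (Hscc : sqrt c3 * sqrt c3 = c3) by (apply sqrt_sqrt; lra).
  assert (Hs33 : sqrt 3 * sqrt 3 = 3) by (apply sqrt_sqrt; lra).
  set (c0 := 2 * sqrt 3 * sqrt c3 / sqrt PI).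
  assert (Hc0 : 0 <= c0) by (apply Rmult_le_pos; [nra | left; now apply Rinv_0_lt_compat]).
  assert (Ic3 : 0 < / c3) by now apply Rinv_0_lt_compat.
  (* The first part of the constant comes from stationary phase, the second from averaging |cos|.
     The threshold on [r] gives eta <= eps through 1 / eps <= r, and 2 K <= PI N through K <= r. *)
  exists (K * (6 * c3 * K * / PI * A1 * (1 + / c3)) + c0 * A2 * / c3), (1 + / eps + K).
  assert (Ieps : 0 < / eps) by (apply Rinv_0_lt_compat; lra).
  split; [lra |]. intros r Hr N.
  assert (Hr1 : 1 <= r) by lra.
  assert (Hrk : forall k, (1 <= k)%nat -> r <= r ^ k).
  { intros k Hk. rewrite <- (pow_1 r) at 1. now apply Rle_pow. }
  assert (HNr : r <= N) by (apply Hrk; lia).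
  assert (HN : 0 < N) by lra.
  set (eta := / r ^ 3).
  assert (Hr3 : r <= r ^ 3) by (apply Hrk; lia).
  assert (Heta : 0 < eta <= 1).
  { unfold eta. split. apply Rinv_0_lt_compat; lra. rewrite <- Rinv_1. apply Rinv_le_contravar; lra. }
  assert (Hee : eta <= eps).
  { unfold eta. rewrite <- (Rinv_inv eps). apply Rinv_le_contravar; lra. }
  assert (HT : 2 * K <= PI * N). { generalize PI2_1; intros. nra. }
  assert (HsN : sqrt N = r ^ 4).
  { unfold N. replace (r ^ 8) with (r ^ 4 * r ^ 4) by ring. apply sqrt_square. apply pow_le; lra. }
  assert (Hr4 : 0 < r ^ 4) by (apply pow_lt; lra).
  assert (CA : forall x, continuous (fun x => Rabs (model c3 c4 N (- 3 * c3 * N ^ 2 * x ^ 2))) x).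
  { intros x. apply (continuous_comp (fun x => - 3 * c3 * N ^ 2 * x ^ 2) (fun y => Rabs (model c3 c4 N y))).
    cont_auto. apply continuous_Rabs_comp, model_cont; lra. }
  (* The substitution y = - 3 c3 N^2 x^2 reverses the orientation, which absorbs the negative sign
     of its derivative. *)
  assert (E1 : RInt (fun y => Rabs (model c3 c4 N y)) (- 3 * c3 * N ^ 2 * K ^ 2)
      (- 3 * c3 * N ^ 2 * eps ^ 2) =
    RInt (fun x => 6 * c3 * N ^ 2 * x * Rabs (model c3 c4 N (- 3 * c3 * N ^ 2 * x ^ 2))) eps K).
  { rewrite <- (RInt_comp (V := R_CompleteNormedModule) (fun y => Rabs (model c3 c4 N y))
      (fun x => - 3 * c3 * N ^ 2 * x ^ 2) (fun x => - 6 * c3 * N ^ 2 * x)).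
    - assert (XS : forall u v, ex_RInt (fun x => scal (- 6 * c3 * N ^ 2 * x)
        (Rabs (model c3 c4 N (- 3 * c3 * N ^ 2 * x ^ 2)))) u v).
      { intros. apply ex_RInt_cont_all. intros x.
        apply continuous_Rmult; [cont_auto | apply CA]. }
      rewrite <- (opp_RInt_swap (V := R_CompleteNormedModule)), <- (RInt_opp (V := R_CompleteNormedModule)) by apply XS.
      apply RInt_ext. intros x _. unfold opp, scal; simpl; unfold mult; simpl. ring.
    - intros x _. apply continuous_Rabs_comp, model_cont; lra.
    - intros x _. split. auto_derive; trivial; ring. cont_auto. }
  rewrite E1. clear E1.
  set (err := / PI * A1 * (eta ^ 2 + / (N * c3 * eta))).
  assert (P : forall x, eps <= x <= K ->
    Rabs (6 * c3 * N ^ 2 * x * Rabs (model c3 c4 N (- 3 * c3 * N ^ 2 * x ^ 2)) -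
      r ^ 4 * c0 * (b x * Rabs (cos (2 * (N * c3) * x ^ 3 - PI / 4)))) <=
    6 * c3 * N * K * err).
  { intros x Hx.
    assert (Hlam : 0 < N * c3) by (apply Rmult_lt_0_compat; lra).
    assert (S := SP (N * c3) (2 * (N * c3) * x ^ 3) x eta (PI * N) Hlam Hx Heta Hee HT).
    rewrite model_scaled by trivial.
    set (J := RInt _ 0 (PI * N)) in *.
    assert (Hsx : 0 < sqrt x) by (apply sqrt_lt_R0; lra).
    assert (Hsxx : sqrt x * sqrt x = x) by (apply sqrt_sqrt; lra).
    set (w := 2 * (N * c3) * x ^ 3) in *.
    set (Q := exp (- c4 * x ^ 4) / sqrt (3 * x) * (2 / sqrt (N * c3) * (cos w * Ci + sin w * Ci))) in *.
    assert (EQ : r ^ 4 * c0 * (b x * Rabs (cos (w - PI / 4))) =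
       6 * c3 * N ^ 2 * x * (/ (PI * N) * Rabs Q)).
    { unfold Q. rewrite !Rabs_mult, cos_plus_sin_abs by trivial.
      assert (HsNc : sqrt (N * c3) = r ^ 4 * sqrt c3) by (rewrite sqrt_mult, HsN; lra).
      assert (Hs3x : sqrt (3 * x) = sqrt 3 * sqrt x) by (rewrite sqrt_mult; lra).
      rewrite HsNc, Hs3x.
      rewrite (Rabs_right (exp _ / _)), (Rabs_right (2 / _)).
      2:{ apply Rle_ge, Rmult_le_pos; [lra |]. left; apply Rinv_0_lt_compat; nra. }
      2:{ apply Rle_ge, Rmult_le_pos; [left; apply exp_pos |]. left; apply Rinv_0_lt_compat; nra. }
      unfold c0, b. set (a := exp _). set (cc := Rabs (cos _)).
      replace (N ^ 2) with ((r ^ 4 * r ^ 4) ^ 2) by (unfold N; ring).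
      replace N with (r ^ 4 * r ^ 4) by (unfold N; ring).
      apply leading_constant; lra. }
    rewrite EQ. rewrite Rabs_mult, (Rabs_right (/ (PI * N))).
    2:{ left. apply Rinv_0_lt_compat. nra. }
    rewrite <- Rmult_minus_distr_l, <- Rmult_minus_distr_l.
    assert (HPN : 0 < / (PI * N)) by (apply Rinv_0_lt_compat; nra).
    assert (HN2 : 0 < N ^ 2) by now apply pow_lt.
    assert (HcN : 0 < 6 * c3 * N ^ 2) by nra.
    rewrite !Rabs_mult, (Rabs_right (/ (PI * N))), (Rabs_right x), (Rabs_right (N ^ 2)),
     (Rabs_right c3), (Rabs_right 6) by lra.
    apply Rle_trans with (6 * c3 * N ^ 2 * K * (/ (PI * N) * (A1 * (eta ^ 2 + / (N * c3 * eta))))).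
    - apply Rmult_le_compat.
      + nra.
      + apply Rmult_le_pos; [lra | apply Rabs_pos].
      + apply Rmult_le_compat_l; lra.
      + apply Rmult_le_compat_l; [lra |].
        eapply Rle_trans; [apply Rabs_triang_inv2 | exact S].
    - right. unfold err. field. repeat split; lra. }
  assert (CB : forall x, eps <= x <= K ->
     continuous (fun x => b x * Rabs (cos (2 * (N * c3) * x ^ 3 - PI / 4))) x).
  { intros x Hx. apply continuous_Rmult; auto. apply continuous_Rabs_comp. cont_auto. }
  assert (XB : ex_RInt (fun x => b x * Rabs (cos (2 * (N * c3) * x ^ 3 - PI / 4))) eps K).
  { apply ex_RInt_cont; [lra | auto]. }
  assert (XM : ex_RInt (fun x => 6 * c3 * N ^ 2 * x *
     Rabs (model c3 c4 N (- 3 * c3 * N ^ 2 * x ^ 2))) eps K).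
  { apply ex_RInt_cont; [lra |]. intros. apply continuous_Rmult; [cont_auto | apply CA]. }
  assert (XB' : ex_RInt (fun x => r ^ 4 * c0 *
     (b x * Rabs (cos (2 * (N * c3) * x ^ 3 - PI / 4)))) eps K).
  { now apply (ex_RInt_scal (V := R_NormedModule)). }
  assert (B1 := RInt_abs_le_const _ eps K _ (proj2 He)
    (ex_RInt_minus (V := R_NormedModule) _ _ _ _ XM XB') P).
  assert (E2 := RInt_minus_R _ _ eps K XM XB').
  rewrite RInt_scal_R in E2 by exact XB.
  (* Averaging gains 1 / N, so after multiplication by r^4 = sqrt N this error is only O(r^(-4)). *)
  assert (B2 := AV (N * c3) (PI / 4) ltac:(apply Rmult_lt_0_compat; lra)).
  replace (4 * sqrt 3 * sqrt c3 / (PI * sqrt PI)) with (c0 * (2 / PI)) by (unfold c0; field; lra).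
  set (I1 := RInt (fun x => b x * Rabs (cos (2 * (N * c3) * x ^ 3 - PI / 4))) eps K) in *.
  set (I2 := RInt b eps K) in *.
  change (RInt (fun x => sqrt x * exp (- c4 * x ^ 4)) eps K) with I2.
  set (I3 := RInt (fun x => 6 * c3 * N ^ 2 * x *
     Rabs (model c3 c4 N (- 3 * c3 * N ^ 2 * x ^ 2))) eps K) in *.
  assert (B1' : Rabs (I3 - r ^ 4 * c0 * I1) <= (K - eps) * (6 * c3 * N * K * err)).
  { rewrite <- E2. exact B1. }
  replace (I3 - r ^ 4 * (c0 * (2 / PI)) * I2) with
    ((I3 - r ^ 4 * c0 * I1) + r ^ 4 * c0 * (I1 - 2 / PI * I2)) by (field; lra).
  eapply Rle_trans; [apply Rabs_triang |]. rewrite Rmult_plus_distr_r.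
  assert (IP : 0 < / PI) by now apply Rinv_0_lt_compat.
  apply Rplus_le_compat.
  - eapply Rle_trans; [exact B1' |].
    (* Multiplied by N, the two stationary phase errors become r^2 and r^3 / c3. With eta = r^(-s)
       they would be r^(8 - 2 s) and r^s / c3, both below the main order r^4 exactly when 2 < s < 4:
       hence s = 3. *)
    assert (EN : N * (eta ^ 2 + / (N * c3 * eta)) = r ^ 2 + / c3 * r ^ 3).
    { unfold eta. assert (r <> 0) by lra. replace N with (r ^ 3 * r ^ 3 * r ^ 2) by (unfold N; ring).
      field. lra. }
    assert (Hr2 : r ^ 2 <= r ^ 3) by (apply Rle_pow; [lra | lia]).
    replace ((K - eps) * (6 * c3 * N * K * err)) with
      ((K - eps) * (6 * c3 * K * / PI * A1 * (N * (eta ^ 2 + / (N * c3 * eta)))))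
      by (unfold err; ring).
    rewrite EN.
    apply Rle_trans with (K * ((6 * c3 * K * / PI * A1) * ((1 + / c3) * r ^ 3))); [| right; ring].
    assert (HH : 0 <= 6 * c3 * K * / PI * A1).
    { apply Rmult_le_pos; trivial. apply Rmult_le_pos; [nra | lra]. }
    assert (0 <= / c3 * r ^ 3) by (apply Rmult_le_pos; lra).
    apply Rmult_le_compat; try lra.
    + apply Rmult_le_pos; trivial. apply Rplus_le_le_0_compat; [apply pow2_ge_0 | lra].
    + apply Rmult_le_compat_l; trivial. lra.
  - assert (HcA : 0 <= c0 * A2 * / c3).
    { apply Rmult_le_pos; [now apply Rmult_le_pos | lra]. }
    rewrite Rabs_mult, (Rabs_right (r ^ 4 * c0)) by nra.
    apply Rle_trans with (r ^ 4 * c0 * (A2 / (N * c3))).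
    + apply Rmult_le_compat_l; [nra | exact B2].
    + apply Rle_trans with (c0 * A2 * / c3 * 1).
      * replace (r ^ 4 * c0 * (A2 / (N * c3))) with (c0 * A2 * / c3 * / r ^ 4).
        2:{ unfold N. field. split; lra. }
        apply Rmult_le_compat_l.
        { exact HcA. }
        rewrite <- Rinv_1. apply Rinv_le_contravar; [lra |].
        assert (r <= r ^ 4) by (apply Hrk; lia). lra.
      * apply Rmult_le_compat_l; [exact HcA | lra].
Qed.

(** * Finite sums over Z and trigonometric polynomials *)

Lemma plusR (x y : R) : plus x y = x + y.
Proof. reflexivity. Qed.

(** Windows with a free left end make translating, cutting and enlarging a sum exact operations; the
    abstract group covers real and complex summands. *)
Fixpoint zsum {G : AbelianGroup} (f : Z -> G) (p : Z) (m : nat) : G :=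
  match m with
  | O => zero
  | S k => plus (zsum f p k) (f (p + Z.of_nat k)%Z)
  end.

Lemma zsum_ext {G : AbelianGroup} (f g : Z -> G) p m :
  (forall j, (p <= j < p + Z.of_nat m)%Z -> f j = g j) -> zsum f p m = zsum g p m.
Proof.
  intros H. induction m as [| m IH]; trivial. simpl. rewrite IH, H; trivial. lia.
  intros; apply H; lia.
Qed.

Lemma zsum_zero {G : AbelianGroup} (f : Z -> G) p m :
  (forall j, (p <= j < p + Z.of_nat m)%Z -> f j = zero) -> zsum f p m = zero.
Proof.
  intros H. induction m as [| m IH]; trivial. simpl. rewrite IH, H; try lia.
  apply plus_zero_l. intros; apply H; lia.
Qed.

Lemma zsum_app {G : AbelianGroup} (f : Z -> G) p m k :
  zsum f p (m + k) = plus (zsum f p m) (zsum f (p + Z.of_nat m) k).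
Proof.
  induction k as [| k IH].
  - rewrite Nat.add_0_r. simpl. now rewrite plus_zero_r.
  - rewrite Nat.add_succ_r. simpl. rewrite IH, plus_assoc. do 2 f_equal. lia.
Qed.

Lemma zsum_plus {G : AbelianGroup} (f g : Z -> G) p m :
  zsum (fun j => plus (f j) (g j)) p m = plus (zsum f p m) (zsum g p m).
Proof.
  induction m as [| m IH]; simpl. now rewrite plus_zero_l.
  rewrite IH, <- !plus_assoc. f_equal. rewrite !plus_assoc. f_equal. apply plus_comm.
Qed.

Lemma zsum_shift {G : AbelianGroup} (f : Z -> G) (l p : Z) m :
  zsum (fun j => f (j - l)%Z) p m = zsum f (p - l) m.
Proof.
  induction m as [| m IH]; trivial. simpl. rewrite IH. do 2 f_equal. lia.
Qed.

Lemma zsum_switch {G : AbelianGroup} (f : Z -> Z -> G) p m q k :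
  zsum (fun i => zsum (fun j => f i j) q k) p m = zsum (fun j => zsum (fun i => f i j) p m) q k.
Proof.
  induction m as [| m IH]; simpl.
  - symmetry. now apply zsum_zero.
  - rewrite IH. symmetry. apply zsum_plus.
Qed.

Lemma zsum_support {G : AbelianGroup} (f : Z -> G) p m q k :
  (q <= p)%Z -> (p + Z.of_nat m <= q + Z.of_nat k)%Z ->
  (forall j, (j < p \/ p + Z.of_nat m <= j)%Z -> f j = zero) ->
  zsum f q k = zsum f p m.
Proof.
  intros H1 H2 H.
  replace k with (Z.to_nat (p - q) + (m + Z.to_nat (q + Z.of_nat k - p - Z.of_nat m)))%nat by lia.
  rewrite !zsum_app, (zsum_zero f q), (zsum_zero f (_ + Z.of_nat m)).
  - rewrite plus_zero_l, plus_zero_r. f_equal. lia.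
  - intros j Hj. apply H. lia.
  - intros j Hj. apply H. lia.
Qed.

Lemma zsum_mult_l {K : Ring} (c : K) (f : Z -> K) p m :
  zsum (fun j => mult c (f j)) p m = mult c (zsum f p m).
Proof.
  induction m as [| m IH]; cbn [zsum].
  symmetry; apply mult_zero_r.
  rewrite IH. symmetry; apply mult_distr_l.
Qed.

Lemma zsum_mult_r {K : Ring} (c : K) (f : Z -> K) p m :
  zsum (fun j => mult (f j) c) p m = mult (zsum f p m) c.
Proof.
  induction m as [| m IH]; cbn [zsum].
  symmetry; apply mult_zero_l.
  rewrite IH. symmetry; apply mult_distr_r.
Qed.

(** After the exchange of sums, the outer window translated by any l with |l| <= k still contains
    [- r, r], where [B] lives. *)
Lemma zsum_convolution {K : Ring} (A B : Z -> K) (k r : nat) :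
  (forall j, (Z.of_nat r < Z.abs j)%Z -> B j = zero) ->
  zsum (fun j => zsum (fun l => mult (A l) (B (j - l)%Z)) (- Z.of_nat k) (2 * k + 1))
     (- Z.of_nat (k + r)) (2 * (k + r) + 1) =
  mult (zsum A (- Z.of_nat k) (2 * k + 1)) (zsum B (- Z.of_nat r) (2 * r + 1)).
Proof.
  intros HB. rewrite zsum_switch, <- zsum_mult_r. apply zsum_ext. intros l Hl.
  rewrite zsum_mult_l. f_equal. rewrite zsum_shift. apply zsum_support; try lia.
  intros j Hj. apply HB. lia.
Qed.

Lemma zsum_Re (f : Z -> C) p m : Re (zsum f p m) = zsum (fun j => Re (f j)) p m.
Proof. induction m as [| m IH]; trivial. simpl. now rewrite <- IH. Qed.

Lemma zsum_Im (f : Z -> C) p m : Im (zsum f p m) = zsum (fun j => Im (f j)) p m.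
Proof. induction m as [| m IH]; trivial. simpl. now rewrite <- IH. Qed.

Lemma zsum_le (f g : Z -> R) p m :
  (forall j, (p <= j < p + Z.of_nat m)%Z -> f j <= g j) -> zsum f p m <= zsum g p m.
Proof.
  intros H. induction m as [| m IH]; simpl. apply Rle_refl.
  apply Rplus_le_compat. apply IH; intros; apply H; lia. apply H; lia.
Qed.

Lemma zsum_const (c : R) p m : zsum (fun _ => c) p m = INR m * c.
Proof.
  induction m as [| m IH]. simpl. unfold zero; simpl; ring.
  rewrite S_INR. simpl zsum. rewrite IH. unfold plus; simpl. ring.
Qed.

Lemma Series_finite (f : nat -> R) (n : nat) : (forall k, (n <= k)%nat -> f k = 0) ->
  Series f = zsum (fun j => f (Z.to_nat j)) 0 n.
Proof.
  intros H. apply is_series_unique.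
  apply (filterlim_ext_loc (fun _ => zsum (fun j => f (Z.to_nat j)) 0 n)).
  2: apply filterlim_const.
  exists n. intros k Hk.
  assert (E : forall i, sum_n f i = zsum (fun j => f (Z.to_nat j)) 0 (S i)).
  { induction i as [| i IH].
    - rewrite sum_O. simpl. now rewrite plus_zero_l.
    - rewrite sum_Sn, IH.
      change (zsum (fun j => f (Z.to_nat j)) 0 (S (S i))) with
        (plus (zsum (fun j => f (Z.to_nat j)) 0 (S i)) (f (Z.to_nat (0 + Z.of_nat (S i))))).
      f_equal. f_equal. lia. }
  rewrite E. replace (S k) with (n + (S k - n))%nat by lia. rewrite zsum_app.
  rewrite (zsum_zero _ (0 + Z.of_nat n)), plus_zero_r; trivial.
  intros j Hj. apply H. lia.
Qed.

Lemma RsumZ_finite (f : Z -> R) (n : nat) : (forall l, (Z.of_nat n < Z.abs l)%Z -> f l = 0) ->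
  RsumZ f = zsum f (- Z.of_nat n) (2 * n + 1).
Proof.
  intros H. unfold RsumZ.
  rewrite (Series_finite _ (S n)), (Series_finite _ n).
  2:{ intros k Hk. apply H. lia. } 2:{ intros k Hk. apply H. lia. }
  replace (2 * n + 1)%nat with (n + S n)%nat by lia. rewrite zsum_app, plus_comm.
  apply (f_equal2 Rplus).
  - replace (- Z.of_nat n + Z.of_nat n)%Z with 0%Z by lia.
    apply zsum_ext. intros j Hj. f_equal. lia.
  - clear H. induction n as [| n IH]; trivial.
    change (zsum f (- Z.of_nat (S n)) (S n)) with (zsum f (- Z.of_nat (S n)) (1 + n)).
    rewrite zsum_app, plus_comm.
    replace (- Z.of_nat (S n) + Z.of_nat 1)%Z with (- Z.of_nat n)%Z by lia.
    rewrite <- IH. cbn [zsum]. rewrite plus_zero_l.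
    do 2 f_equal; lia.
Qed.

Lemma CsumZ_finite (f : Z -> C) (n : nat) : (forall l, (Z.of_nat n < Z.abs l)%Z -> f l = RtoC 0) ->
  CsumZ f = zsum f (- Z.of_nat n) (2 * n + 1).
Proof.
  intros H. unfold CsumZ. rewrite !(RsumZ_finite _ n).
  - rewrite <- zsum_Re, <- zsum_Im. now rewrite <- surjective_pairing.
  - intros l Hl. now rewrite H.
  - intros l Hl. now rewrite H.
Qed.

(** * Orthogonality of characters and Parseval's identity *)

Definition cis (t : R) : C := (cos t, sin t).

Lemma cis_plus s t : cis (s + t) = (cis s * cis t)%C.
Proof.
  unfold cis, Cmult; simpl. rewrite cos_plus, sin_plus. f_equal; ring.
Qed.

Lemma cis_0 : cis 0 = RtoC 1.
Proof. unfold cis. now rewrite cos_0, sin_0. Qed.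

Lemma Cmod_cis t : Cmod (cis t) = 1.
Proof.
  unfold Cmod, cis; simpl fst; simpl snd.
  replace (cos t ^ 2 + sin t ^ 2) with 1. apply sqrt_1.
  generalize (sin2_cos2 t). unfold Rsqr. intros; nra.
Qed.

Lemma Re_mult_cis z t : Re (z * cis t)%C = Re z * cos t - Im z * sin t.
Proof. reflexivity. Qed.

(** Complex integrals are encoded by real parts; the arbitrary factor [z] recovers both
    components. *)
Lemma is_RInt_cis (z : C) (k : Z) :
  is_RInt (fun t => Re (z * cis (IZR k * t))%C) (- PI) PI
    (if Z.eq_dec k 0 then 2 * PI * Re z else 0).
Proof.
  assert (HP := PI_RGT_0).
  destruct (Z.eq_dec k 0) as [-> | Hk].
  - apply (is_RInt_ext (fun _ => Re z)).
    + intros t _. rewrite Rmult_0_l, cis_0, Cmult_1_r. reflexivity.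
    + replace (2 * PI * Re z) with (scal (PI - - PI) (Re z)) by (unfold scal; simpl; unfold mult; simpl; ring).
      apply (is_RInt_const (V := R_NormedModule)).
  - assert (Hk' : IZR k <> 0) by now apply not_0_IZR.
    assert (S : sin (IZR k * PI) = 0) by (apply sin_eq_0_1; now exists k).
    apply (is_RInt_ext (fun t => Re z * cos (IZR k * t) - Im z * sin (IZR k * t))).
    + intros t _. now rewrite Re_mult_cis.
    + set (g := fun t => (Re z * sin (IZR k * t) + Im z * cos (IZR k * t)) / IZR k).
      replace 0 with (g PI - g (- PI)).
      * apply is_RInt_deriv; try lra.
        -- intros t _. unfold g. auto_derive; trivial. field; trivial.
        -- cont_auto.
      * unfold g. replace (IZR k * - PI) with (- (IZR k * PI)) by ring.
        rewrite sin_neg, cos_neg, S. field; trivial.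
Qed.

Lemma is_RInt_zero (a b : R) : is_RInt (fun _ => 0) a b 0.
Proof.
  assert (H := is_RInt_const (V := R_NormedModule) a b 0).
  unfold scal in H; simpl in H; unfold mult in H; simpl in H. now rewrite Rmult_0_r in H.
Qed.

Definition trigpoly (c : Z -> C) (p : Z) (m : nat) (t : R) : C :=
  zsum (fun j => (c j * cis (IZR j * t))%C) p m.

Lemma trigpoly_S c p m t :
  trigpoly c p (S m) t = (trigpoly c p m t + c (p + Z.of_nat m)%Z * cis (IZR (p + Z.of_nat m) * t))%C.
Proof. reflexivity. Qed.

(** The value 0 outside the window is part of the statement because Parseval's identity uses the
    coefficient at the index just beyond it. *)
Lemma is_RInt_coeff (c : Z -> C) (p : Z) (m : nat) (q : Z) (z : C) :
  is_RInt (fun t => Re (z * (trigpoly c p m t * cis (- IZR q * t)))%C) (- PI) PI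
    (if Z_le_dec p q then if Z_lt_dec q (p + Z.of_nat m) then 2 * PI * Re (z * c q)%C else 0 else 0).
Proof.
  induction m as [| m IH].
  - replace (if Z_le_dec p q then _ else 0) with 0.
    2:{ destruct (Z_le_dec p q); destruct (Z_lt_dec q (p + Z.of_nat 0)); trivial; lia. }
    apply (is_RInt_ext (fun _ => 0)).
    + intros t _. change (trigpoly c p 0 t) with (RtoC 0). rewrite Cmult_0_l, Cmult_0_r. reflexivity.
    + apply is_RInt_zero.
  - set (k := (p + Z.of_nat m)%Z).
    assert (I2 := is_RInt_cis (z * c k)%C (k - q)).
    refine (is_RInt_ext_eq _ _ _ _ _ _ (is_RInt_plus_R _ _ _ _ _ _ IH I2) _ _).
    + intros t. rewrite trigpoly_S. fold k.
      replace (IZR (k - q) * t) with (IZR k * t + - IZR q * t) by (rewrite minus_IZR; ring).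
      rewrite cis_plus.
      change (Re (z * (trigpoly c p m t * cis (- IZR q * t)))%C + Re (z * c k * (cis (IZR k * t) * cis (- IZR q * t)))%C)
       with (Re (z * (trigpoly c p m t * cis (- IZR q * t)) + (z * c k * (cis (IZR k * t) * cis (- IZR q * t))))%C).
      f_equal. ring.
    + unfold k in *.       destruct (Z_le_dec p q), (Z_lt_dec q (p + Z.of_nat m)), (Z.eq_dec (p + Z.of_nat m - q) 0),
        (Z_lt_dec q (p + Z.of_nat (S m))); try lia; try apply Rplus_0_r.
      replace (p + Z.of_nat m)%Z with q by lia. apply Rplus_0_l.
Qed.

Lemma fourier_coeff (c : Z -> C) (p : Z) (m : nat) (q : Z) (z : C) :
  (p <= q < p + Z.of_nat m)%Z ->
  is_RInt (fun t => Re (z * (trigpoly c p m t * cis (- IZR q * t)))%C) (- PI) PI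
    (2 * PI * Re (z * c q)%C).
Proof.
  intros H. assert (I := is_RInt_coeff c p m q z).
  destruct (Z_le_dec p q), (Z_lt_dec q (p + Z.of_nat m)); try lia. exact I.
Qed.

(** Induction on the window. A new term of index k adds |c k|^2 and the cross term 2 Re (conj (c k)
    T(t) exp (- i k t)); since the polynomial T stops before k, the cross term has integral 0. *)
Lemma parseval (c : Z -> C) (p : Z) (m : nat) :
  is_RInt (fun t => Cmod (trigpoly c p m t) ^ 2) (- PI) PI
    (2 * PI * zsum (fun j => Cmod (c j) ^ 2) p m).
Proof.
  induction m as [| m IH].
  - apply (is_RInt_ext (fun _ => 0)).
    + intros t _. change (trigpoly c p 0 t) with (RtoC 0). rewrite Cmod_0. symmetry; apply pow_i; lia.
    + change (zsum (fun j => Cmod (c j) ^ 2) p 0) with 0. rewrite Rmult_0_r.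
      apply is_RInt_zero.
  - set (k := (p + Z.of_nat m)%Z).
    assert (I2 := is_RInt_coeff c p m k (2 * Cconj (c k))%C).
    replace (if Z_le_dec p k then _ else 0) with 0 in I2.
    2:{ destruct (Z_le_dec p k), (Z_lt_dec k (p + Z.of_nat m)); trivial. lia. }
    assert (I3 : is_RInt (fun _ => Cmod (c k) ^ 2) (- PI) PI ((PI - - PI) * Cmod (c k) ^ 2))
      by apply (is_RInt_const (V := R_NormedModule)).
    refine (is_RInt_ext_eq _ _ _ _ _ _ (is_RInt_plus_R _ _ _ _ _ _ IH
       (is_RInt_plus_R _ _ _ _ _ _ I2 I3)) _ _).
    2:{ change (zsum (fun j => Cmod (c j) ^ 2) p (S m)) with
          (zsum (fun j => Cmod (c j) ^ 2) p m + Cmod (c k) ^ 2).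
        ring. }
    intros t. rewrite trigpoly_S. fold k.
    replace (- IZR k * t) with (- (IZR k * t)) by ring.
    set (T := trigpoly c p m t). set (u := IZR k * t).
    rewrite !Cmod2_alt. unfold cis. rewrite cos_neg, sin_neg.
    destruct T as [a b], (c k) as [x y]. simpl.
    assert (E : cos u ^ 2 + sin u ^ 2 = 1) by (generalize (sin2_cos2 u); unfold Rsqr; intros; nra).
    replace (x * (x * 1)) with ((cos u ^ 2 + sin u ^ 2) * x ^ 2) by (rewrite E; ring).
    replace (y * (y * 1)) with ((cos u ^ 2 + sin u ^ 2) * y ^ 2) by (rewrite E; ring).
    ring.
Qed.

(** * Fourier transform of the Green's function *)

Definition support_in (c : Z -> C) (k : nat) : Prop :=
  forall l, (Z.of_nat k < Z.abs l)%Z -> c l = RtoC 0.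

Lemma finitely_supported_nat (a : Z -> C) : finitely_supported a -> exists k, support_in a k.
Proof.
  intros [s Hs].
  exists (fold_right (fun l m => Nat.max (Z.abs_nat l) m) O s).
  intros l Hl. destruct (Ceq_dec (a l) (RtoC 0)) as [|Hn]; trivial. exfalso.
  assert (W : forall s', In l s' ->
    (Z.abs_nat l <= fold_right (fun l m => Nat.max (Z.abs_nat l) m) O s')%nat).
  { induction s' as [| x s' IH]; simpl; [easy |]. intros [-> | H]; [lia |].
    specialize (IH H). lia. }
  specialize (W s (Hs l Hn)). lia.
Qed.

Lemma laurent_finite (a u : Z -> C) (k : nat) : support_in a k ->
  forall j, laurent a u j =
    zsum (fun l => (a l * u (j - l)%Z)%C) (- Z.of_nat k) (2 * k + 1).
Proof.
  intros Ha j. unfold laurent. apply CsumZ_finite. intros l Hl. rewrite Ha by trivial.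
  apply Cmult_0_l.
Qed.

Lemma green_support (a : Z -> C) (k n : nat) : support_in a k -> support_in (green a n) (n * k).
Proof.
  intros Ha. induction n as [| n IH]; intros j Hj.
  - simpl. unfold delta. destruct (Z.eq_dec j 0); trivial. lia.
  - change (green a (S n) j) with (laurent a (green a n) j).
    rewrite (laurent_finite _ _ k) by trivial. apply (zsum_zero (G := C_AbelianGroup)). intros l Hl.
    rewrite IH by lia. apply Cmult_0_r.
Qed.

(** A Leibniz rule: a weight that is additive along j = l + (j - l) distributes over the product of
    the symbols. The weights 0, 1, 1 give multiplicativity, centred linear weights give the
    derivative of a product. *)
Lemma trigpoly_laurent (a u : Z -> C) (k r : nat) (t : R) (wa wu w : Z -> C) :
  support_in a k -> support_in u r ->
  (forall j l, w j = (wa l + wu (j - l)%Z)%C) ->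
  trigpoly (fun j => w j * laurent a u j)%C (- Z.of_nat (k + r)) (2 * (k + r) + 1) t =
  (trigpoly (fun l => wa l * a l) (- Z.of_nat k) (2 * k + 1) t *
     trigpoly u (- Z.of_nat r) (2 * r + 1) t +
   trigpoly a (- Z.of_nat k) (2 * k + 1) t *
     trigpoly (fun j => wu j * u j) (- Z.of_nat r) (2 * r + 1) t)%C.
Proof.
  intros Ha Hu Hw. unfold trigpoly.
  pose proof (zsum_convolution (K := C_Ring)) as conv.
  unfold mult in conv; simpl in conv.
  etransitivity.
  2:{ apply (f_equal2 Cplus).
      - apply (conv (fun l => (wa l * a l * cis (IZR l * t))%C)
          (fun j => (u j * cis (IZR j * t))%C) k r).
        intros j Hj. rewrite Hu by trivial. apply Cmult_0_l.
      - apply (conv (fun l => (a l * cis (IZR l * t))%C)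
          (fun j => (wu j * u j * cis (IZR j * t))%C) k r).
        intros j Hj. rewrite Hu by trivial. rewrite Cmult_0_r. apply Cmult_0_l. }
  etransitivity.
  2:{ apply (zsum_plus (G := C_AbelianGroup)). }
  apply zsum_ext. intros j _.
  etransitivity.
  2:{ apply (zsum_plus (G := C_AbelianGroup)). }
  rewrite (laurent_finite _ _ k) by trivial.
  pose proof (zsum_mult_l (K := C_Ring)) as ml.
  pose proof (zsum_mult_r (K := C_Ring)) as mr.
  unfold mult in ml, mr; simpl in ml, mr.
  etransitivity.
  { apply (f_equal (fun z => Cmult z (cis (IZR j * t)))). symmetry. apply ml. }
  etransitivity.
  { symmetry. apply mr. }
  apply zsum_ext. intros l _. simpl.
  replace (IZR j * t) with (IZR l * t + IZR (j - l) * t) by (rewrite minus_IZR; ring).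
  rewrite cis_plus, (Hw j l). unfold plus; simpl. ring.
Qed.

Section GreenFourier.
Variables (a : Z -> C) (k : nat).
Hypothesis Ha : support_in a k.
Let F := trigpoly a (- Z.of_nat k) (2 * k + 1).

Lemma green_fourier (n : nat) (t : R) :
  trigpoly (green a n) (- Z.of_nat (n * k)) (2 * (n * k) + 1) t = (F t ^ n)%C.
Proof.
  induction n as [| n IH].
  - unfold trigpoly. simpl. unfold delta; simpl. rewrite Rmult_0_l, cis_0.
    change (RtoC 0 + RtoC 1 * RtoC 1 = RtoC 1)%C. ring.
  - change (green a (S n)) with (laurent a (green a n)).
    rewrite Cpow_S, <- IH.
    assert (E := trigpoly_laurent a (green a n) k (n * k) t (fun _ => RtoC 0) (fun _ => RtoC 1)
      (fun _ => RtoC 1) Ha (green_support a k n Ha)).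
    change (S n * k)%nat with (k + n * k)%nat.
    etransitivity; [| etransitivity; [apply E |]].
    + apply zsum_ext. intros j _. now rewrite Cmult_1_l.
    + intros _ _. ring.
    + fold F. unfold trigpoly at 1. rewrite zsum_zero.
      * change (@zero C_AbelianGroup) with (RtoC 0).
        rewrite Cmult_0_l, Cplus_0_l. f_equal. apply zsum_ext. intros j _. now rewrite Cmult_1_l.
      * intros j _. rewrite Cmult_0_l. apply Cmult_0_l.
Qed.

(** The centring is additive, j - al (n + 1) = (l - al) + ((j - l) - al n), so each convolution
    contributes one derivative term. In effect this differentiates a power of the centred symbol;
    stating it for [S n] avoids the exponent n - 1. *)
Lemma green_fourier_deriv (al : R) (n : nat) (t : R) :
  trigpoly (fun j => RtoC (IZR j - al * INR (S n)) * green a (S n) j)%C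
    (- Z.of_nat (S n * k)) (2 * (S n * k) + 1) t =
  (RtoC (INR (S n)) * F t ^ n *
     trigpoly (fun l => RtoC (IZR l - al) * a l) (- Z.of_nat k) (2 * k + 1) t)%C.
Proof.
  assert (Step : forall n,
    trigpoly (fun j => RtoC (IZR j - al * INR (S n)) * green a (S n) j)%C
      (- Z.of_nat (S n * k)) (2 * (S n * k) + 1) t =
    (trigpoly (fun l => RtoC (IZR l - al) * a l) (- Z.of_nat k) (2 * k + 1) t * F t ^ n +
     F t * trigpoly (fun j => RtoC (IZR j - al * INR n) * green a n j)%C
      (- Z.of_nat (n * k)) (2 * (n * k) + 1) t)%C).
  { intros m. rewrite <- green_fourier.
    apply (trigpoly_laurent a (green a m) k (m * k) t); trivial.
    - now apply green_support.
    - intros j l. rewrite <- RtoC_plus, minus_IZR, S_INR. f_equal. ring. }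
  induction n as [| n IH].
  - rewrite Step.
    replace (trigpoly (fun j => RtoC (IZR j - al * INR 0) * green a 0 j)%C
      (- Z.of_nat (0 * k)) (2 * (0 * k) + 1) t) with (RtoC 0).
    + simpl. ring.
    + symmetry. apply (zsum_zero (G := C_AbelianGroup)). intros j Hj. replace j with 0%Z by lia.
      simpl. rewrite Rmult_0_r, Rminus_0_r, Cmult_0_l. apply Cmult_0_l.
  - rewrite Step, IH, (S_INR (S n)), RtoC_plus, Cpow_S. ring.
Qed.
End GreenFourier.

(** * Bounds on the symbol *)

Lemma Cexp_cis z : Cexp z = (RtoC (exp (Re z)) * cis (Im z))%C.
Proof. unfold Cexp, cis, Cmult, RtoC; simpl. f_equal; ring. Qed.

Lemma Cexp_plus z w : Cexp (z + w)%C = (Cexp z * Cexp w)%C.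
Proof.
  rewrite !Cexp_cis. change (Re (z + w)%C) with (Re z + Re w).
  change (Im (z + w)%C) with (Im z + Im w).
  rewrite exp_plus, cis_plus, RtoC_mult. ring.
Qed.

Lemma Cmod_Cexp z : Cmod (Cexp z) = exp (Re z).
Proof.
  rewrite Cexp_cis, Cmod_mult, Cmod_cis, Cmod_R, Rabs_right by (left; apply exp_pos). ring.
Qed.

Lemma Cexp_0 : Cexp (RtoC 0) = RtoC 1.
Proof. rewrite Cexp_cis. simpl. rewrite exp_0, cis_0. ring. Qed.

Lemma Cexp_pow z n : (Cexp z ^ n)%C = Cexp (RtoC (INR n) * z)%C.
Proof.
  induction n as [| n IH].
  - simpl. rewrite Cmult_0_l, Cexp_0. reflexivity.
  - rewrite Cpow_S, IH, <- Cexp_plus, S_INR, RtoC_plus. f_equal. ring.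
Qed.

Lemma Cexp_imag t : Cexp (Ci * RtoC t)%C = cis t.
Proof.
  rewrite Cexp_cis.
  replace (Re (Ci * RtoC t)%C) with 0 by (unfold Ci, Cmult; simpl; ring).
  replace (Im (Ci * RtoC t)%C) with t by (unfold Ci, Cmult; simpl; ring).
  rewrite exp_0. ring.
Qed.

Lemma Cexp_real t : Cexp (RtoC t) = RtoC (exp t).
Proof. rewrite Cexp_cis. simpl. rewrite cis_0. ring. Qed.

Lemma Cmod_Ci : Cmod Ci = 1.
Proof. rewrite <- (Cmod_cis (PI / 2)). f_equal. unfold cis. now rewrite cos_PI2, sin_PI2. Qed.

Lemma Cmod_le_sum (z : C) : Cmod z <= Rabs (Re z) + Rabs (Im z).
Proof.
  replace z with (RtoC (Re z) + Ci * RtoC (Im z))%C at 1.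
  - eapply Rle_trans; [apply Cmod_triangle |]. rewrite Cmod_mult, !Cmod_R.
    rewrite Cmod_Ci. lra.
  - destruct z as [x y]. unfold Ci, RtoC, Cmult, Cplus; simpl. apply injective_projections; simpl; ring.
Qed.

Lemma Rabs_Im_le (z : C) : Rabs (Im z) <= Cmod z.
Proof. eapply Rle_trans; [apply Rmax_r | apply Rmax_Cmod]. Qed.

(** Engine of the Taylor bounds below: each remainder is the integral of an earlier one, so a bound
    |t|^k on the derivative becomes |x|^(k + 1). Factorials are given up. *)
Lemma lip_origin (f df : R -> R) (L x : R) :
  (forall t, is_derive f t (df t)) -> (forall t, continuous df t) ->
  (forall t, Rabs t <= Rabs x -> Rabs (df t) <= L) ->
  Rabs (f x - f 0) <= L * Rabs x.
Proof.
  intros Hd Hc HL. rewrite <- (Rminus_0_r x) at 2.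
  assert (Hx := Rabs_pos x).
  apply (lip_of_deriv f df (- Rabs x) (Rabs x)); auto.
  - intros t Ht. apply HL. now apply Rabs_le.
  - lra.
  - split; [| apply Rle_abs]. generalize (Rle_abs (- x)). rewrite Rabs_Ropp. lra.
Qed.

Lemma exp_m1_bound u : Rabs (exp u - 1) <= Rabs u * exp (Rabs u).
Proof.
  rewrite <- exp_0 at 1. rewrite (Rmult_comm (Rabs u)).
  apply (lip_origin exp exp).
  - intros; apply is_derive_exp.
  - intros; apply continuous_exp.
  - intros t Ht. rewrite Rabs_right by (left; apply exp_pos). apply exp_le.
    generalize (Rle_abs t). lra.
Qed.

Lemma sin_le_abs x : Rabs (sin x) <= Rabs x.
Proof.
  rewrite <- (Rminus_0_r (sin x)), <- sin_0, <- (Rmult_1_l (Rabs x)).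
  apply (lip_origin sin cos).
  - intros; apply is_derive_sin.
  - intros; apply continuous_cos.
  - intros; apply Rabs_cos_le.
Qed.

Lemma cos_m1_abs x : Rabs (cos x - 1) <= Rabs x.
Proof.
  rewrite <- cos_0. eapply Rle_trans; [apply cos_lip |]. rewrite Rminus_0_r. lra.
Qed.

Lemma cos_m1_sqr x : Rabs (cos x - 1) <= Rabs x ^ 2.
Proof.
  rewrite <- cos_0 at 1. replace (Rabs x ^ 2) with (Rabs x * Rabs x) by ring.
  apply (lip_origin cos (fun t => - sin t)).
  - intros; apply is_derive_cos.
  - cont_auto.
  - intros t Ht. rewrite Rabs_Ropp. generalize (sin_le_abs t). lra.
Qed.

Lemma sin_taylor1 x : Rabs (sin x - x) <= Rabs x ^ 2.
Proof.
  replace (sin x - x) with ((sin x - x) - (sin 0 - 0)) by (rewrite sin_0; ring).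
  replace (Rabs x ^ 2) with (Rabs x * Rabs x) by ring.
  apply (lip_origin (fun t => sin t - t) (fun t => cos t - 1)).
  - intros. auto_derive; trivial. ring.
  - cont_auto.
  - intros t Ht. generalize (cos_m1_abs t). lra.
Qed.

Lemma sin_taylor3 x : Rabs (sin x - x) <= Rabs x ^ 3.
Proof.
  replace (sin x - x) with ((sin x - x) - (sin 0 - 0)) by (rewrite sin_0; ring).
  replace (Rabs x ^ 3) with (Rabs x ^ 2 * Rabs x) by ring.
  apply (lip_origin (fun t => sin t - t) (fun t => cos t - 1)).
  - intros. auto_derive; trivial. ring.
  - cont_auto.
  - intros t Ht. eapply Rle_trans; [apply cos_m1_sqr |].
    apply pow_incr. generalize (Rabs_pos t); lra.
Qed.

Lemma cos_taylor2 x : Rabs (cos x - 1 + x ^ 2 / 2) <= Rabs x ^ 3.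
Proof.
  replace (cos x - 1 + x ^ 2 / 2) with ((cos x - 1 + x ^ 2 / 2) - (cos 0 - 1 + 0 ^ 2 / 2))
    by (rewrite cos_0; field).
  replace (Rabs x ^ 3) with (Rabs x ^ 2 * Rabs x) by ring.
  apply (lip_origin (fun t => cos t - 1 + t ^ 2 / 2) (fun t => - (sin t - t))).
  - intros. auto_derive; trivial. field.
  - cont_auto.
  - intros t Ht. rewrite Rabs_Ropp. eapply Rle_trans; [apply sin_taylor1 |].
    apply pow_incr. generalize (Rabs_pos t); lra.
Qed.

Lemma cis_taylor1 x : Cmod (cis x - 1 - Ci * RtoC x)%C <= 2 * Rabs x ^ 2.
Proof.
  eapply Rle_trans; [apply Cmod_le_sum |].
  replace (Re (cis x - 1 - Ci * RtoC x)%C) with (cos x - 1) by (unfold cis, Ci, RtoC; simpl; ring).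
  replace (Im (cis x - 1 - Ci * RtoC x)%C) with (sin x - x) by (unfold cis, Ci, RtoC; simpl; ring).
  generalize (cos_m1_sqr x) (sin_taylor1 x). lra.
Qed.

Lemma cis_taylor2 x : Cmod (cis x - 1 - Ci * RtoC x + RtoC (x ^ 2 / 2))%C <= 2 * Rabs x ^ 3.
Proof.
  eapply Rle_trans; [apply Cmod_le_sum |].
  replace (Re (cis x - 1 - Ci * RtoC x + RtoC (x ^ 2 / 2))%C) with (cos x - 1 + x ^ 2 / 2)
    by (unfold cis, Ci, RtoC; simpl; ring).
  replace (Im (cis x - 1 - Ci * RtoC x + RtoC (x ^ 2 / 2))%C) with (sin x - x)
    by (unfold cis, Ci, RtoC; simpl; ring).
  generalize (cos_taylor2 x) (sin_taylor3 x). lra.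
Qed.

(** Modulus and argument are separated as exp u (cis v - 1) + (exp u - 1); the first term accounts
    for 2 of the constant 3, the second for 1. *)
Lemma Cexp_m1_bound z : Cmod (Cexp z - 1)%C <= 3 * Cmod z * exp (Cmod z).
Proof.
  set (u := Re z). set (v := Im z).
  assert (Hu : Rabs u <= Cmod z) by apply re_le_Cmod.
  assert (Hv : Rabs v <= Cmod z) by apply Rabs_Im_le.
  replace (Cexp z - 1)%C with (RtoC (exp u) * (cis v - 1) + RtoC (exp u - 1))%C.
  2:{ rewrite Cexp_cis, RtoC_minus. fold u v. ring. }
  eapply Rle_trans; [apply Cmod_triangle |].
  rewrite Cmod_mult, !Cmod_R, (Rabs_right (exp u)) by (left; apply exp_pos).
  assert (C1 : Cmod (cis v - 1)%C <= 2 * Rabs v).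
  { eapply Rle_trans; [apply Cmod_le_sum |].
    replace (Re (cis v - 1)%C) with (cos v - 1) by (unfold cis; simpl; ring).
    replace (Im (cis v - 1)%C) with (sin v) by (unfold cis; simpl; ring).
    generalize (cos_m1_abs v) (sin_le_abs v). lra. }
  assert (C2 := exp_m1_bound u).
  assert (E1 : exp u <= exp (Cmod z)) by (apply exp_le; generalize (Rle_abs u); lra).
  assert (E2 : exp (Rabs u) <= exp (Cmod z)) by (apply exp_le; lra).
  assert (P1 := exp_pos u). assert (P2 := exp_pos (Rabs u)).
  assert (exp u * Cmod (cis v - 1)%C <= exp (Cmod z) * (2 * Cmod z)).
  { apply Rmult_le_compat; try lra. apply Cmod_ge_0. }
  assert (Rabs u * exp (Rabs u) <= Cmod z * exp (Cmod z)).
  { apply Rmult_le_compat; try lra. apply Rabs_pos. }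
  lra.
Qed.

Lemma Cmod_zsum (f : Z -> C) p m : Cmod (zsum f p m) <= zsum (fun j => Cmod (f j)) p m.
Proof.
  induction m as [| m IH].
  - change (Cmod (RtoC 0) <= 0). rewrite Cmod_0. lra.
  - eapply Rle_trans; [apply Cmod_triangle |]. now apply Rplus_le_compat_r.
Qed.

Lemma Fhat_trigpoly (a : Z -> C) (k : nat) (t : R) : support_in a k ->
  Fhat a (RtoC t) = trigpoly a (- Z.of_nat k) (2 * k + 1) t.
Proof.
  intros Ha. unfold Fhat. rewrite (CsumZ_finite _ k).
  - apply zsum_ext. intros j _. rewrite <- Cmult_assoc, <- RtoC_mult, Cexp_imag. reflexivity.
  - intros l Hl. rewrite Ha by trivial. apply Cmult_0_l.
Qed.

(** Differentiability at 0 gives continuity there, hence the bound |phi 0| + 1 nearby. *)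
Lemma holomorphic_near_bounded (phi : C -> C) : holomorphic_near phi (RtoC 0) ->
  exists B, 0 <= B /\ locally (RtoC 0) (fun z => Cmod (phi z) <= B).
Proof.
  intros H. apply locally_singleton in H.
  apply ex_derive_continuous in H.
  exists (Cmod (phi (RtoC 0)) + 1). split.
  { generalize (Cmod_ge_0 (phi (RtoC 0))); lra. }
  apply locally_C.
  assert (L : locally (phi (RtoC 0) : C_NormedModule) (fun w : C => Cmod w <= Cmod (phi (RtoC 0)) + 1)).
  { apply (locally_le_locally_norm (V := C_NormedModule)).
    exists (mkposreal 1 Rlt_0_1). intros w Hw.
    unfold ball_norm in Hw; simpl in Hw.
    change (norm (minus w (phi 0))) with (Cmod (w - phi (RtoC 0))%C) in Hw.
    replace w with (phi (RtoC 0) + (w - phi (RtoC 0)))%C by ring.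
    eapply Rle_trans; [apply Cmod_triangle | lra]. }
  exact (H _ L).
Qed.

Lemma csum_S (f : Z -> C) p m : zsum f p (S m) = (zsum f p m + f (p + Z.of_nat m)%Z)%C :> C.
Proof. reflexivity. Qed.

Lemma csum_0 (f : Z -> C) p : zsum f p 0 = RtoC 0 :> C.
Proof. reflexivity. Qed.

Lemma squeeze_le_0 (x C d : R) : 0 < d -> (forall t, 0 < t < d -> x <= C * t) -> x <= 0.
Proof.
  intros Hd H. destruct (Rle_dec x 0) as [|Hx]; trivial. exfalso.
  assert (HC : 0 < Rabs C + 1) by (generalize (Rabs_pos C); lra).
  set (t := Rmin (d / 2) (x / (2 * (Rabs C + 1)))).
  assert (Ht1 : t <= d / 2) by apply Rmin_l.
  assert (Ht2 : t <= x / (2 * (Rabs C + 1))) by apply Rmin_r.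
  assert (Ht : 0 < t).
  { apply Rmin_glb_lt. lra. apply Rdiv_lt_0_compat; lra. }
  specialize (H t ltac:(lra)).
  assert (C * t <= (Rabs C + 1) * (x / (2 * (Rabs C + 1)))).
  { apply Rle_trans with ((Rabs C + 1) * t).
    - apply Rmult_le_compat_r; [lra |]. generalize (Rle_abs C); lra.
    - apply Rmult_le_compat_l; lra. }
  replace ((Rabs C + 1) * (x / (2 * (Rabs C + 1)))) with (x / 2) in H0 by (field; lra).
  lra.
Qed.

Section Symbol.
Variables (a : Z -> C) (k : nat) (alpha c3 c4 : R).
Hypothesis HA : assumption_A a alpha c3 c4.
Hypothesis Ha : support_in a k.
Let p := (- Z.of_nat k)%Z.
Let m := (2 * k + 1)%nat.
Let F := trigpoly a p m.
(** Centred frequencies. As [h t] is the sum of a_l exp (i b_l t), its derivative is i exp (- i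
    alpha t) [D1 t], so bounds on [D1] are bounds on the derivative of the centred symbol. *)
Let b (l : Z) := IZR l - alpha.
Let D1 := trigpoly (fun l => RtoC (b l) * a l)%C p m.
Let h (t : R) := (F t * cis (- alpha * t))%C.

Lemma symbol_expansion : exists d B, 0 < d /\ 0 <= B /\ forall t, Rabs t < d ->
  exists w, Cmod w <= B /\
  h t = Cexp (RtoC (- c4 * t ^ 4) + Ci * RtoC (- c3 * t ^ 3) + RtoC (t ^ 5) * w)%C.
Proof.
  destruct HA as [_ [_ [_ [_ [_ [phi [Hphi Hloc]]]]]]].
  destruct (holomorphic_near_bounded phi Hphi) as [B [HB HphiB]].
  destruct (filter_and _ _ Hloc HphiB) as [d Hd].
  exists d, B. split; [apply cond_pos |]. split; [exact HB |].
  intros t Ht. destruct (Hd (RtoC t)) as [E1 E2].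
  { split.
    - change (Rabs (t + - 0) < d). replace (t + - 0) with t by ring. exact Ht.
    - change (Rabs (0 + - 0) < d). replace (0 + - 0) with 0 by ring. rewrite Rabs_R0. apply cond_pos. }
  exists (phi (RtoC t)). split; [exact E2 |].
  unfold h, F, p, m. rewrite <- Fhat_trigpoly by exact Ha. rewrite E1, <- Cexp_imag, <- Cexp_plus.
  f_equal. rewrite !RtoC_mult, !RtoC_opp, !RtoC_pow. ring.
Qed.

(** The quartic damping absorbs the remainder t^5 phi: for small t that remainder is at most (c4 /
    2) t^4, and half of the damping survives. For n-th powers, exp (n t^5 w) - 1 is linear in n
    |t|^5 up to an exponential growth, which the other half of the damping pays for. *)
Lemma symbol_local : exists d B, 0 < d /\ 0 <= B /\ forall t, Rabs t < d ->
  Cmod (F t) <= exp (- (c4 / 2) * t ^ 4) /\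
  Cmod (h t - 1)%C <= B * Rabs t ^ 3 /\
  forall n, Cmod (h t ^ n - RtoC (exp (- (INR n * c4 * t ^ 4))) * cis (- (INR n * c3 * t ^ 3)))%C <=
    B * INR n * Rabs t ^ 5 * exp (- (c4 / 2) * (INR n * t ^ 4)).
Proof.
  destruct symbol_expansion as [d [B [Hd [HB H]]]].
  assert (Hc4 : 0 < c4) by apply HA.
  set (S := c4 + Rabs c3 + B).
  assert (HS : 0 <= S) by (unfold S; generalize (Rabs_pos c3); lra).
  assert (HeS : 0 < exp S) by apply exp_pos.
  assert (Hq : 0 < c4 / (2 * (B + 1))) by (apply Rdiv_lt_0_compat; lra).
  (* The radius keeps the expansion valid, forces |t| <= 1 so that powers compare, and gives B |t|
     <= c4 / 2; [B + 1] avoids a division by 0. In the constant, 3 S exp S serves [h - 1] and 3 B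
     the n-th powers. *)
  exists (Rmin (Rmin d 1) (c4 / (2 * (B + 1)))), (3 * S * exp S + 3 * B).
  split. { repeat apply Rmin_glb_lt; lra. }
  split. { assert (0 <= S * exp S) by nra. lra. }
  intros t Ht.
  assert (Ht1 : Rabs t < d).
  { eapply Rlt_le_trans; [exact Ht |]. eapply Rle_trans; [apply Rmin_l | apply Rmin_l]. }
  assert (Ht2 : Rabs t <= 1).
  { left. eapply Rlt_le_trans; [exact Ht |]. eapply Rle_trans; [apply Rmin_l | apply Rmin_r]. }
  assert (Ht3 : B * Rabs t <= c4 / 2).
  { assert (Rabs t <= c4 / (2 * (B + 1))).
    { left. eapply Rlt_le_trans; [exact Ht | apply Rmin_r]. }
    assert ((B + 1) * Rabs t <= (B + 1) * (c4 / (2 * (B + 1)))) by (apply Rmult_le_compat_l; lra).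
    replace ((B + 1) * (c4 / (2 * (B + 1)))) with (c4 / 2) in H1 by (field; lra).
    generalize (Rabs_pos t). lra. }
  destruct (H t Ht1) as [w [Hw Eh]].
  assert (Hat := Rabs_pos t).
  assert (T4 := pow4_abs t).
  assert (T4p : 0 <= t ^ 4) by (rewrite T4; now apply pow_le).
  assert (T5 : B * Rabs t ^ 5 <= c4 / 2 * t ^ 4).
  { rewrite T4. replace (B * Rabs t ^ 5) with (B * Rabs t * Rabs t ^ 4) by ring.
    apply Rmult_le_compat_r; trivial. now apply pow_le. }
  assert (W5 : Cmod (RtoC (t ^ 5) * w)%C <= B * Rabs t ^ 5).
  { rewrite Cmod_mult, Cmod_R, <- RPow_abs, Rmult_comm.
    apply Rmult_le_compat_r; trivial. now apply pow_le. }
  assert (Hmod : Cmod (F t) = Cmod (h t)).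
  { unfold h. rewrite Cmod_mult, Cmod_cis. ring. }
  repeat split.
  - rewrite Hmod, Eh, Cmod_Cexp. apply exp_le.
    replace (Re (RtoC (- c4 * t ^ 4) + Ci * RtoC (- c3 * t ^ 3) + RtoC (t ^ 5) * w)%C) with
      (- c4 * t ^ 4 + Re (RtoC (t ^ 5) * w)%C).
    2:{ unfold Ci, RtoC, Cmult, Cplus, Re; simpl; ring. }
    assert (X := re_le_Cmod (RtoC (t ^ 5) * w)%C).
    generalize (Rle_abs (Re (RtoC (t ^ 5) * w)%C)). lra.
  - rewrite Eh. eapply Rle_trans; [apply Cexp_m1_bound |].
    set (z := (_ + _ + _)%C).
    assert (Hz : Cmod z <= S * Rabs t ^ 3).
    { unfold z. eapply Rle_trans; [apply Cmod_triangle |].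
      eapply Rle_trans; [apply Rplus_le_compat_r, Cmod_triangle |].
      rewrite (Cmod_mult Ci), !Cmod_R.
      rewrite Cmod_Ci, !Rabs_mult, !Rabs_Ropp, (Rabs_right c4), <- !RPow_abs by lra.
      assert (P3 : 0 <= Rabs t ^ 3) by now apply pow_le.
      assert (P4 : Rabs t ^ 4 <= Rabs t ^ 3).
      { replace (Rabs t ^ 4) with (Rabs t * Rabs t ^ 3) by ring. nra. }
      assert (P5 : Rabs t ^ 5 <= Rabs t ^ 3).
      { replace (Rabs t ^ 5) with (Rabs t * Rabs t ^ 4) by ring.
        assert (0 <= Rabs t ^ 4) by now apply pow_le. nra. }
      unfold S. assert (c4 * Rabs t ^ 4 <= c4 * Rabs t ^ 3) by (apply Rmult_le_compat_l; lra).
      assert (B * Rabs t ^ 5 <= B * Rabs t ^ 3) by (apply Rmult_le_compat_l; lra).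
      lra. }
    assert (P3 : 0 <= Rabs t ^ 3) by now apply pow_le.
    assert (P3' : Rabs t ^ 3 <= 1) by (rewrite <- (pow1 3); apply pow_incr; lra).
    assert (Hz2 : exp (Cmod z) <= exp S) by (apply exp_le; nra).
    apply Rle_trans with (3 * (S * Rabs t ^ 3) * exp S).
    + apply Rmult_le_compat; [generalize (Cmod_ge_0 z); lra | left; apply exp_pos | lra | lra].
    + assert (0 <= B * Rabs t ^ 3) by (apply Rmult_le_pos; lra). lra.
  - intros n. rewrite Eh, Cexp_pow.
    set (z := (RtoC (t ^ 5) * w)%C) in *.
    set (x := INR n). assert (Hx : 0 <= x) by apply pos_INR.
    replace (RtoC x * (RtoC (- c4 * t ^ 4) + Ci * RtoC (- c3 * t ^ 3) + z))%C with
      (RtoC (- (x * c4 * t ^ 4)) + Ci * RtoC (- (x * c3 * t ^ 3)) + RtoC x * z)%C.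
    2:{ rewrite !RtoC_opp, !RtoC_mult, !RtoC_opp. ring. }
    rewrite !Cexp_plus, Cexp_real, Cexp_imag.
    set (u := RtoC (exp (- (x * c4 * t ^ 4)))). set (v := cis (- (x * c3 * t ^ 3))).
    replace (u * v * Cexp (RtoC x * z) - u * v)%C with (u * v * (Cexp (RtoC x * z) - 1))%C by ring.
    rewrite !Cmod_mult. unfold v. rewrite Cmod_cis. unfold u. rewrite Cmod_R, Rabs_right by (left; apply exp_pos).
    assert (Hxz : Cmod (RtoC x * z)%C <= x * (B * Rabs t ^ 5)).
    { rewrite Cmod_mult, Cmod_R, Rabs_right by lra. apply Rmult_le_compat_l; lra. }
    assert (X := Cexp_m1_bound (RtoC x * z)%C).
    assert (P5 : 0 <= Rabs t ^ 5) by now apply pow_le.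
    assert (Y : Cmod (Cexp (RtoC x * z) - 1)%C <= 3 * (x * (B * Rabs t ^ 5)) * exp (c4 / 2 * (x * t ^ 4))).
    { eapply Rle_trans; [exact X |]. apply Rmult_le_compat.
      - generalize (Cmod_ge_0 (RtoC x * z)%C); lra.
      - left; apply exp_pos.
      - lra.
      - apply exp_le. eapply Rle_trans; [exact Hxz |].
        replace (c4 / 2 * (x * t ^ 4)) with (x * (c4 / 2 * t ^ 4)) by ring.
        apply Rmult_le_compat_l; lra. }
    rewrite Rmult_1_r.
    apply Rle_trans with (exp (- (x * c4 * t ^ 4)) * (3 * (x * (B * Rabs t ^ 5)) * exp (c4 / 2 * (x * t ^ 4)))).
    { apply Rmult_le_compat_l; [left; apply exp_pos | exact Y]. }
    replace (exp (- (x * c4 * t ^ 4)) * (3 * (x * (B * Rabs t ^ 5)) * exp (c4 / 2 * (x * t ^ 4)))) with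
      (3 * B * (x * Rabs t ^ 5) * (exp (- (x * c4 * t ^ 4)) * exp (c4 / 2 * (x * t ^ 4)))) by ring.
    rewrite <- exp_plus.
    replace (- (x * c4 * t ^ 4) + c4 / 2 * (x * t ^ 4)) with (- (c4 / 2) * (x * t ^ 4)) by field.
    rewrite (Rmult_assoc _ x). apply Rmult_le_compat_r; [left; apply exp_pos |].
    apply Rmult_le_compat_r; [apply Rmult_le_pos; lra |].
    assert (0 <= S * exp S) by nra. lra.
Qed.

Let M1 : C := zsum (fun l => (RtoC (b l) * a l)%C) p m.
Let M2 : C := zsum (fun l => (RtoC (b l ^ 2) * a l)%C) p m.

Lemma cis_shift l t : cis (IZR l * t) = (cis (alpha * t) * cis (b l * t))%C.
Proof. rewrite <- cis_plus. f_equal. unfold b. ring. Qed.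

Lemma cis_shift' l t : (cis (IZR l * t) * cis (- alpha * t))%C = cis (b l * t).
Proof. rewrite <- cis_plus. f_equal. unfold b. ring. Qed.

Lemma symbol_taylor t :
  h t = (1 + Ci * RtoC t * M1 - RtoC (t ^ 2 / 2) * M2 +
    zsum (fun l => (a l * (cis (b l * t) - 1 - Ci * RtoC (b l * t) + RtoC ((b l * t) ^ 2 / 2)))%C) p m)%C.
Proof.
  assert (E1 : (zsum a p m : C) = RtoC 1).
  { destruct HA as [_ [E _]]. rewrite <- E. symmetry. now apply CsumZ_finite. }
  (* With the zeroth moment kept as a sum the identity holds term by term and goes through by
     induction on [m]; its value 1 is inserted at the end. *)
  transitivity (zsum a p m + Ci * RtoC t * M1 - RtoC (t ^ 2 / 2) * M2 +
    zsum (fun l => (a l * (cis (b l * t) - 1 - Ci * RtoC (b l * t) + RtoC ((b l * t) ^ 2 / 2)))%C) p m)%C;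
    [clear E1 | now rewrite E1].
  unfold h, F, trigpoly, M1, M2.
  induction m as [| i IH].
  - rewrite !csum_0. ring.
  - rewrite !csum_S, Cmult_plus_distr_r, IH.
    set (l := (p + Z.of_nat i)%Z).
    assert (Y : (a l * cis (IZR l * t) * cis (- alpha * t) = a l * cis (b l * t))%C)
      by (rewrite <- Cmult_assoc, cis_shift'; reflexivity).
    rewrite Y.
    replace (RtoC ((b l * t) ^ 2 / 2)) with (RtoC (t ^ 2 / 2) * RtoC (b l ^ 2))%C
      by (rewrite <- RtoC_mult; f_equal; field).
    rewrite !RtoC_mult. ring.
Qed.

(* The centred symbol [h] is [1 + O(t^3)]: the first two moments of [a] about [alpha]
   vanish, which makes the centred derivative of the symbol [O(t^2)]. *)
Lemma symbol_moments : M1 = RtoC 0 /\ M2 = RtoC 0.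
Proof.
  destruct symbol_local as [d [B [Hd [HB H]]]].
  set (T := zsum (fun l => Cmod (a l) * (2 * Rabs (b l) ^ 3)) p m).
  assert (R3 : forall t, Cmod (zsum (fun l => (a l * (cis (b l * t) - 1 - Ci * RtoC (b l * t)
     + RtoC ((b l * t) ^ 2 / 2)))%C) p m) <= T * Rabs t ^ 3).
  { intros t. eapply Rle_trans; [apply Cmod_zsum |].
    unfold T. rewrite <- (zsum_mult_r (K := R_Ring)). apply zsum_le. intros l _.
    change (mult (Cmod (a l) * (2 * Rabs (b l) ^ 3)) (Rabs t ^ 3)) with
      (Cmod (a l) * (2 * Rabs (b l) ^ 3) * (Rabs t ^ 3)).
    rewrite Cmod_mult, Rmult_assoc. apply Rmult_le_compat_l; [apply Cmod_ge_0 |].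
    eapply Rle_trans; [apply cis_taylor2 |]. rewrite Rabs_mult. right; ring. }
  assert (Main : forall t, 0 < t < d -> Cmod (Ci * RtoC t * M1 - RtoC (t ^ 2 / 2) * M2)%C <= (B + T) * t ^ 3).
  { intros t Ht. assert (Hat : Rabs t = t) by (apply Rabs_right; lra).
    destruct (H t ltac:(lra)) as [_ [H1 _]]. specialize (R3 t).
    rewrite Hat in *. rewrite symbol_taylor in H1.
    match type of R3 with Cmod ?e <= _ => set (E := e) in * end.
    replace (Ci * RtoC t * M1 - RtoC (t ^ 2 / 2) * M2)%C with
      ((1 + Ci * RtoC t * M1 - RtoC (t ^ 2 / 2) * M2 + E - 1) + - E)%C by ring.
    eapply Rle_trans; [apply Cmod_triangle |]. rewrite Cmod_opp. lra. }
  assert (Z1 : M1 = RtoC 0).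
  { apply Cmod_eq_0. apply Rle_antisym; [| apply Cmod_ge_0].
    (* Here t |M1| <= (B + T) t^3 + t^2 |M2| / 2 is divided by t, with t^2 <= t d. Once [M1] is
       gone, dividing by t^2 / 2 settles [M2] in the same way. *)
    apply (squeeze_le_0 _ ((B + T) * d + Cmod M2 / 2) d Hd). intros t Ht.
    assert (E : Cmod (Ci * RtoC t * M1)%C <= (B + T) * t ^ 3 + t ^ 2 / 2 * Cmod M2).
    { replace (Ci * RtoC t * M1)%C with ((Ci * RtoC t * M1 - RtoC (t ^ 2 / 2) * M2) + RtoC (t ^ 2 / 2) * M2)%C by ring.
      eapply Rle_trans; [apply Cmod_triangle |]. apply Rplus_le_compat; [now apply Main |].
      rewrite Cmod_mult, Cmod_R, Rabs_right; [lra |]. generalize (pow2_ge_0 t); lra. }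
    rewrite !Cmod_mult, Cmod_Ci, Cmod_R, Rabs_right, Rmult_1_l in E by lra.
    assert (HBT : 0 <= B + T).
    { assert (M := Main t Ht). assert (X := Cmod_ge_0 (Ci * RtoC t * M1 - RtoC (t ^ 2 / 2) * M2)%C).
      assert (0 < t ^ 3) by (apply pow_lt; lra). nra. }
    apply Rmult_le_reg_l with t; [lra |]. eapply Rle_trans; [exact E |].
    replace ((B + T) * t ^ 3) with ((B + T) * t ^ 2 * t) by ring.
    assert (0 <= (B + T) * t ^ 2) by (apply Rmult_le_pos; [lra | apply pow2_ge_0]).
    assert ((B + T) * t ^ 2 * t <= (B + T) * t ^ 2 * d) by (apply Rmult_le_compat_l; lra).
    lra. }
  split; trivial.
  apply Cmod_eq_0. apply Rle_antisym; [| apply Cmod_ge_0].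
  apply (squeeze_le_0 _ (2 * (B + T)) d Hd). intros t Ht.
  assert (M := Main t Ht). rewrite Z1 in M.
  replace (Ci * RtoC t * 0 - RtoC (t ^ 2 / 2) * M2)%C with (- (RtoC (t ^ 2 / 2) * M2))%C in M by ring.
  assert (0 < t ^ 2) by (apply pow_lt; lra).
  rewrite Cmod_opp, Cmod_mult, Cmod_R, Rabs_right in M by lra.
  apply Rmult_le_reg_l with (t ^ 2 / 2); [lra |]. eapply Rle_trans; [exact M |]. right; field.
Qed.

(** Expanding to first order leaves the moments [M1] and [M2], both zero, and a quadratic remainder;
    the bound is global in [t] because [cis_taylor1] is. *)
Lemma symbol_deriv_bound : exists B, 0 <= B /\ forall t, Cmod (D1 t) <= B * t ^ 2.
Proof.
  destruct symbol_moments as [Z1 Z2].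
  exists (zsum (fun l => Cmod (RtoC (b l) * a l)%C * (2 * Rabs (b l) ^ 2)) p m).
  assert (Pos : forall l, 0 <= Cmod (RtoC (b l) * a l)%C * (2 * Rabs (b l) ^ 2)).
  { intros l. apply Rmult_le_pos; [apply Cmod_ge_0 |]. generalize (pow2_ge_0 (Rabs (b l))); lra. }
  split.
  { replace 0 with (zsum (fun _ => 0) p m) by (rewrite zsum_const; apply Rmult_0_r).
    apply zsum_le. intros; apply Pos. }
  intros t.
  assert (E : D1 t = (cis (alpha * t) * (M1 + Ci * RtoC t * M2 +
    zsum (fun l => (RtoC (b l) * a l * (cis (b l * t) - 1 - Ci * RtoC (b l * t)))%C) p m))%C).
  { unfold D1, trigpoly, M1, M2. clear. induction m as [| i IH].
    - rewrite !csum_0. ring.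
    - rewrite !csum_S, IH, cis_shift.
      set (l := (p + Z.of_nat i)%Z). rewrite RtoC_mult, RtoC_pow. ring. }
  rewrite E, Z1, Z2, Cmod_mult, Cmod_cis, Rmult_1_l, Cmult_0_r, !Cplus_0_l.
  eapply Rle_trans; [apply Cmod_zsum |].
  rewrite <- (zsum_mult_r (K := R_Ring)). apply zsum_le. intros l _.
  change (mult ?x (t ^ 2)) with (x * (t ^ 2)).
  rewrite Cmod_mult, Rmult_assoc. apply Rmult_le_compat_l; [apply Cmod_ge_0 |].
  eapply Rle_trans; [apply cis_taylor1 |]. rewrite Rabs_mult, Rpow_mult_distr, (pow2_abs t). right; ring.
Qed.

Lemma symbol_mod_cont t : continuous (fun t => Cmod (F t)) t.
Proof.
  assert (C0 : continuous (fun t => Re (F t)) t /\ continuous (fun t => Im (F t)) t).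
  { unfold F, trigpoly. clear. induction m as [| i [IH1 IH2]].
    - split; apply continuous_const.
    - split.
      + apply (continuous_Rplus (fun t => Re (zsum (fun j => (a j * cis (IZR j * t))%C) p i))); trivial.
        apply (continuous_ext (fun t => Re (a (p + Z.of_nat i)%Z) * cos (IZR (p + Z.of_nat i) * t) -
          Im (a (p + Z.of_nat i)%Z) * sin (IZR (p + Z.of_nat i) * t))); [reflexivity |]. cont_auto.
      + apply (continuous_Rplus (fun t => Im (zsum (fun j => (a j * cis (IZR j * t))%C) p i))); trivial.
        apply (continuous_ext (fun t => Re (a (p + Z.of_nat i)%Z) * sin (IZR (p + Z.of_nat i) * t) +
          Im (a (p + Z.of_nat i)%Z) * cos (IZR (p + Z.of_nat i) * t))); [reflexivity |]. cont_auto. }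
  destruct C0 as [C1 C2].
  apply (continuous_comp (fun t => Re (F t) ^ 2 + Im (F t) ^ 2) sqrt).
  - apply continuous_Rplus.
    + apply (continuous_comp (fun t => Re (F t)) (fun x => x ^ 2)); trivial. cont_auto.
    + apply (continuous_comp (fun t => Im (F t)) (fun x => x ^ 2)); trivial. cont_auto.
  - apply continuous_sqrt.
Qed.

(** Compactness turns the strict inequality of the assumption into a uniform gap. *)
Lemma symbol_max (u v : R) : - PI <= u <= v -> v <= PI -> (forall t, u <= t <= v -> t <> 0) ->
  exists M, M < 1 /\ forall t, u <= t <= v -> Cmod (F t) <= M.
Proof.
  intros Hu Hv Hnz.
  destruct (continuity_ab_maj (fun t => Cmod (F t)) u v) as [x [Hx Hux]]; [lra | |].
  { intros t _. apply continuity_pt_filterlim. apply symbol_mod_cont. }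
  exists (Cmod (F x)). split; trivial.
  destruct HA as [_ [_ [H _]]].
  unfold F, p, m. rewrite <- (Fhat_trigpoly a k x Ha). apply H; [lra |]. apply Hnz; trivial.
Qed.

Lemma symbol_decay : exists c, 0 < c <= c4 / 2 /\ forall t, - PI <= t <= PI ->
  Cmod (F t) <= exp (- c * t ^ 4).
Proof.
  destruct symbol_local as [d0 [B [Hd0 [_ H]]]].
  assert (Hc4 : 0 < c4) by apply HA.
  assert (HP := PI_RGT_0).
  (* As d < d0, every t of [- PI, PI] outside the local range lies in one of two compact arcs; the
     cap PI keeps their ends ordered. *)
  set (d := Rmin (d0 / 2) PI).
  assert (Hd : 0 < d) by (apply Rmin_glb_lt; lra).
  assert (Hdd0 : d <= d0 / 2) by apply Rmin_l. assert (HdP : d <= PI) by apply Rmin_r.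
  destruct (symbol_max d PI) as [Mp [HMp Hp]]; try lra. { intros; lra. }
  destruct (symbol_max (- PI) (- d)) as [Mn [HMn Hn]]; try lra. { intros; lra. }
  (* The floor 1/2 makes [M] positive, so that its logarithm can be taken. *)
  set (M := Rmax (Rmax Mp Mn) (/ 2)).
  assert (HM : M < 1) by (repeat apply Rmax_lub_lt; lra).
  assert (HM0 : / 2 <= M) by apply Rmax_r.
  assert (HMpM : Mp <= M) by (eapply Rle_trans; apply Rmax_l).
  assert (HMnM : Mn <= M) by (eapply Rle_trans; [apply Rmax_r | apply Rmax_l]).
  assert (Hln : ln M < 0) by (rewrite <- ln_1; apply ln_increasing; lra).
  assert (HP4 : 0 < PI ^ 4) by (apply pow_lt; lra).
  (* Since c PI^4 <= - ln M, the constant bound [M] is below exp (- c t^4) on all of [- PI, PI]. *)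
  set (c := Rmin (c4 / 2) (- ln M / PI ^ 4)).
  assert (Hc : 0 < c) by (apply Rmin_glb_lt; [lra | apply Rdiv_lt_0_compat; lra]).
  assert (Hc1 : c <= c4 / 2) by apply Rmin_l.
  assert (Hc2 : c * PI ^ 4 <= - ln M).
  { assert (c <= - ln M / PI ^ 4) by apply Rmin_r.
    replace (- ln M) with (- ln M / PI ^ 4 * PI ^ 4) by (field; lra).
    apply Rmult_le_compat_r; lra. }
  exists c. split; [lra |]. intros t Ht.
  assert (T4 := pow4_abs t).
  assert (T4p : 0 <= t ^ 4) by (rewrite T4; apply pow_le, Rabs_pos).
  destruct (Rlt_dec (Rabs t) d0) as [Hs | Hs].
  - eapply Rle_trans; [apply (H t Hs) |]. apply exp_le. nra.
  - assert (Cmod (F t) <= M).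
    { destruct (Rle_dec 0 t) as [H0 | H0].
      - rewrite Rabs_right in Hs by lra. eapply Rle_trans; [apply Hp | exact HMpM]. lra.
      - rewrite Rabs_left in Hs by lra. eapply Rle_trans; [apply Hn | exact HMnM]. lra. }
    eapply Rle_trans; [exact H0 |]. rewrite <- (exp_ln M) by lra. apply exp_le.
    assert (t ^ 4 <= PI ^ 4).
    { rewrite T4. apply pow_incr. split; [apply Rabs_pos | now apply Rabs_le]. }
    assert (c * t ^ 4 <= c * PI ^ 4) by (apply Rmult_le_compat_l; lra). lra.
Qed.

Lemma symbol_bounds : exists c B, 0 < c <= c4 / 2 /\ 0 <= B /\ forall t, - PI <= t <= PI ->
  Cmod (F t) <= exp (- c * t ^ 4) /\
  Cmod (D1 t) <= B * t ^ 2 /\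
  forall n, (1 <= n)%nat ->
    Cmod (h t ^ n - RtoC (exp (- (INR n * c4 * t ^ 4))) * cis (- (INR n * c3 * t ^ 3)))%C <=
    B * INR n * Rabs t ^ 5 * exp (- c * (INR n * t ^ 4)).
Proof.
  destruct symbol_decay as [c [Hc HF]].
  destruct symbol_deriv_bound as [B1 [HB1 HD]].
  destruct symbol_local as [d [B2 [Hd [HB2 HL]]]].
  assert (Hd5 : 0 < d ^ 5) by now apply pow_lt.
  assert (HId : 0 < 2 / d ^ 5) by (apply Rdiv_lt_0_compat; lra).
  (* For |t| >= d both n-th powers are at most exp (- c n t^4), while n |t|^5 >= d^5; the term 2 /
     d^5 makes the local formula valid there too. *)
  exists c, (B1 + B2 + 2 / d ^ 5). split; [lra |]. split; [lra |].
  intros t Ht. split; [now apply HF |]. split.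
  { eapply Rle_trans; [apply HD |]. apply Rmult_le_compat_r; [apply pow2_ge_0 | lra]. }
  intros n Hn. assert (Hx : 1 <= INR n) by (apply (le_INR 1); lia).
  set (x := INR n) in *.
  assert (T4 := pow4_ge_0 t).
  assert (XT : 0 <= x * t ^ 4) by (apply Rmult_le_pos; lra).
  assert (P5 : 0 <= Rabs t ^ 5) by (apply pow_le, Rabs_pos).
  assert (XP5 : 0 <= x * Rabs t ^ 5) by (apply Rmult_le_pos; lra).
  rewrite (Rmult_assoc _ x).
  destruct (Rlt_dec (Rabs t) d) as [Hs | Hs].
  - destruct (HL t Hs) as [_ [_ H]]. eapply Rle_trans; [apply H |]. fold x.
    rewrite (Rmult_assoc _ x). apply Rmult_le_compat.
    + now apply Rmult_le_pos.
    + left; apply exp_pos.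
    + apply Rmult_le_compat_r; lra.
    + apply exp_le. assert (c * (x * t ^ 4) <= c4 / 2 * (x * t ^ 4)) by (apply Rmult_le_compat_r; lra). lra.
  - unfold Cminus. eapply Rle_trans; [apply Cmod_triangle |].
    rewrite Cmod_opp, Cmod_mult, Cmod_cis, Cmod_R, Rabs_right by (left; apply exp_pos).
    assert (E1 : Cmod (h t ^ n)%C <= exp (- c * (x * t ^ 4))).
    { rewrite Cmod_pow. unfold h. rewrite Cmod_mult, Cmod_cis, Rmult_1_r.
      apply Rle_trans with (exp (- c * t ^ 4) ^ n).
      - apply pow_incr. split; [apply Cmod_ge_0 | now apply HF].
      - right. rewrite <- Rpower_pow by apply exp_pos. unfold Rpower. rewrite ln_exp. f_equal. fold x. ring. }
    assert (E2 : exp (- (x * c4 * t ^ 4)) <= exp (- c * (x * t ^ 4))).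
    { apply exp_le. assert (c * (x * t ^ 4) <= c4 * (x * t ^ 4)) by (apply Rmult_le_compat_r; lra). lra. }
    assert (D5 : d ^ 5 <= Rabs t ^ 5) by (apply pow_incr; lra).
    assert (E3 : 2 <= (B1 + B2 + 2 / d ^ 5) * (x * Rabs t ^ 5)).
    { apply Rle_trans with (2 / d ^ 5 * (1 * d ^ 5)); [right; field; lra |].
      apply Rmult_le_compat; try lra. apply Rmult_le_compat; lra. }
    assert (P := exp_pos (- c * (x * t ^ 4))).
    apply Rle_trans with (2 * exp (- c * (x * t ^ 4))); [lra |].
    apply Rmult_le_compat_r; lra.
Qed.
End Symbol.

(** * Comparison of the Green's function with the model *)

Lemma cis_pow t n : (cis t ^ n)%C = cis (INR n * t).
Proof.
  rewrite <- !Cexp_imag, Cexp_pow. f_equal. rewrite RtoC_mult. ring.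
Qed.

Lemma RInt_reflect (f : R -> R) (a : R) : (forall t, continuous f t) ->
  RInt f (- a) 0 = RInt (fun t => f (- t)) 0 a.
Proof.
  intros Hf.
  assert (E : forall g : R -> R, (forall t, continuous g t) -> forall u v, ex_RInt g u v).
  { intros. apply ex_RInt_cont_all. auto. }
  assert (X := RInt_comp_lin (V := R_CompleteNormedModule) f (-1) 0 0 a (E f Hf _ _)).
  replace (-1 * 0 + 0) with 0 in X by ring. replace (-1 * a + 0) with (- a) in X by ring.
  rewrite <- (opp_RInt_swap (V := R_CompleteNormedModule)) by now apply E.
  rewrite <- X, <- (RInt_opp (V := R_CompleteNormedModule)).
  - apply RInt_ext. intros t _. unfold opp, scal; simpl; unfold mult; simpl.
    replace (-1 * t + 0) with (- t) by ring. ring.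
  - apply E. intros t. apply (continuous_scal_r (V := R_NormedModule)).
    apply (continuous_comp (fun t => -1 * t + 0) f); auto. cont_auto.
Qed.

(** The phase is odd and the damping even, so over the symmetric interval the sine part cancels and
    the cosine part doubles: the model is the Fourier coefficient of the comparison symbol, and it
    is real. *)
Lemma is_RInt_model (c3 c4 N y : R) (z : C) :
  is_RInt (fun t => Re (z * (RtoC (exp (- c4 * (N * t) ^ 4)) * cis (- (N ^ 4 * c3 * t ^ 3))
     * cis (- y * t)))%C) (- PI) PI (2 * PI * Re z * model c3 c4 N y).
Proof.
  assert (HP := PI_RGT_0).
  set (E := fun t => cos (y * t + N ^ 4 * c3 * t ^ 3) * exp (- c4 * (N * t) ^ 4)).
  set (O := fun t => sin (y * t + N ^ 4 * c3 * t ^ 3) * exp (- c4 * (N * t) ^ 4)).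
  assert (CE : forall t, continuous E t) by (unfold E; cont_auto).
  assert (CO : forall t, continuous O t) by (unfold O; cont_auto).
  assert (XE : forall u v, ex_RInt E u v).
  { intros. apply ex_RInt_cont_all. auto. }
  assert (XO : forall u v, ex_RInt O u v).
  { intros. apply ex_RInt_cont_all. auto. }
  assert (IE : RInt E (- PI) PI = 2 * PI * model c3 c4 N y).
  { rewrite <- (RInt_Chasles_R E (- PI) 0 PI), RInt_reflect by auto.
    rewrite (RInt_ext (fun t => E (- t)) E).
    - unfold model. fold E. apply Rminus_diag_uniq. field. lra.
    - intros t _. unfold E. rewrite <- cos_neg. f_equal; f_equal; ring. }
  assert (IO : RInt O (- PI) PI = 0).
  { rewrite <- (RInt_Chasles_R O (- PI) 0 PI), RInt_reflect by auto.
    rewrite (RInt_ext (fun t => O (- t)) (fun t => -1 * O t)).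
    - rewrite RInt_scal_R by apply XO. apply Rminus_diag_uniq. ring.
    - intros t _. unfold O.
      replace (y * - t + N ^ 4 * c3 * (- t) ^ 3) with (- (y * t + N ^ 4 * c3 * t ^ 3)) by ring.
      rewrite sin_neg. replace (- c4 * (N * - t) ^ 4) with (- c4 * (N * t) ^ 4) by ring.
      match goal with |- @eq _ ?a ?b => assert (X : a - b = 0) by ring; lra end. }
  assert (JE := RInt_correct (V := R_CompleteNormedModule) _ _ _ (XE (- PI) PI)).
  assert (JO := RInt_correct (V := R_CompleteNormedModule) _ _ _ (XO (- PI) PI)).
  rewrite IE in JE. rewrite IO in JO.
  assert (KE : is_RInt (fun t => Re z * E t) (- PI) PI (Re z * (2 * PI * model c3 c4 N y)))
    by now apply (is_RInt_scal (V := R_NormedModule)).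
  assert (KO : is_RInt (fun t => Im z * O t) (- PI) PI (Im z * 0))
    by now apply (is_RInt_scal (V := R_NormedModule)).
  refine (is_RInt_ext_eq _ _ _ _ _ _ (is_RInt_plus_R _ _ _ _ _ _ KE KO) _ _); [| ring].
  intros t. rewrite <- Cmult_assoc, <- cis_plus.
  replace (- (N ^ 4 * c3 * t ^ 3) + - y * t) with (- (y * t + N ^ 4 * c3 * t ^ 3)) by ring.
  unfold cis. rewrite cos_neg, sin_neg. unfold E, O. destruct z as [u v].
  unfold RtoC, Cmult, Re, Im; simpl. ring.
Qed.

(** The multiplier conj w / |w|, or 0 when w = 0, reduces the modulus of a complex coefficient to
    one real integral. *)
Lemma Cmod_as_Re (w : C) : exists z, Cmod z <= 1 /\ Re (z * w)%C = Cmod w.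
Proof.
  destruct (Req_dec (Cmod w) 0) as [E | E].
  - exists (RtoC 0). rewrite Cmod_0. split; [lra |]. rewrite Cmult_0_l, E. reflexivity.
  - exists (Cconj w * RtoC (/ Cmod w))%C.
    assert (0 < Cmod w) by (generalize (Cmod_ge_0 w); lra).
    split.
    + rewrite Cmod_mult, Cmod_conj, Cmod_R, Rabs_right.
      * right. now apply Rinv_r.
      * left. now apply Rinv_0_lt_compat.
    + replace (Cconj w * RtoC (/ Cmod w) * w)%C with (RtoC (/ Cmod w) * (w * Cconj w))%C by ring.
      rewrite <- Cmod2_conj. simpl. field. trivial.
Qed.

Lemma zsum_nonneg_support (f : Z -> R) (r : nat) (q : Z) (K : nat) :
  (forall j, 0 <= f j) -> (forall j, (Z.of_nat r < Z.abs j)%Z -> f j = 0) ->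
  zsum f q K <= zsum f (- Z.of_nat r) (2 * r + 1).
Proof.
  intros Hf Hr.
  set (q' := Z.min q (- Z.of_nat r)).
  set (K' := Z.to_nat (Z.max (q + Z.of_nat K) (Z.of_nat r + 1) - q')).
  rewrite <- (zsum_support f (- Z.of_nat r) (2 * r + 1) q' K').
  - replace K' with (Z.to_nat (q - q') + (K + Z.to_nat (q' + Z.of_nat K' - q - Z.of_nat K)))%nat by lia.
    rewrite !zsum_app. replace (q' + Z.of_nat (Z.to_nat (q - q')))%Z with q by lia.
    assert (P : forall u v, 0 <= zsum f u v).
    { intros u v. apply Rle_trans with (zsum (fun _ => 0) u v).
      - rewrite zsum_const. right. symmetry. apply Rmult_0_r.
      - apply zsum_le. auto. }
    assert (P1 := P q' (Z.to_nat (q - q'))).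
    assert (P2 := P (q + Z.of_nat K)%Z (Z.to_nat (q' + Z.of_nat K' - q - Z.of_nat K))).
    match goal with |- ?x <= plus ?y (plus ?z ?w) => change (x <= y + (z + w)) end. lra.
  - lia.
  - lia.
  - intros j Hj. apply Hr. lia.
Qed.

(** Arbitrary windows are allowed because the l1 sum is later cut into pieces; nonnegativity
    compares each with the full support, where Parseval's identity applies. *)
Lemma parseval_window (c : Z -> C) (r : nat) (N M : R) (q : Z) (K : nat) :
  support_in c r -> 0 < N -> 0 <= M ->
  (forall t, - PI <= t <= PI ->
     Cmod (trigpoly c (- Z.of_nat r) (2 * r + 1) t) ^ 2 <= M * / (1 + (N * t) ^ 2)) ->
  zsum (fun j => Cmod (c j) ^ 2) q K <= M / N.
Proof.
  intros Hc HN HM Hb. assert (HP := PI_RGT_0).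
  eapply Rle_trans.
  { apply (zsum_nonneg_support _ r).
    - intros; apply pow2_ge_0.
    - intros j Hj. rewrite Hc by trivial. rewrite Cmod_0. ring. }
  assert (D := lorentz_dominated N M _ (- PI) PI _ HN HM ltac:(lra)
    (parseval c (- Z.of_nat r) (2 * r + 1))).
  assert (IN : 0 < / N) by now apply Rinv_0_lt_compat.
  assert (HMN : 0 <= M / N) by (apply Rmult_le_pos; lra).
  apply Rmult_le_reg_l with (2 * PI); [lra |].
  eapply Rle_trans; [eapply Rle_trans; [apply Rle_abs | apply D] |].
  - intros t Ht. rewrite Rabs_right by (apply Rle_ge, pow2_ge_0). now apply Hb.
  - replace (M * (PI / N)) with (PI * (M / N)) by (field; lra).
    assert (0 <= PI * (M / N)) by (apply Rmult_le_pos; lra). lra.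
Qed.

(** With n = N^4, s = N t and dt = ds / N the exponents can be read off: the weighted norm has the
    factor n^2 t^4 = N^4 s^4, hence N^3; the error of the model has n |t|^5 = s^5 / N, hence
    N^(-2). *)
Lemma green_bounds (a : Z -> C) (k : nat) (alpha c3 c4 : R) :
  assumption_A a alpha c3 c4 -> support_in a k ->
  exists A, 0 <= A /\ forall n N, (2 <= n)%nat -> 0 < N -> N ^ 4 = INR n ->
  (forall q K, zsum (fun j => Cmod (green a n j) ^ 2) q K <= A / N) /\
  (forall q K, zsum (fun j => (IZR j - alpha * INR n) ^ 2 * Cmod (green a n j) ^ 2) q K <= A * N ^ 3) /\
  (forall j, Cmod (green a n j - RtoC (model c3 c4 N (IZR j - alpha * INR n)))%C <= A / N ^ 2).
Proof.
  intros HA Ha. assert (HP := PI_RGT_0).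
  destruct (symbol_bounds a k alpha c3 c4 HA Ha) as [c [B [Hc [HB HF]]]].
  destruct (quartic_profiles c ltac:(lra)) as [Q [HQ Hprof]].
  exists (Q + B ^ 2 * Q + B * Q).
  assert (HB2 : 0 <= B ^ 2 * Q) by (apply Rmult_le_pos; [apply pow2_ge_0 | lra]).
  assert (HBQ : 0 <= B * Q) by (apply Rmult_le_pos; lra).
  split; [lra |]. intros n N Hn HN HNn.
  set (F := trigpoly a (- Z.of_nat k) (2 * k + 1)) in *.
  assert (Habs : forall t, (N * t) ^ 4 = (N * Rabs t) ^ 4 /\ (N * t) ^ 2 = (N * Rabs t) ^ 2).
  { intros t. rewrite !Rpow_mult_distr.
    replace (t ^ 4) with ((t ^ 2) ^ 2) by ring. replace (Rabs t ^ 4) with ((Rabs t ^ 2) ^ 2) by ring.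
    now rewrite pow2_abs. }
  assert (Hs : forall t, 0 <= N * Rabs t) by (intros; apply Rmult_le_pos; [lra | apply Rabs_pos]).
  assert (IN : 0 < / N) by now apply Rinv_0_lt_compat.
  assert (Hsupp := green_support a k n Ha).
  split; [| split].
  - intros q K. eapply Rle_trans; [apply (parseval_window _ (n * k) N Q); trivial; try lra |].
    { intros t Ht. rewrite green_fourier by trivial. fold F.
      destruct (HF t Ht) as [H1 _]. destruct (Hprof (N * Rabs t) (Hs t)) as [H2 _].
      destruct (Habs t) as [A4 A2]. rewrite <- A4, <- A2 in H2.
      eapply Rle_trans; [| exact H2].
      rewrite Cmod_pow, <- pow_mult.
      apply Rle_trans with (exp (- c * t ^ 4) ^ (n * 2)).
      { apply pow_incr. split; [apply Cmod_ge_0 | exact H1]. }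
      rewrite <- Rpower_pow by apply exp_pos. unfold Rpower. rewrite ln_exp.
      apply exp_le. rewrite mult_INR, Rpow_mult_distr, HNn.
      assert (T4 := pow4_ge_0 t).
      assert (0 <= INR n) by apply pos_INR. simpl (INR 2).
      assert (0 <= c * (INR n * t ^ 4)) by (apply Rmult_le_pos; [lra | now apply Rmult_le_pos]). lra. }
    apply Rmult_le_compat_r; lra.
  - intros q K. destruct n as [| n']; [lia |]. set (n := S n') in *.
    set (c' := fun j => (RtoC (IZR j - alpha * INR n) * green a n j)%C).
    rewrite (zsum_ext _ (fun j => Cmod (c' j) ^ 2)).
    2:{ intros j _. unfold c'. rewrite Cmod_mult, Cmod_R, Rpow_mult_distr, pow2_abs. reflexivity. }
    assert (HN4 : 0 < N ^ 4) by now apply pow_lt.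
    assert (HM : 0 <= N ^ 4 * B ^ 2 * Q)
      by (apply Rmult_le_pos; [apply Rmult_le_pos; [lra | apply pow2_ge_0] | lra]).
    eapply Rle_trans; [apply (parseval_window c' (n * k) N (N ^ 4 * B ^ 2 * Q)); trivial |].
    { intros j Hj. unfold c'. rewrite Hsupp by trivial. apply Cmult_0_r. }
    { intros t Ht. unfold c', n. rewrite green_fourier_deriv by trivial. fold F. fold n.
      destruct (HF t Ht) as [H1 [H1' _]]. destruct (Hprof (N * Rabs t) (Hs t)) as [_ [_ [H2 _]]].
      destruct (Habs t) as [A4 A2]. rewrite <- A4, <- A2 in H2.
      set (D1 := trigpoly _ _ _ t) in *.
      rewrite !Cmod_mult, Cmod_R, (Rpow_mult_distr (Rabs (INR n) * _)), (Rpow_mult_distr (Rabs (INR n))),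
        pow2_abs, Cmod_pow, <- pow_mult, <- HNn.
      assert (T4 := pow4_ge_0 t).
      apply Rle_trans with ((N ^ 4) ^ 2 * exp (- c * (N * t) ^ 4) * (B * t ^ 2) ^ 2).
      - apply Rmult_le_compat.
        + apply Rmult_le_pos; [apply pow2_ge_0 | apply pow_le, Cmod_ge_0].
        + apply pow2_ge_0.
        + apply Rmult_le_compat_l; [apply pow2_ge_0 |].
          apply Rle_trans with (exp (- c * t ^ 4) ^ (n' * 2)).
          { apply pow_incr. split; [apply Cmod_ge_0 | exact H1]. }
          rewrite <- Rpower_pow by apply exp_pos. unfold Rpower. rewrite ln_exp.
          apply exp_le. rewrite mult_INR, Rpow_mult_distr, HNn. simpl (INR 2).
          unfold n. rewrite S_INR.
          (* Differentiation leaves n - 1 factors of the symbol; n >= 2 gives 2 (n - 1) >= n, so the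
             square still decays like exp (- c n t^4). *)
          assert (1 <= INR n') by (apply (le_INR 1); lia).
          assert (0 <= c * t ^ 4) by (apply Rmult_le_pos; lra). nra.
        + apply pow_incr. split; [apply Cmod_ge_0 | exact H1'].
      - replace ((N ^ 4) ^ 2 * exp (- c * (N * t) ^ 4) * (B * t ^ 2) ^ 2) with
          (N ^ 4 * B ^ 2 * ((N * t) ^ 4 * exp (- c * (N * t) ^ 4))) by ring.
        rewrite (Rmult_assoc (N ^ 4 * B ^ 2) Q). apply Rmult_le_compat_l; [| exact H2].
        apply Rmult_le_pos; [lra | apply pow2_ge_0]. }
    assert (HN3 : 0 < N ^ 3) by now apply pow_lt.
    replace (N ^ 4 * B ^ 2 * Q / N) with (B ^ 2 * Q * N ^ 3) by (field; lra).
    apply Rmult_le_compat_r; lra.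
  - intros j. set (y := IZR j - alpha * INR n).
    destruct (Cmod_as_Re (green a n j - RtoC (model c3 c4 N y))%C) as [z [Hz Ez]].
    (* The window is enlarged to contain [j], so that indices outside the support need no separate
       case. *)
    set (r := Nat.max (n * k) (Z.abs_nat j)).
    assert (I1 := fourier_coeff (green a n) (- Z.of_nat r) (2 * r + 1) j z ltac:(lia)).
    assert (I2 := is_RInt_model c3 c4 N y z).
    assert (I3 : is_RInt (fun t =>
      Re (z * (trigpoly (green a n) (- Z.of_nat r) (2 * r + 1) t * cis (- IZR j * t)))%C -
      Re (z * (RtoC (exp (- c4 * (N * t) ^ 4)) * cis (- (N ^ 4 * c3 * t ^ 3)) * cis (- y * t)))%C)
      (- PI) PI (2 * PI * Re (z * green a n j)%C - 2 * PI * Re z * model c3 c4 N y))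
      by now apply (is_RInt_minus (V := R_NormedModule)).
    replace (2 * PI * Re (z * green a n j)%C - 2 * PI * Re z * model c3 c4 N y) with
      (2 * PI * Cmod (green a n j - RtoC (model c3 c4 N y))%C) in I3.
    2:{ rewrite <- Ez. destruct z as [u v], (green a n j) as [u' v'].
        unfold RtoC, Cminus, Cplus, Copp, Cmult, Re; simpl. ring. }
    assert (D := lorentz_dominated N (B * Q * / N) _ (- PI) PI _ HN ltac:(apply Rmult_le_pos; lra) ltac:(lra) I3).
    assert (D' : forall t, - PI <= t <= PI -> Rabs (
      Re (z * (trigpoly (green a n) (- Z.of_nat r) (2 * r + 1) t * cis (- IZR j * t)))%C -
      Re (z * (RtoC (exp (- c4 * (N * t) ^ 4)) * cis (- (N ^ 4 * c3 * t ^ 3)) * cis (- y * t)))%C) <=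
      B * Q * / N * / (1 + (N * t) ^ 2)).
    { intros t Ht.
      assert (ET : trigpoly (green a n) (- Z.of_nat r) (2 * r + 1) t = (F t ^ n)%C).
      { unfold F. rewrite <- green_fourier by trivial. unfold trigpoly.
        apply (zsum_support (G := C_AbelianGroup)); try lia.
        intros i Hi. rewrite Hsupp by lia. apply Cmult_0_l. }
      rewrite ET.
      destruct (HF t Ht) as [_ [_ H3]]. specialize (H3 n ltac:(lia)).
      destruct (Hprof (N * Rabs t) (Hs t)) as [_ [_ [_ H2]]].
      destruct (Habs t) as [A4 A2]. rewrite <- A4, <- A2 in H2.
      set (U := (F t * cis (- alpha * t))%C) in *.
      assert (EU : (F t ^ n * cis (- IZR j * t) = U ^ n * cis (- y * t))%C).
      { unfold U. rewrite Cpow_mult_l, cis_pow, <- Cmult_assoc, <- cis_plus. do 2 f_equal.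
        unfold y. ring. }
      rewrite EU. rewrite HNn.
      replace (- c4 * (N * t) ^ 4) with (- (INR n * c4 * t ^ 4)) by (rewrite <- HNn; ring).
      set (V := (RtoC (exp (- (INR n * c4 * t ^ 4))) * cis (- (INR n * c3 * t ^ 3)))%C) in *.
      change (Rabs (Re (z * (U ^ n * cis (- y * t)) - z * (V * cis (- y * t)))%C) <=
        B * Q * / N * / (1 + (N * t) ^ 2)).
      eapply Rle_trans; [apply re_le_Cmod |].
      replace (z * (U ^ n * cis (- y * t)) - z * (V * cis (- y * t)))%C with
        (z * (U ^ n - V) * cis (- y * t))%C by ring.
      rewrite !Cmod_mult, Cmod_cis, Rmult_1_r.
      apply Rle_trans with (1 * Cmod (U ^ n - V)%C).
      { apply Rmult_le_compat_r; [apply Cmod_ge_0 | exact Hz]. }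
      rewrite Rmult_1_l. eapply Rle_trans; [exact H3 |].
      rewrite <- HNn.
      replace (B * N ^ 4 * Rabs t ^ 5 * exp (- c * (N ^ 4 * t ^ 4))) with
        (B * / N * ((N * Rabs t) ^ 5 * exp (- c * (N * t) ^ 4))).
      2:{ replace ((N * t) ^ 4) with (N ^ 4 * t ^ 4) by ring. field. lra. }
      replace (B * Q * / N * / (1 + (N * t) ^ 2)) with (B * / N * (Q / (1 + (N * t) ^ 2)))
        by (unfold Rdiv; ring).
      apply Rmult_le_compat_l; [apply Rmult_le_pos; lra | exact H2]. }
    specialize (D D').
    rewrite Rabs_right in D.
    2:{ apply Rle_ge. apply Rmult_le_pos; [lra | apply Cmod_ge_0]. }
    set (X := Cmod _) in *.
    apply Rmult_le_reg_l with (2 * PI); [lra |]. eapply Rle_trans; [exact D |].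
    replace (B * Q * / N * (PI / N)) with (PI * (B * Q * / N ^ 2)) by (field; lra).
    assert (IN2 : 0 < / N ^ 2) by (apply Rinv_0_lt_compat; now apply pow_lt).
    unfold Rdiv.
    assert (0 <= B * Q * / N ^ 2) by (apply Rmult_le_pos; lra).
    assert (0 <= (Q + B ^ 2 * Q) * / N ^ 2) by (apply Rmult_le_pos; lra).
    rewrite Rmult_assoc. assert (PI * (B * Q * / N ^ 2) <= PI * ((Q + B ^ 2 * Q + B * Q) * / N ^ 2)).
    { apply Rmult_le_compat_l; lra. }
    assert (0 <= PI * ((Q + B ^ 2 * Q + B * Q) * / N ^ 2)) by (apply Rmult_le_pos; lra). lra.
Qed.

(** * The l1 norm *)

Lemma rsum_S (f : Z -> R) p m : zsum f p (S m) = zsum f p m + f (p + Z.of_nat m)%Z :> R.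
Proof. reflexivity. Qed.

Lemma rsum_0 (f : Z -> R) p : zsum f p 0 = 0 :> R.
Proof. reflexivity. Qed.

Lemma zsum_lin (f g : Z -> R) (u v : R) p m :
  zsum (fun j => u * f j + v * g j) p m = u * zsum f p m + v * zsum g p m :> R.
Proof.
  induction m as [| m IH]. rewrite !rsum_0; ring. rewrite !rsum_S, IH. ring.
Qed.

Lemma zsum_abs_le (f : Z -> R) p m M :
  (forall j, (p <= j < p + Z.of_nat m)%Z -> Rabs (f j) <= M) -> Rabs (zsum f p m) <= INR m * M.
Proof.
  intros H. induction m as [| m IH].
  - rewrite rsum_0, Rabs_R0. simpl. lra.
  - rewrite rsum_S, S_INR. eapply Rle_trans; [apply Rabs_triang |].
    assert (Rabs (zsum f p m) <= INR m * M) by (apply IH; intros; apply H; lia).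
    assert (Rabs (f (p + Z.of_nat m)%Z) <= M) by (apply H; lia). lra.
Qed.

(** Telescoping, with 1 / y^2 <= 1 / (y - 1) - 1 / y for y > 1. *)
Lemma inv_sq_sum_right (be : R) (p : Z) (m : nat) : 1 < IZR p - be ->
  zsum (fun j => / (IZR j - be) ^ 2) p m <=
  / (IZR p - be - 1) - / (IZR (p + Z.of_nat m) - be - 1).
Proof.
  intros Hp. induction m as [| m IH].
  - rewrite rsum_0. replace (p + Z.of_nat 0)%Z with p by lia. lra.
  - rewrite rsum_S. set (y := IZR (p + Z.of_nat m) - be) in *.
    assert (Hy : IZR p - be <= y).
    { unfold y. rewrite plus_IZR. assert (0 <= IZR (Z.of_nat m)) by (apply (IZR_le 0); lia). lra. }
    replace (IZR (p + Z.of_nat (S m)) - be - 1) with y.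
    2:{ unfold y. replace (p + Z.of_nat (S m))%Z with (p + Z.of_nat m + 1)%Z by lia.
        rewrite (plus_IZR _ 1). ring. }
    assert (/ y ^ 2 <= / (y - 1) - / y).
    { replace (/ (y - 1) - / y) with (/ ((y - 1) * y)) by (field; lra).
      apply Rinv_le_contravar; nra. }
    lra.
Qed.

Lemma inv_sq_sum_left (be : R) (p : Z) (m : nat) : IZR (p + Z.of_nat m) - be < 0 ->
  zsum (fun j => / (IZR j - be) ^ 2) p m <=
  / (be - IZR (p + Z.of_nat m)) - / (be - IZR p).
Proof.
  induction m as [| m IH]; intros Hp.
  - rewrite rsum_0. replace (p + Z.of_nat 0)%Z with p by lia. lra.
  - rewrite rsum_S. set (y := be - IZR (p + Z.of_nat m)) in *.
    assert (E : be - IZR (p + Z.of_nat (S m)) = y - 1).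
    { unfold y. replace (p + Z.of_nat (S m))%Z with (p + Z.of_nat m + 1)%Z by lia.
      rewrite (plus_IZR _ 1). ring. }
    rewrite E. specialize (IH ltac:(unfold y in E; lra)).
    assert (/ y ^ 2 <= / (y - 1) - / y).
    { replace (/ (y - 1) - / y) with (/ ((y - 1) * y)) by (field; lra).
      apply Rinv_le_contravar; nra. }
    replace (IZR (p + Z.of_nat m) - be) with (- y) by (unfold y; ring).
    replace ((- y) ^ 2) with (y ^ 2) by ring. lra.
Qed.

(** On a unit cell the left value and the integral differ by at most [L]. With [L] of order 1 / N^2
    and O(N^2) cells the total is O(1). *)
Lemma zsum_RInt_lip (f : R -> R) (L be : R) (p : Z) (m : nat) :
  (forall x, continuous f x) -> (forall x y, Rabs (f x - f y) <= L * Rabs (x - y)) -> 0 <= L ->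
  Rabs (zsum (fun j => f (IZR j - be)) p m -
    RInt f (IZR p - be) (IZR (p + Z.of_nat m) - be)) <= INR m * L.
Proof.
  intros Hc HL HL0.
  assert (X : forall a b, ex_RInt f a b).
  { intros. apply ex_RInt_cont_all. auto. }
  induction m as [| m IH].
  - rewrite rsum_0. replace (p + Z.of_nat 0)%Z with p by lia. rewrite RInt_point.
    unfold zero; simpl. rewrite Rminus_0_r, Rabs_R0. lra.
  - rewrite rsum_S. set (y := IZR (p + Z.of_nat m) - be) in *.
    replace (IZR (p + Z.of_nat (S m)) - be) with (y + 1).
    2:{ unfold y. replace (p + Z.of_nat (S m))%Z with (p + Z.of_nat m + 1)%Z by lia.
        rewrite (plus_IZR _ 1). ring. }
    rewrite <- (RInt_Chasles_R f (IZR p - be) y (y + 1)) by apply X.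
    assert (E : Rabs (RInt (fun x => f y - f x) y (y + 1)) <= (y + 1 - y) * L).
    { apply RInt_abs_le_const; try lra.
      - apply ex_RInt_cont; [lra |]. intros. apply continuous_Rminus; auto. apply continuous_const.
      - intros x Hx. eapply Rle_trans; [apply HL |]. rewrite <- (Rmult_1_r L) at 2.
        apply Rmult_le_compat_l; trivial. apply Rabs_le; lra. }
    rewrite RInt_minus_R, RInt_const in E by (apply X || apply ex_RInt_const).
    unfold scal in E; simpl in E; unfold mult in E; simpl in E.
    rewrite S_INR.
    match goal with |- Rabs (?u + ?v - (?w + ?z)) <= _ =>
      replace (u + v - (w + z)) with ((u - w) + ((y + 1 - y) * f y - z)) by ring end.
    eapply Rle_trans; [apply Rabs_triang |]. lra.
Qed.

Lemma up_spec x : x < IZR (up x) <= x + 1.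
Proof. destruct (archimed x). lra. Qed.

Lemma up_le x y : x <= y -> (up x <= up y)%Z.
Proof.
  intros H. assert (A := up_spec x). assert (B := up_spec y).
  assert (IZR (up x) < IZR (up y + 1)) by (rewrite plus_IZR; lra).
  apply lt_IZR in H0. lia.
Qed.

(** Half-open segments, so that consecutive ones share their cut point. *)
Definition zseg (f : Z -> R) (p q : Z) : R := zsum f p (Z.to_nat (q - p)).

Lemma zseg_app f p q s : (p <= q <= s)%Z -> zseg f p s = zseg f p q + zseg f q s.
Proof.
  intros H. unfold zseg.
  replace (Z.to_nat (s - p)) with (Z.to_nat (q - p) + Z.to_nat (s - q))%nat by lia.
  rewrite zsum_app. rewrite plusR. do 2 f_equal. lia.
Qed.

Lemma zseg_nonneg f p q : (forall j, 0 <= f j) -> 0 <= zseg f p q.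
Proof.
  intros Hf. apply Rle_trans with (zsum (fun _ => 0) p (Z.to_nat (q - p))).
  - rewrite zsum_const. lra.
  - apply zsum_le. auto.
Qed.

Lemma INR_seg p q : (p <= q)%Z -> INR (Z.to_nat (q - p)) = IZR q - IZR p.
Proof. intros H. rewrite INR_IZR_INZ, Z2Nat.id by lia. apply minus_IZR. Qed.

(* AM-GM: [2 u <= tau v u^2 + 1 / (tau v)]. *)
Lemma am_gm tau v u : 0 < tau -> 0 < v -> u <= tau / 2 * (v * u ^ 2) + / (2 * tau) * / v.
Proof.
  intros Ht Hv.
  assert (E : tau / 2 * (v * u ^ 2) + / (2 * tau) * / v - u = (tau * v * u - 1) ^ 2 * / (2 * tau * v))
    by (field; lra).
  assert (0 <= (tau * v * u - 1) ^ 2 * / (2 * tau * v)).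
  { apply Rmult_le_pos; [apply pow2_ge_0 |]. left. apply Rinv_0_lt_compat. nra. }
  lra.
Qed.

Section Windows.
Variables (c3 A r al : R) (g : Z -> R).
Hypotheses (Hc3 : 0 < c3) (HA : 0 <= A) (Hr : 1 <= r) (Hg : forall j, 0 <= g j).
Let N := r ^ 8.
Let X := 3 * c3 * N ^ 2.

Lemma powr_pos i : 0 < r ^ i.
Proof. apply pow_lt; lra. Qed.

(** Cauchy-Schwarz in its AM-GM form: the weighted l2 norm against the tail of the sum of 1 / (j -
    al)^2. The extra 1 in the left case allows for cut points rounded upwards by [up]. *)
Lemma tail_window (K : R) (p q : Z) : 1 <= K -> 2 <= X -> (p <= q)%Z ->
  (forall m, zsum (fun j => (IZR j - al) ^ 2 * g j ^ 2) p m <= A * N ^ 3) ->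
  (X * K ^ 2 <= IZR p - al \/ IZR q - al <= - X * K ^ 2 + 1) ->
  zseg g p q <= r ^ 4 * ((A / 2 + / (3 * c3)) * / K).
Proof.
  intros HK HX Hpq HS HY.
  (* Balances the two terms: with N^3 = r^24 and Y = 3 c3 r^16 K^2 both have size r^4 / K. *)
  set (tau := / (r ^ 20 * K)).
  assert (R20 := powr_pos 20). assert (R4 := powr_pos 4). assert (R16 := powr_pos 16).
  assert (Htau : 0 < tau) by (apply Rinv_0_lt_compat; nra).
  assert (HK2 : 1 <= K ^ 2) by (apply pow_R1_Rle; lra).
  set (Y := X * K ^ 2) in *. assert (HY2 : 2 <= Y) by (unfold Y; nra).
  assert (HX0 : X = 3 * c3 * r ^ 16) by (unfold X, N; ring).
  set (m := Z.to_nat (q - p)).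
  assert (Eq : (p + Z.of_nat m = q)%Z) by (unfold m; lia).
  assert (Inv : zsum (fun j => / (IZR j - al) ^ 2) p m <= 2 / Y).
  { assert (H2 : / (Y - 1) <= 2 / Y).
    { replace (2 / Y) with (/ (Y / 2)) by (field; lra). apply Rinv_le_contravar; lra. }
    destruct HY as [HY | HY].
    - eapply Rle_trans; [apply inv_sq_sum_right; lra |].
      assert (/ (IZR p - al - 1) <= / (Y - 1)) by (apply Rinv_le_contravar; lra).
      assert (0 < / (IZR (p + Z.of_nat m) - al - 1)).
      { apply Rinv_0_lt_compat. rewrite Eq. apply IZR_le in Hpq. lra. }
      lra.
    - assert (HY' : IZR q - al <= - Y + 1) by (unfold Y; lra).
      eapply Rle_trans; [apply inv_sq_sum_left; rewrite Eq; lra |]. rewrite Eq.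
      assert (/ (al - IZR q) <= / (Y - 1)) by (apply Rinv_le_contravar; lra).
      assert (0 < / (al - IZR p)).
      { apply Rinv_0_lt_compat. apply IZR_le in Hpq. lra. }
      lra. }
  assert (B : zseg g p q <= tau / 2 * (A * N ^ 3) + / (2 * tau) * (2 / Y)).
  { unfold zseg. fold m.
    apply Rle_trans with (zsum (fun j => tau / 2 * ((IZR j - al) ^ 2 * g j ^ 2) +
      / (2 * tau) * / (IZR j - al) ^ 2) p m).
    - apply zsum_le. intros j Hj. apply am_gm; trivial.
      assert (IZR p <= IZR j) by (apply IZR_le; lia).
      assert (IZR j <= IZR q - 1).
      { rewrite <- (minus_IZR q 1). apply IZR_le; lia. }
      assert (IZR j - al <> 0). { unfold Y in *. destruct HY; nra. }
      apply pow2_gt_0. trivial.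
    - rewrite zsum_lin. apply Rplus_le_compat.
      + apply Rmult_le_compat_l; [lra | apply HS].
      + apply Rmult_le_compat_l; trivial. left. apply Rinv_0_lt_compat; lra. }
  eapply Rle_trans; [exact B |]. right.
  unfold tau, Y. rewrite HX0. unfold N.
  replace ((r ^ 8) ^ 3) with (r ^ 20 * r ^ 4) by ring. replace (r ^ 20) with (r ^ 16 * r ^ 4) by ring.
  field. repeat split; lra.
Qed.

(** Around y = 0, where the critical points merge, no pointwise formula is used: the number of
    indices and the l2 norm suffice, and both enter with a small factor eps. *)
Lemma middle_window (eps : R) (p q : Z) : 0 < eps -> (p <= q)%Z ->
  (forall m, zsum (fun j => g j ^ 2) p m <= A / N) ->
  IZR q - IZR p <= 2 * X * eps ^ 2 + 1 ->
  zseg g p q <= r ^ 4 * ((A / 2 + 3 * c3) * eps) + / (2 * eps) * r ^ 3.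
Proof.
  intros He Hpq HS Hlen.
  (* Balances A tau / N against X eps^2 / tau at size eps r^4, as N = r^8 and X = 3 c3 r^16. *)
  set (tau := eps * r ^ 12).
  assert (R12 := powr_pos 12). assert (R4 := powr_pos 4). assert (R8 := powr_pos 8).
  assert (R3 := powr_pos 3).
  assert (Htau : 0 < tau) by (unfold tau; nra).
  assert (HX0 : X = 3 * c3 * (r ^ 12 * r ^ 4)) by (unfold X, N; ring).
  set (m := Z.to_nat (q - p)).
  assert (B : zseg g p q <= tau / 2 * (A / N) + / (2 * tau) * (2 * X * eps ^ 2 + 1)).
  { unfold zseg. fold m.
    apply Rle_trans with (zsum (fun j => tau / 2 * (g j ^ 2) + / (2 * tau) * 1) p m).
    - apply zsum_le. intros j _. assert (X0 := am_gm tau 1 (g j) Htau Rlt_0_1).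
      rewrite Rinv_1, Rmult_1_l in X0. exact X0.
    - rewrite (zsum_lin (fun j => g j ^ 2) (fun _ => 1)). apply Rplus_le_compat.
      + apply Rmult_le_compat_l; [lra | apply HS].
      + apply Rmult_le_compat_l. left. apply Rinv_0_lt_compat; lra.
        rewrite zsum_const. unfold m. rewrite INR_seg by trivial. lra. }
  eapply Rle_trans; [exact B |].
  replace (tau / 2 * (A / N) + / (2 * tau) * (2 * X * eps ^ 2 + 1)) with
    (r ^ 4 * ((A / 2 + 3 * c3) * eps) + / (2 * eps) * / r ^ 12).
  2:{ unfold tau. rewrite HX0. unfold N. replace (r ^ 12) with (r ^ 8 * r ^ 4) by ring.
      field. repeat split; lra. }
  apply Rplus_le_compat_l. apply Rmult_le_compat_l.
  - left. apply Rinv_0_lt_compat; lra.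
  - apply Rle_trans with 1.
    + rewrite <- Rinv_1. apply Rinv_le_contravar; [lra | apply pow_R1_Rle; lra].
    + apply pow_R1_Rle; lra.
Qed.

(** O(N^2) indices with terms O(1 / N^2) contribute O(1); the rounding term 1 is absorbed by
    r^16. *)
Lemma bounded_window (C K : R) (p q : Z) : (p <= q)%Z -> 0 <= C ->
  IZR q - IZR p <= X * K ^ 2 + 1 -> (forall j, (p <= j < q)%Z -> g j <= C / N ^ 2) ->
  zseg g p q <= (3 * c3 * K ^ 2 + 1) * C.
Proof.
  intros Hpq HC Hlen Hb. assert (R16 := powr_pos 16).
  assert (HX0 : X = 3 * c3 * r ^ 16) by (unfold X, N; ring).
  assert (HN2 : N ^ 2 = r ^ 16) by (unfold N; ring).
  assert (1 <= r ^ 16) by (apply pow_R1_Rle; lra).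
  unfold zseg. eapply Rle_trans.
  { apply (zsum_le _ (fun _ => C / N ^ 2)). intros j Hj. apply Hb. lia. }
  rewrite zsum_const, INR_seg, HN2 by trivial.
  apply Rle_trans with ((X * K ^ 2 + r ^ 16) * (C / r ^ 16)).
  - apply Rmult_le_compat_r; [| lra]. apply Rmult_le_pos; trivial. left. now apply Rinv_0_lt_compat.
  - rewrite HX0. right. field. lra.
Qed.
End Windows.

(* The sum is cut at [y = - X K^2, - X eps^2, X eps^2, X K^2] with [X = 3 c3 N^2]: the outer
   pieces are bounded by the weighted l2 norm, the middle one by the l2 norm, the fourth
   by the nonstationary bound on the model; the second carries the limit. *)
Lemma l1_norm_estimate (a : Z -> C) (k : nat) (alpha c3 c4 : R) :
  assumption_A a alpha c3 c4 -> 0 < c3 -> support_in a k ->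
  exists A0, 0 <= A0 /\ forall eps K, 0 < eps <= 1 -> 1 <= K ->
  exists C r0, 1 <= r0 /\ forall n r, r0 <= r -> r ^ 32 = INR n ->
  Rabs (RsumZ (fun j => Cmod (green a n j)) -
    r ^ 4 * (4 * sqrt 3 * sqrt c3 / (PI * sqrt PI)) *
      RInt (fun x => sqrt x * exp (- c4 * x ^ 4)) eps K) <=
  r ^ 4 * (A0 * (eps + / K)) + C * r ^ 3.
Proof.
  intros HA Hc3 Ha. assert (Hc4 : 0 < c4) by apply HA.
  destruct (green_bounds a k alpha c3 c4 HA Ha) as [A [HA0 GB]].
  destruct (model_lip c3 c4 Hc4) as [L [HL ML]].
  assert (I3 : 0 < / (3 * c3)) by (apply Rinv_0_lt_compat; lra).
  exists (2 * (A / 2 + / (3 * c3)) + (A / 2 + 3 * c3)). split; [lra |].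
  intros eps K He HK.
  destruct (model_main_window c3 c4 eps K Hc3 Hc4 ltac:(lra)) as [B [r1 [Hr1 MW]]].
  set (C2 := 3 * c3 * K ^ 2 + 1).
  set (Cp := / (3 * c3 * eps ^ 2) + A).
  (* In the constant, 1 / (2 eps) comes from the middle window, C2 Cp from the side without critical
     points, C2 A from replacing the Green's function by the model, C2 L from passing to an
     integral, 2 from rounding its ends, and B from the main window. The threshold contains 2 for n
     >= 2 and 1 / c3 for X >= 2. *)
  exists (/ (2 * eps) + C2 * Cp + (C2 * A + C2 * L + 2 + B)), (r1 + 2 + / c3).
  assert (Ic3 : 0 < / c3) by now apply Rinv_0_lt_compat.
  split; [lra |]. intros n r Hr Hn.
  assert (Hr0 : 1 <= r) by lra.
  assert (Pr : forall i, 1 <= r ^ i) by (intros; apply pow_R1_Rle; lra).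
  set (N := r ^ 8). assert (HN : 1 <= N) by apply Pr.
  assert (HN4 : N ^ 4 = INR n) by (rewrite <- Hn; unfold N; ring).
  assert (Hn2 : (2 <= n)%nat).
  { apply INR_le. rewrite <- Hn. simpl (INR 2).
    apply Rle_trans with (r ^ 1); [simpl; lra | apply Rle_pow; [lra | lia]]. }
  destruct (GB n N Hn2 ltac:(lra) HN4) as [G1 [G2 G3]].
  set (al := alpha * INR n) in *.
  set (g := fun j => Cmod (green a n j)).
  assert (Hg : forall j, 0 <= g j) by (intros; apply Cmod_ge_0).
  set (X := 3 * c3 * N ^ 2).
  assert (HX : 2 <= X).
  { unfold X. assert (r <= N ^ 2).
    { replace (N ^ 2) with (r ^ 16) by (unfold N; ring). rewrite <- (pow_1 r) at 1. apply Rle_pow; [lra | lia]. }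
    assert (c3 * / c3 = 1) by (apply Rinv_r; lra).
    assert (c3 * / c3 <= c3 * N ^ 2) by (apply Rmult_le_compat_l; lra). lra. }
  assert (He2 : 0 < eps ^ 2) by (apply pow_lt; lra).
  assert (HK2 : 1 <= K ^ 2) by (apply pow_R1_Rle; lra).
  assert (HeK : eps ^ 2 <= K ^ 2) by (apply pow_incr; lra).
  assert (HXe : 0 < X * eps ^ 2) by nra.
  assert (HXeK : X * eps ^ 2 <= X * K ^ 2) by (apply Rmult_le_compat_l; lra).
  set (p1 := up (al - X * K ^ 2)). set (p2 := up (al - X * eps ^ 2)).
  set (p3 := up (al + X * eps ^ 2)). set (p4 := up (al + X * K ^ 2)).
  assert (P12 : (p1 <= p2)%Z) by (apply up_le; lra).
  assert (P23 : (p2 <= p3)%Z) by (apply up_le; lra).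
  assert (P34 : (p3 <= p4)%Z) by (apply up_le; lra).
  assert (U1 := up_spec (al - X * K ^ 2)). fold p1 in U1.
  assert (U2 := up_spec (al - X * eps ^ 2)). fold p2 in U2.
  assert (U3 := up_spec (al + X * eps ^ 2)). fold p3 in U3.
  assert (U4 := up_spec (al + X * K ^ 2)). fold p4 in U4.
  (* Large enough to cover the support of the Green's function and all cut points. *)
  set (J := (n * k + Z.abs_nat p1 + Z.abs_nat p4)%nat).
  set (q0 := (- Z.of_nat J)%Z). set (q5 := (Z.of_nat J + 1)%Z).
  assert (Esum : RsumZ g = zseg g q0 p1 + zseg g p1 p2 + zseg g p2 p3 + zseg g p3 p4 + zseg g p4 q5).
  { rewrite (RsumZ_finite g J).
    - replace (zsum g (- Z.of_nat J) (2 * J + 1)) with (zseg g q0 q5).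
      2:{ unfold zseg, q0, q5. f_equal. lia. }
      rewrite (zseg_app g q0 p4 q5), (zseg_app g q0 p3 p4), (zseg_app g q0 p2 p3), (zseg_app g q0 p1 p2);
        trivial; unfold q0, q5, J; lia.
    - intros l Hl. unfold g. rewrite (green_support a k n Ha l) by (unfold J in Hl; lia).
      apply Cmod_0. }
  assert (T0 : 0 <= zseg g q0 p1 <= r ^ 4 * ((A / 2 + / (3 * c3)) * / K)).
  { split.
    - now apply zseg_nonneg.
    - apply (tail_window c3 A r al g Hc3 Hr0 K q0 p1 HK HX).
      + unfold q0, J; lia.
      + intros m. apply G2.
      + right. fold N. fold X. lra. }
  assert (T5 : 0 <= zseg g p4 q5 <= r ^ 4 * ((A / 2 + / (3 * c3)) * / K)).
  { split.
    - now apply zseg_nonneg.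
    - apply (tail_window c3 A r al g Hc3 Hr0 K p4 q5 HK HX).
      + unfold q5, J; lia.
      + intros m. apply G2.
      + left. fold N. fold X. lra. }
  assert (T2 : 0 <= zseg g p2 p3 <= r ^ 4 * ((A / 2 + 3 * c3) * eps) + / (2 * eps) * r ^ 3).
  { split.
    - now apply zseg_nonneg.
    - apply (middle_window c3 A r g Hr0 eps p2 p3); [lra | exact P23 | intros m; apply G1 |].
      fold N. fold X. lra. }
  assert (HN2 : 1 <= N ^ 2) by (apply pow_R1_Rle; lra).
  assert (HC2 : 1 <= C2) by (unfold C2; nra).
  assert (HCp : 0 <= Cp).
  { unfold Cp. assert (0 < / (3 * c3 * eps ^ 2)) by (apply Rinv_0_lt_compat; nra). lra. }
  assert (T3 : 0 <= zseg g p3 p4 <= C2 * Cp).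
  { split.
    - now apply zseg_nonneg.
    - apply (bounded_window c3 r g Hr0 Cp K p3 p4); [exact P34 | exact HCp | |].
      + fold N. fold X. lra.
      + intros j Hj. fold N. set (y := IZR j - al).
        assert (IZR p3 <= IZR j) by (apply IZR_le; lia).
        assert (Hy : X * eps ^ 2 <= y) by (unfold y; lra).
        assert (M1 := model_nonstationary c3 c4 N y Hc3 Hc4 ltac:(lra) ltac:(lra)).
        assert (M2 := G3 j). fold y in M2.
        replace (g j) with (Cmod ((green a n j - RtoC (model c3 c4 N y)) + RtoC (model c3 c4 N y))%C)
          by (unfold g; f_equal; ring).
        eapply Rle_trans; [apply Cmod_triangle |]. rewrite Cmod_R.
        assert (/ y <= / (X * eps ^ 2)) by (apply Rinv_le_contravar; lra).
        replace (Cp / N ^ 2) with (A / N ^ 2 + / (X * eps ^ 2)); [lra |].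
        unfold Cp, X. field. lra. }
  set (fM := fun y => Rabs (model c3 c4 N y)).
  assert (CM : forall y, continuous fM y).
  { intros y. apply continuous_Rabs_comp, model_cont; lra. }
  assert (XM : forall u v, ex_RInt fM u v).
  { intros. apply ex_RInt_cont_all. auto. }
  assert (M0 : forall y, Rabs (fM y) <= 1).
  { intros y. unfold fM. rewrite Rabs_Rabsolu. now apply model_abs_le_1. }
  set (m := Z.to_nat (p2 - p1)).
  assert (Em : (p1 + Z.of_nat m = p2)%Z) by (unfold m; lia).
  assert (Hm : INR m <= C2 * N ^ 2).
  { unfold m. rewrite INR_seg by trivial. unfold C2, X in *. lra. }
  assert (Hm0 : 0 <= INR m) by apply pos_INR.
  assert (Cnt : forall D, 0 <= D -> INR m * (D / N ^ 2) <= C2 * D).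
  { intros D HD. apply Rle_trans with (C2 * N ^ 2 * (D / N ^ 2)); [| right; field; lra].
    apply Rmult_le_compat_r; trivial. apply Rmult_le_pos; trivial. left. apply Rinv_0_lt_compat; lra. }
  assert (S1 : Rabs (zseg g p1 p2 - zsum (fun j => fM (IZR j - al)) p1 m) <= C2 * A).
  { unfold zseg. fold m.
    replace (zsum g p1 m - zsum (fun j => fM (IZR j - al)) p1 m) with
      (1 * zsum g p1 m + -1 * zsum (fun j => fM (IZR j - al)) p1 m) by (simpl; ring).
    rewrite <- zsum_lin. eapply Rle_trans; [| apply Cnt; exact HA0].
    apply zsum_abs_le. intros j _. unfold g, fM.
    rewrite <- (Cmod_R (model c3 c4 N (IZR j - al))).
    replace (1 * Cmod (green a n j) + -1 * Cmod (RtoC (model c3 c4 N (IZR j - al)))) with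
      (Cmod (green a n j) - Cmod (RtoC (model c3 c4 N (IZR j - al)))) by ring.
    eapply Rle_trans; [| apply (G3 j)].
    fold al. set (u := green a n j). set (v := RtoC (model c3 c4 N (IZR j - al))).
    apply Rabs_le. split.
    - assert (Cmod v <= Cmod u + Cmod (u - v)%C); [| lra].
      replace v with (u + - (u - v))%C at 1 by ring.
      eapply Rle_trans; [apply Cmod_triangle |]. rewrite Cmod_opp. lra.
    - assert (Cmod u <= Cmod v + Cmod (u - v)%C); [| lra].
      replace u with (v + (u - v))%C at 1 by ring. apply Cmod_triangle. }
  assert (S2 : Rabs (zsum (fun j => fM (IZR j - al)) p1 m - RInt fM (IZR p1 - al) (IZR p2 - al)) <= C2 * L).
  { rewrite <- Em. eapply Rle_trans; [apply (zsum_RInt_lip fM (L / N ^ 2)); trivial |].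
    - intros x y. unfold fM. eapply Rle_trans; [apply Rabs_triang_inv2 |]. apply ML. lra.
    - apply Rmult_le_pos; trivial. left. apply Rinv_0_lt_compat; lra.
    - now apply Cnt. }
  (* Rounding moves each end by at most 1, and the model is bounded by 1. *)
  assert (S3 : Rabs (RInt fM (IZR p1 - al) (IZR p2 - al) - RInt fM (- X * K ^ 2) (- X * eps ^ 2)) <= 2).
  { rewrite <- (RInt_Chasles_R fM (- X * K ^ 2) (IZR p1 - al) (- X * eps ^ 2)) by apply XM.
    rewrite <- (RInt_Chasles_R fM (IZR p1 - al) (- X * eps ^ 2) (IZR p2 - al)) by apply XM.
    assert (Q1 := RInt_abs_le_const fM (- X * K ^ 2) (IZR p1 - al) 1 ltac:(lra) (XM _ _) ltac:(auto)).
    assert (Q2 := RInt_abs_le_const fM (- X * eps ^ 2) (IZR p2 - al) 1 ltac:(lra) (XM _ _) ltac:(auto)).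
    match goal with |- Rabs (?u + ?v - (?w + ?z)) <= _ =>
      replace (u + v - (w + z)) with (v + - w) by ring end.
    eapply Rle_trans; [apply Rabs_triang |]. rewrite Rabs_Ropp. lra. }
  assert (S4 := MW r ltac:(lra)). cbv zeta in S4. fold N in S4.
  replace (- 3 * c3 * N ^ 2 * K ^ 2) with (- X * K ^ 2) in S4 by (unfold X; ring).
  replace (- 3 * c3 * N ^ 2 * eps ^ 2) with (- X * eps ^ 2) in S4 by (unfold X; ring).
  change (fun j => Cmod (green a n j)) with g. rewrite Esum.
  set (MT := r ^ 4 * _ * _) in *.
  change (RInt (fun y => Rabs (model c3 c4 N y))) with (RInt fM) in S4.
  set (R1 := RInt fM (- X * K ^ 2) (- X * eps ^ 2)) in *.
  set (R2 := RInt fM (IZR p1 - al) (IZR p2 - al)) in *.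
  set (Z1 := zsum (fun j => fM (IZR j - al)) p1 m) in *.
  assert (R3 := Pr 3%nat). assert (R4 := Pr 4%nat).
  assert (IK : 0 < / K) by (apply Rinv_0_lt_compat; lra).
  assert (Ie : 0 < / (2 * eps)) by (apply Rinv_0_lt_compat; lra).
  apply Rabs_le_between in S1. apply Rabs_le_between in S2. apply Rabs_le_between in S3.
  apply Rabs_le_between in S4.
  assert (Y1 : C2 * A + C2 * L + 2 <= (C2 * A + C2 * L + 2) * r ^ 3).
  { rewrite <- (Rmult_1_r (C2 * A + C2 * L + 2)) at 1. apply Rmult_le_compat_l; trivial.
    assert (0 <= C2 * A) by nra. assert (0 <= C2 * L) by nra. lra. }
  assert (Y2 : C2 * Cp <= C2 * Cp * r ^ 3).
  { rewrite <- (Rmult_1_r (C2 * Cp)) at 1. apply Rmult_le_compat_l; trivial. nra. }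
  assert (Y3 : 0 <= r ^ 4 * ((A / 2 + / (3 * c3)) * eps)) by (apply Rmult_le_pos; [lra | apply Rmult_le_pos; lra]).
  assert (Y4 : 0 <= r ^ 4 * ((A / 2 + 3 * c3) * / K)) by (apply Rmult_le_pos; [lra | apply Rmult_le_pos; lra]).
  assert (Y5 : 0 <= r ^ 4 * ((A / 2 + / (3 * c3)) * / K)) by lra.
  assert (Y6 : 0 <= r ^ 4 * ((A / 2 + 3 * c3) * eps)) by (apply Rmult_le_pos; [lra | apply Rmult_le_pos; lra]).
  assert (Y7 : 0 <= / (2 * eps) * r ^ 3) by (apply Rmult_le_pos; lra).
  clear - S1 S2 S3 S4 T0 T5 T2 T3 Y1 Y2 Y3 Y4 Y5 Y6 Y7.
  apply Rabs_le. split; lra.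
Qed.

Lemma constant_identity (c3 c4 : R) : 0 < c3 ->
  4 * sqrt 3 * sqrt c3 / (PI * sqrt PI) * (2 / 3 * / Rpower c4 (3 / 8) * Gamma (11 / 8)) =
  8 * Gamma (11 / 8) / (sqrt 3 * Rpower PI (3 / 2)) * (Rpower c3 (1 / 2) / Rpower c4 (3 / 8)).
Proof.
  intros Hc3. assert (HP := PI_RGT_0).
  replace (1 / 2) with (/ 2) by field. rewrite Rpower_sqrt by trivial.
  replace (Rpower PI (3 / 2)) with (PI * sqrt PI).
  2:{ rewrite <- (Rpower_1 PI) at 1 by trivial. rewrite <- (Rpower_sqrt PI) by trivial.
      rewrite <- Rpower_plus. f_equal. field. }
  assert (0 < sqrt PI) by now apply sqrt_lt_R0.
  assert (0 < sqrt 3) by (apply sqrt_lt_R0; lra).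
  assert (H3 : sqrt 3 * sqrt 3 = 3) by (apply sqrt_sqrt; lra).
  assert (0 < Rpower c4 (3 / 8)) by apply exp_pos.
  set (G := Gamma (11 / 8)).
  apply Rminus_diag_uniq.
  transitivity ((sqrt 3 * sqrt 3 - 3) * (8 / 3 * sqrt c3 * G / (PI * sqrt PI * sqrt 3 * Rpower c4 (3 / 8)))).
  - field. repeat split; lra.
  - rewrite H3. ring.
Qed.

Theorem corollary2 (a : Z -> C) (alpha c3 c4 : R)
  (hA : assumption_A a alpha c3 c4) (hc3 : 0 < c3) :
  is_lim_seq
    (fun n : nat =>
       / Rpower (INR n) (1 / 8) * RsumZ (fun j : Z => Cmod (green a n j)))
    (8 * Gamma (11 / 8) / (sqrt 3 * Rpower PI (3 / 2)) *
       (Rpower c3 (1 / 2) / Rpower c4 (3 / 8))).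
Proof.
  assert (Hc4 : 0 < c4) by apply hA.
  destruct (finitely_supported_nat a (proj1 hA)) as [k Hk].
  destruct (l1_norm_estimate a k alpha c3 c4 hA hc3 Hk) as [A0 [HA0 LE]].
  destruct (quartic_gamma c4 Hc4) as [A1 [HA1 QG]].
  rewrite <- constant_identity by trivial.
  set (c0 := 4 * sqrt 3 * sqrt c3 / (PI * sqrt PI)) in *.
  set (G := 2 / 3 * / Rpower c4 (3 / 8) * Gamma (11 / 8)) in *.
  assert (Hc0 : 0 <= c0).
  { assert (HP := PI_RGT_0). unfold c0.
    assert (0 < sqrt PI) by now apply sqrt_lt_R0.
    assert (0 <= sqrt 3) by apply sqrt_pos. assert (0 <= sqrt c3) by apply sqrt_pos.
    apply Rmult_le_pos; [nra | left; apply Rinv_0_lt_compat; nra]. }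
  apply is_lim_seq_spec. intros e.
  set (Q := A0 + c0 * A1). assert (HQ : 0 <= Q) by (unfold Q; nra).
  (* One parameter suffices, with eps = 1 / K: the error Q (eps + 1 / K) that remains after division
     by r^4 is then at most e / 4. *)
  set (K := 1 + 8 * Q / e).
  assert (He := cond_pos e).
  assert (HK : 1 <= K).
  { unfold K. assert (0 <= 8 * Q / e); [| lra]. apply Rmult_le_pos; [lra |].
    left; now apply Rinv_0_lt_compat. }
  assert (IK : 0 < / K <= 1).
  { split. apply Rinv_0_lt_compat; lra. rewrite <- Rinv_1. apply Rinv_le_contravar; lra. }
  assert (HKQ : Q * (/ K + / K) <= e / 4).
  { apply Rmult_le_reg_r with K; [lra |].
    replace (Q * (/ K + / K) * K) with (2 * Q) by (field; lra).
    unfold K. replace (e / 4 * (1 + 8 * Q / e)) with (e / 4 + 2 * Q) by (field; lra). lra. }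
  destruct (LE (/ K) K IK HK) as [C [r0 [Hr0 Est]]].
  specialize (QG (/ K) K IK HK).
  set (IG := RInt (fun x => sqrt x * exp (- c4 * x ^ 4)) (/ K) K) in *.
  (* From [rr] on, C r^3 is at most (e / 4) r^4; together with the previous e / 4 the total stays
     below [e]. *)
  set (rr := r0 + 4 * Rabs C / e).
  assert (Hrr : r0 <= rr).
  { unfold rr. assert (0 <= 4 * Rabs C / e); [| lra]. apply Rmult_le_pos.
    generalize (Rabs_pos C); lra. left; now apply Rinv_0_lt_compat. }
  destruct (nfloor_ex (rr ^ 32)) as [n0 Hn0]. { apply pow_le; lra. }
  exists (S n0). intros n Hn.
  assert (Hnr : rr ^ 32 <= INR n).
  { apply Rle_trans with (INR n0 + 1); [lra |]. rewrite <- S_INR. now apply le_INR. }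
  assert (Hn1 : 0 < INR n).
  { apply (lt_INR 0). lia. }
  set (r := Rpower (INR n) (/ 32)).
  assert (Hr : r ^ 32 = INR n).
  { unfold r. rewrite <- Rpower_pow by apply exp_pos. rewrite Rpower_mult.
    replace (/ 32 * INR 32) with 1 by (simpl; field). now apply Rpower_1. }
  assert (Hr4 : Rpower (INR n) (1 / 8) = r ^ 4).
  { unfold r. rewrite <- Rpower_pow by apply exp_pos. rewrite Rpower_mult. f_equal. simpl. field. }
  assert (Hrpos : 0 < r) by apply exp_pos.
  assert (Hrrr : rr <= r).
  { replace rr with (Rpower (rr ^ 32) (/ 32)).
    - apply Rle_Rpower_l; [lra |]. split; [apply pow_lt; lra | exact Hnr].
    - rewrite <- Rpower_pow by lra. rewrite Rpower_mult.
      replace (INR 32 * / 32) with 1 by (simpl; field). apply Rpower_1. lra. }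
  assert (E := Est n r ltac:(lra) Hr).
  rewrite Hr4.
  set (S := RsumZ (fun j : Z => Cmod (green a n j))) in *.
  assert (R4 : 0 < r ^ 4) by now apply pow_lt.
  assert (HC : Rabs C <= e / 4 * r).
  { assert (4 * Rabs C / e <= r) by (unfold rr in Hrrr; lra).
    apply Rmult_le_reg_l with (4 / e). { apply Rdiv_lt_0_compat; lra. }
    replace (4 / e * (e / 4 * r)) with r by (field; lra).
    replace (4 / e * Rabs C) with (4 * Rabs C / e) by (field; lra). lra. }
  assert (E1 : Rabs (S - r ^ 4 * c0 * IG) <= r ^ 4 * (A0 * (/ K + / K) + e / 4)).
  { eapply Rle_trans; [exact E |]. rewrite (Rmult_plus_distr_l (r ^ 4) (A0 * _)). apply Rplus_le_compat_l.
    assert (R3 : 0 < r ^ 3) by now apply pow_lt.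
    replace (r ^ 4 * (e / 4)) with (e / 4 * r * r ^ 3) by (simpl; field).
    apply Rmult_le_compat_r; [lra |]. generalize (Rle_abs C). lra. }
  replace (/ r ^ 4 * S - c0 * G) with
    (/ r ^ 4 * (S - r ^ 4 * c0 * IG) + c0 * (IG - G)) by (field; lra).
  assert (E2 : Rabs (/ r ^ 4 * (S - r ^ 4 * c0 * IG)) <= A0 * (/ K + / K) + e / 4).
  { rewrite Rabs_mult, Rabs_right by (left; now apply Rinv_0_lt_compat).
    apply Rmult_le_reg_l with (r ^ 4); trivial.
    rewrite <- Rmult_assoc, Rinv_r, Rmult_1_l by lra. exact E1. }
  assert (E3 : Rabs (c0 * (IG - G)) <= c0 * A1 * (/ K + / K)).
  { rewrite Rabs_mult, Rabs_right, Rmult_assoc by lra. now apply Rmult_le_compat_l. }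
  eapply Rle_lt_trans; [apply Rabs_triang |].
  unfold Q in HKQ. lra.
Qed.
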